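(* Let $F$ be a number field and let $\Delta$ be the absolute value of its discriminant. For every Arakelov divisor $D$ on $F$, $$h^0(D)-h^1(D)=\deg D-\tfrac12\log\Delta .$$
   Context: **Ghost-spaces and dimensions.** A function $f:G\to\mathbb C$ on an abelian group is positive-definite if for all $x_1,\dots,x_n\in G$ the matrix $(f(x_j-x_i))_{i,j}$ is Hermitian nonnegative-definite. If $G$ is a locally compact abelian group and $u:G\to\mathbb R_{>0}$ is continuous and positive-definite with $u(0)=1$, the ghost-space of the first kind $G_u$ is $G$ together with the convolution of measures determined by $\delta_x*\delta_y=\frac{u(x)u(y)}{u(x+y)}\delta_{x+y}$. If $G$ is discrete, its dimension is $\dim G_u=\log\sum_{x\in G}u(x)$. If $\mu$ is a positive-definite, even probability measure on $G$, the ghost-space of the second kind $G^{\mu}$ is $G$ together with the convolution determined by $\delta_x*\delta_y=T_{x+y}\mu$, where $T_z$ denotes translation of measures by $z$. If $G$ is compact with probability Haar measure $m$ and $\mu=h\cdot m$ with $h$ a continuous density, its dimension is $\dim G^{\mu}=\log h(0)$. **Arakelov divisors.** Let $O_F$ be the ring of integers of $F$. An Arakelov divisor on $F$ is a formal sum $D=\sum_P x_P P+\sum_\sigma x_\sigma\sigma$, where $P$ runs over the maximal ideals of $O_F$, $x_P\in\mathbb Z$ (almost all zero), and $\sigma$ runs over the infinite places of $F$, $x_\sigma\in\mathbb R$. Its degree is $\deg D=\sum_P x_P\log N(P)+\sum_\sigma x_\sigma$, with $N(P)=|O_F/P|$. The associated fractional ideal is $I=\prod_P P^{-x_P}$. We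 identify $I\otimes\mathbb R=F\otimes\mathbb R=\prod_{\sigma\text{ real}}\mathbb R\times\prod_{\sigma\text{ complex}}\mathbb C$, and for $z=(z_\sigma)$ in it put $\|z\|_D^2=\sum_\sigma |z_\sigma|^2\,\|1\|_\sigma^2$, where $\|1\|_\sigma^2=e^{-2x_\sigma}$ for real $\sigma$ and $\|1\|_\sigma^2=2e^{-x_\sigma}$ for complex $\sigma$. **Cohomology.** $H^0(D)$ is the ghost-space of the first kind $I_u$ with $u(x)=e^{-\pi\|x\|_D^2}$ on the discrete group $I$, and $h^0(D)=\dim H^0(D)=\log\sum_{x\in I}e^{-\pi\|x\|_D^2}$. $H^1(D)$ is defined as $((I\otimes\mathbb R)/I)/((I\otimes\mathbb R)_u/I_u)$, where $u(x)=e^{-\pi\|x\|_D^2}$ on $I\otimes\mathbb R$. Here the inner quotient is the ghost-space of the first kind $((I\otimes\mathbb R)/I)_v$ with $$v(\overline{x})=\frac{\sum_{y\in I}e^{-\pi\|x+y\|_D^2}}{\sum_{y\in I}e^{-\pi\|y\|_D^2}},$$ and the outer quotient is the ghost-space of the second kind $((I\otimes\mathbb R)/I)^{\mu}$, where $\mu$ is the probability measure on the compact group $(I\otimes\mathbb R)/I$ proportional to $v\cdot m$, $m$ being the probability Haar measure. Finally $h^1(D)=\dim H^1(D)$, the dimension of this ghost-space of the second kind. *)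

(* Defs.v *)
From HB Require Import structures.
From mathcomp Require Import all_boot all_order all_algebra all_field.
From mathcomp Require Import ring_quotient generic_quotient complex finmap.
From mathcomp Require Import all_classical all_reals all_analysis.

Set Implicit Arguments.
Unset Strict Implicit.
Unset Printing Implicit Defensive.

Import Order.TTheory GRing.Theory Num.Theory.
Import numFieldNormedType.Exports.

Local Open Scope classical_set_scope.
Local Open Scope ring_scope.

Definition borel (G : topologicalZmodType) : Type := G.

Section Borel.
Variable G : topologicalZmodType.
HB.instance Definition _ := Choice.on (borel G).
HB.instance Definition _ := isPointed.Build (borel G) (0 : G).
HB.instance Definition _ := @isMeasurable.Build (sigma_display (@open G))
  (borel G) <<s @open G >> (@sigma_algebra0 _ setT (@open G))
  (@sigma_algebraC (borel G) (@open G))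
  (@sigma_algebra_bigcup _ setT (@open G)).
End Borel.

(* V / L, with the group structure of ring_quotient and the quotient topology *)
Definition quot_group (V : topologicalZmodType) (L : zmodClosed V) : Type :=
  quotient_topology {ideal_quot L}.

Section QuotGroup.
Variables (V : topologicalZmodType) (L : zmodClosed V).
Local Open Scope quotient_scope.

HB.instance Definition _ := Topological.on (quot_group L).
HB.instance Definition _ := generic_quotient.Quotient.on (quot_group L).
HB.instance Definition _ := GRing.isZmodule.Build (quot_group L)
  (@ring_quotient.Quotient.addqA V L) (@ring_quotient.Quotient.addqC V L)
  (@ring_quotient.Quotient.add0q V L) (@ring_quotient.Quotient.addNq V L).

Local Notation proj := (\pi_(quot_group L) : V -> quot_group L).

Lemma quot_group_eqP (x y : V) : proj x = proj y <-> x - y \in L.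
Proof.
rewrite (ring_quotient.Quotient.idealrBE L); split => [pxy|/eqP pxy]; last exact: pxy.
apply/eqP; exact: pxy.
Qed.

Lemma quot_group_piD (x y : V) : proj (x + y) = proj x + proj y.
Proof. exact: (ring_quotient.Quotient.pi_add L x y). Qed.
Lemma quot_group_piN (x : V) : proj (- x) = - proj x.
Proof. exact: (ring_quotient.Quotient.pi_opp L x). Qed.
Lemma quot_group_piB (x y : V) : proj (x - y) = proj x - proj y.
Proof. by rewrite quot_group_piD quot_group_piN. Qed.

Lemma quot_group_nbhs (x : V) (A : set V) :
  nbhs x A -> nbhs (proj x) (proj @` A).
Proof.
rewrite nbhsE => -[B [oB Bx] BA].
rewrite nbhsE; exists (proj @` B); last exact: image_subset.
split; last by exists x.
rewrite -[open _]/(open (proj @^-1` (proj @` B))).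
suff -> : proj @^-1` (proj @` B) = \bigcup_(l in [set l : V | l \in L])
    ((fun z : V => z - l) @^-1` B).
  apply: bigcup_open => l _; apply: open_comp oB => z _ /=.
  apply: (@continuous_comp _ _ _ (fun z : V => (z, l)) (fun p : V * V => p.1 - p.2)).
    by apply: cvg_pair => /=; [exact: cvg_id | exact: cvg_cst].
  exact: sub_continuous.
apply/seteqP; split=> [z [b Bb bz]|z [l lL Bzl]].
  exists (z - b); last by rewrite /= opprB addrC subrK.
  exact/quot_group_eqP.
by exists (z - l) => //; apply/quot_group_eqP; rewrite addrAC subrr add0r rpredN.
Qed.

Lemma quot_group_sub_continuous :
  continuous (fun q : quot_group L * quot_group L => q.1 - q.2).
Proof.
move=> [q r] W /= nW.
have {nW} : nbhs (repr q - repr r) (proj @^-1` W).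
  apply: (@pi_continuous V {ideal_quot L} (repr q - repr r)).
  move: nW; rewrite -{1}[q]reprK -{1}[r]reprK -quot_group_piB; exact.
move=> /(@sub_continuous V (repr q, repr r)) [[A B] /= [nA nB] AB].
exists (proj @` A, proj @` B).
  by split; [rewrite -[q]reprK|rewrite -[r]reprK]; exact: quot_group_nbhs.
move=> [_ _] [/= [a Aa <-] [b Bb <-]]; rewrite -quot_group_piB.
exact: (AB (a, b)).
Qed.

HB.instance Definition _ :=
  PreTopologicalNmodule_isTopologicalZmodule.Build (quot_group L)
    quot_group_sub_continuous.

End QuotGroup.

(* The probability Haar measure of a compact group G (`get` picks the unique
   translation-invariant Borel probability measure). *)
Definition haar (R : realType) (G : topologicalZmodType) : probability (borel G) R :=
  get [set m : probability (borel G) R |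
        forall (x : G) (A : set (borel G)), measurable A ->
          m [set (x + y : G) | y in A] = m A].

(* A ghost-space is recorded by the data (G, u), respectively (G, mu), which
   determine its convolution
     delta_x * delta_y = u(x)u(y)/u(x+y) delta_{x+y}   (first kind),
     delta_x * delta_y = T_{x+y} mu                    (second kind).
   The dimensions depend on these data only.  Positive-definiteness is a
   property of the data, not a field of the records. *)

Record ghost_first (R : realType) := GhostFirst {
  first_group :> zmodType;
  first_weight : first_group -> R }.

Record ghost_second (R : realType) := GhostSecond {
  second_group :> topologicalZmodType;
  second_measure : set (borel second_group) -> \bar R }.

(* for G discrete; the value is +oo if the sum diverges *)
Definition dim_first (R : realType) (X : ghost_first R) : \bar R :=
  lne (\esum_(x in [set: X]) (first_weight x)%:E).

(* the continuous density of mu with respect to the Haar measure; it is unique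
   because nonempty open sets have positive Haar measure *)
Definition haar_density (R : realType) (G : topologicalZmodType)
    (mu : set (borel G) -> \bar R) : G -> R :=
  xget (fun=> 0) [set h : G -> R | continuous h /\
    forall A : set (borel G), measurable A ->
      mu A = (\int[haar R G]_(x in A) (h x)%:E)%E].

(* for G compact: log h(0), where mu = h . m *)
Definition dim_second (R : realType) (X : ghost_second R) : \bar R :=
  lne (haar_density (@second_measure R X) 0)%:E.

(* the quotient V_u / L_u of ghost-spaces of the first kind *)
Definition quot_weight (R : realType) (V : topologicalZmodType) (L : zmodClosed V)
    (u : V -> R) (q : quot_group L) : R :=
  fine (\esum_(y in [set y : V | y \in L]) (u (repr q + y))%:E)
  / fine (\esum_(y in [set y : V | y \in L]) (u y)%:E).

(* the quotient of G by the ghost-space G_v, for G compact: the measure is the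
   multiple of v . m with total mass 1 *)
Definition quot_by_ghost (R : realType) (G : topologicalZmodType) (v : G -> R) :
    ghost_second R :=
  @GhostSecond R G (fun A =>
    (\int[haar R G]_(x in A) (v x)%:E)
    / (\int[haar R G]_(x in [set: borel G]) (v x)%:E))%E.

Section NumberField.
Variable F : fieldExtType rat.

Definition ringint : set F := [set x | integralOver (intr : int -> F) x].

Definition is_submod (A : set F) : Prop :=
  A 0 /\ forall x y, A x -> A y -> A (x - y).

Definition is_ideal (P : set F) : Prop :=
  [/\ P `<=` ringint, P 0, forall x y, P x -> P y -> P (x + y)
    & forall a x, ringint a -> P x -> P (a * x)].

Definition is_maximal (P : set F) : Prop :=
  [/\ is_ideal P, P <> ringint
    & forall J, is_ideal J -> P `<=` J -> J = P \/ J = ringint].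

Definition max_ideal := {P : set F | `[< is_maximal P >]}.

(* N(P) = |O_F / P| *)
Definition idealN (P : set F) : nat :=
  #|` fset_set [set [set x + y | y in P] | x in ringint] |.

Definition ideal_mul (A B : set F) : set F :=
  [set x | exists s : seq (F * F),
     (forall p, p \in s -> A p.1 /\ B p.2) /\ x = \sum_(p <- s) p.1 * p.2].

Definition ideal_inv (A : set F) : set F :=
  [set x | forall y, A y -> ringint (x * y)].

Definition ideal_exp (A : set F) (k : int) : set F :=
  match k with
  | Posz n => iter n (ideal_mul A) ringint
  | Negz n => iter n.+1 (ideal_mul (ideal_inv A)) ringint
  end.

Lemma zmod_ringint : is_submod ringint.
Proof. by split=> [|x y]; [exact: (mxpoly.integral0 intr)|exact: integral_sub]. Qed.

Lemma zmod_ideal_mul A B : is_submod A -> is_submod (ideal_mul A B).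
Proof.
move=> [A0 AB]; have AN x : A x -> A (- x) by rewrite -sub0r; exact: AB.
split=> [|x y [s [sAB ->]] [t [tAB ->]]].
  by exists [::]; rewrite big_nil; split.
exists (s ++ [seq (- p.1, p.2) | p <- t]); split; last first.
  by rewrite big_cat big_map -sumrN; congr (_ + _); apply: eq_bigr => p _; rewrite mulNr.
move=> p; rewrite mem_cat => /orP[/sAB//|/mapP[q /tAB[Aq Bq] ->]].
by split; [exact: AN|].
Qed.

Lemma zmod_ideal_inv A : is_submod (ideal_inv A).
Proof.
split=> [y _|x y xA yA z Az]; first by rewrite mul0r; exact: (mxpoly.integral0 intr).
by rewrite mulrBl; apply: integral_sub; [exact: xA|exact: yA].
Qed.

Lemma zmod_ideal_exp P k : is_ideal P -> is_submod (ideal_exp P k).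
Proof.
move=> [_ P0 PD PM].
have PZ : is_submod P.
  split=> // x y Px Py; rewrite -[- y]mulN1r; apply: PD => //; apply: PM => //.
  by apply: integral_opp; exact: (mxpoly.integral1 intr).
case: k => [[|n]|n] /=; first exact: zmod_ringint.
  exact: zmod_ideal_mul.
by apply: zmod_ideal_mul; exact: zmod_ideal_inv.
Qed.

Definition field_trace (x : F) : rat :=
  \tr (\matrix_(i, j) coord (vbasis {:F}) j (x * (vbasis {:F})`_i)).

Definition is_integral_basis (w : {ffun 'I_(\dim {:F}) -> F}) : Prop :=
  (forall i, ringint (w i)) /\
  forall x, ringint x ->
    exists! c : {ffun 'I_(\dim {:F}) -> int}, x = \sum_i w i *~ c i.

Definition disc : rat :=
  let w := xget [ffun=> 0] is_integral_basis in
  \det (\matrix_(i, j) field_trace (w i * w j)).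

End NumberField.

Definition nonreal (F : fieldExtType rat) (R : realType)
  (tau : {rmorphism F -> R[i]}) : Prop := exists x, complex.Im (tau x) != 0.

(* A complete list, without repetition, of the infinite places of F: the
   embeddings into the reals, and one embedding into the complex numbers for
   each pair of conjugate nonreal embeddings. *)
Record infinite_places (F : fieldExtType rat) (R : realType) := InfinitePlaces {
  nreal : nat;
  ncplx : nat;
  real_place : 'I_nreal -> {rmorphism F -> R};
  cplx_place : 'I_ncplx -> {rmorphism F -> R[i]};
  real_placeP : forall s : {rmorphism F -> R}, exists! i, s =1 real_place i;
  cplx_place_nonreal : forall j, nonreal (cplx_place j);
  cplx_placeP : forall t : {rmorphism F -> R[i]}, nonreal t ->
    exists! j, t =1 cplx_place j \/ (forall x, t x = conjc (cplx_place j x)) }.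

(* F (x) R as the product of its completions; R[i]^o is R[i] with the topology
   of its absolute value *)
Definition tensorR (F : fieldExtType rat) (R : realType)
    (S : infinite_places F R) : Type :=
  ('rV[R]_(nreal S) * 'rV[R[i]^o]_(ncplx S))%type.

Lemma rV_sub_continuous (T : topologicalZmodType) (n : nat) :
  continuous (fun p : 'rV[T]_n * 'rV[T]_n => p.1 - p.2).
Proof.
move=> [u v] W [P nP PW] /=.
have /choice[Q hQ] (j : 'I_n) : exists Q : set T * set T,
    [/\ nbhs (u 0 j) Q.1, nbhs (v 0 j) Q.2 &
      forall a b, Q.1 a -> Q.2 b -> P 0 j (a - b)].
  have := nP 0 j; rewrite !mxE => /(@sub_continuous T (u 0 j, v 0 j)).
  by move=> [[A B] /= [nA nB] AB]; exists (A, B); split=> // a b Aa Bb; exact: (AB (a, b)).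
exists ([set x : 'rV[T]_n | forall i j, (Q j).1 (x i j)],
        [set x : 'rV[T]_n | forall i j, (Q j).2 (x i j)]).
  split; [exists (fun _ j => (Q j).1)|exists (fun _ j => (Q j).2)] => // i j;
  by have [] := hQ j; rewrite (ord1 i).
move=> [x y] /= [hx hy]; apply: PW => i j; rewrite !mxE (ord1 i).
by have [_ _] := hQ j; exact.
Qed.

Lemma rV_pair_sub_continuous (T1 T2 : topologicalZmodType) (m n : nat) :
  continuous (fun p : ('rV[T1]_m * 'rV[T2]_n) * ('rV[T1]_m * 'rV[T2]_n) =>
    p.1 - p.2).
Proof.
move=> [[u1 v1] [u2 v2]] W [[A B] /= [nA nB] AB].
have [[A1 A2] /= [nA1 nA2] hA] := @rV_sub_continuous _ _ (u1, u2) _ nA.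
have [[B1 B2] /= [nB1 nB2] hB] := @rV_sub_continuous _ _ (v1, v2) _ nB.
exists (A1 `*` B1, A2 `*` B2) => /=.
  by split; [exists (A1, B1)|exists (A2, B2)].
move=> [[x1 y1] [x2 y2]] /= [[Ax1 By1] [Ax2 By2]].
by apply: AB; split; [exact: (hA (x1, x2))|exact: (hB (y1, y2))].
Qed.

Section TensorR.
Variables (F : fieldExtType rat) (R : realType) (S : infinite_places F R).
HB.instance Definition _ := Topological.on (tensorR S).
HB.instance Definition _ := GRing.Zmodule.on (tensorR S).

HB.instance Definition _ :=
  PreTopologicalNmodule_isTopologicalZmodule.Build (tensorR S)
    (@rV_pair_sub_continuous R R[i]^o (nreal S) (ncplx S)).

Definition canon (x : F) : tensorR S :=
  (\row_i real_place i x, \row_j (cplx_place j x : R[i]^o)).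

Lemma canon0 : canon 0 = 0.
Proof. by congr (_, _); apply/matrixP => i j; rewrite !mxE rmorph0. Qed.

Lemma canonB x y : canon (x - y) = canon x - canon y.
Proof. by congr (_, _); apply/matrixP => i j; rewrite !mxE rmorphB. Qed.

End TensorR.

Record arakelov_divisor (F : fieldExtType rat) (R : realType)
    (S : infinite_places F R) := ArakelovDivisor {
  fin_coef : {fsfun max_ideal F -> int with 0};
  real_coef : 'I_(nreal S) -> R;
  cplx_coef : 'I_(ncplx S) -> R }.

Section Arakelov.
Variables (F : fieldExtType rat) (R : realType) (S : infinite_places F R).
Variable D : arakelov_divisor S.

Definition degree : R :=
  \sum_(P <- finsupp (fin_coef D)) (fin_coef D P)%:~R * ln (idealN (val P))%:R
  + \sum_i real_coef D i + \sum_j cplx_coef D j.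

(* ideal_mul is commutative on ideals, so the order of finsupp is irrelevant *)
Definition frac_ideal : set F :=
  \big[@ideal_mul F/@ringint F]_(P <- finsupp (fin_coef D))
     ideal_exp (val P) (- fin_coef D P).

Lemma zmod_frac_ideal : is_submod frac_ideal.
Proof.
apply: (big_rec (@is_submod F)); first exact: zmod_ringint.
move=> P A _ _; apply: zmod_ideal_mul; apply: zmod_ideal_exp.
by have /asboolP[] := valP P.
Qed.

Definition frac_ideal_pred : {pred F} := fun x => `[< frac_ideal x >].

Lemma frac_ideal_zmod_closed : zmod_closed frac_ideal_pred.
Proof.
have [I0 IB] := zmod_frac_ideal.
split=> [|x y /asboolP Ix /asboolP Iy]; apply/asboolP => //.
exact: IB.
Qed.
HB.instance Definition _ :=
  GRing.isZmodClosed.Build F frac_ideal_pred frac_ideal_zmod_closed.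

Definition ideal_group := {x : F | x \in frac_ideal_pred}.
HB.instance Definition _ := SubChoice.on ideal_group.
HB.instance Definition _ := [SubChoice_isSubZmodule of ideal_group by <:].

Definition lattice : {pred tensorR S} :=
  fun z => `[< exists2 x, frac_ideal x & z = canon S x >].

Lemma lattice_zmod_closed : zmod_closed lattice.
Proof.
have [I0 IB] := zmod_frac_ideal.
split=> [|_ _ /asboolP[x Ix ->] /asboolP[y Iy ->]]; apply/asboolP.
  by exists 0 => //; rewrite canon0.
by exists (x - y); [exact: IB|rewrite canonB].
Qed.
HB.instance Definition _ :=
  GRing.isZmodClosed.Build (tensorR S) lattice lattice_zmod_closed.

Definition sqnorm (z : tensorR S) : R :=
  \sum_i `|z.1 0 i| ^+ 2 * expR (- 2 * real_coef D i)
  + \sum_j ComplexField.Normc.normc (z.2 0 j) ^+ 2 * (2 * expR (- cplx_coef D j)).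

Definition gauss (z : tensorR S) : R := expR (- pi * sqnorm z).

Definition H0 : ghost_first R :=
  @GhostFirst R ideal_group (fun x => gauss (canon S (val x))).

Definition h0 : \bar R := dim_first H0.

Definition torus : topologicalZmodType := quot_group lattice.

Definition H1 : ghost_second R :=
  quot_by_ghost (quot_weight gauss : torus -> R).

Definition h1 : \bar R := dim_second H1.

End Arakelov.

(* Main.v *)
From HB Require Import structures.
From mathcomp Require Import all_boot all_order all_algebra all_field.
From mathcomp Require Import ring_quotient generic_quotient complex finmap.
From mathcomp Require Import all_classical all_reals all_analysis.
From mathcomp Require Import measurable_realfun ring lra.
Require Import Defs.

(** Let [V] be the tensor product of [F] with the reals, [L] the image in [V] of
    the fractional ideal [I] of [D], and [u] the Gaussian [exp (- pi |z|^2)].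
    Put [Theta := sum_(y in L) u y], so that [h0 = ln Theta].  On the torus
    [V / L] the weight is [v x = Theta^-1 * sum_(y in L) u (x + y)], and the
    measure of [H1] is [v / kappa] times the Haar probability, where [kappa] is
    the Haar integral of [v].  As [v] is continuous and [v 0 = 1], the density
    at [0] is [1 / kappa] and [h1 = - ln kappa].  Therefore
    [h0 - h1 = ln (Theta * kappa)], and [Theta * kappa] is the mean over the
    torus of [x |-> sum_(y in L) u (x + y)].  Unfolding this mean gives the
    integral of [u] over [V] for the Lebesgue measure for which [L] has covolume
    one, which is [(det G)^(-1/2)] for the Gram matrix [G] of a Z-basis of [I].
    The theorem thus is a computation of a covolume: the Gaussian only has to be
    integrated, and no Poisson summation enters.

    The covolume.  The lemma [det_gram] expresses [det G] by the discriminant of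
    the Z-basis and the weights of the infinite places.  The discriminant of a
    sublattice is that of the lattice times the square of the index
    ([coset_count_zbasis], by the Smith normal form), and [J / PJ] has [N(P)]
    elements for a maximal ideal [P] ([coset_count_maximal]).  The latter uses
    that [P] is invertible ([maximal_mul_inv]).  By induction over the divisor
    the discriminant of [I] is [disc F] times the square of the norm of [I]
    ([frac_ideal_disc]).  The existence of Z-bases ([zbasis_exists]), and hence
    of the integral basis in the definition of [disc F], comes from minimising
    the discriminant.

    The mean over the torus.  The Haar probability is characterised by its
    invariance, so the mean is taken one coordinate at a time: averaging a
    function along a circle in the torus leaves its integral unchanged
    ([integral_circle_mean]).  Writing [G = U^T * diag d * U] with [U]
    unitriangular ([posdef_factor]), the average along the [j]-th coordinate
    circle turns the sum over the [j]-th integer coordinate into a Gaussian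
    integral over the line, equal to [d_j^(-1/2)] ([tail_theta_mean]).  After
    all the coordinates a constant remains ([integral_quot_weight]).

    The same circles serve twice more.  Averaging a Dirac mass along each of
    them produces the Haar probability ([invariant_probability_exists]), and a
    null open set would spread along them over the whole torus, so nonempty open
    sets have positive measure ([invariant_open_gt0]).  This makes the
    continuous density of the measure of [H1] unique ([density_le]), so that its
    value at [0] is the one computed above. *)

Set Implicit Arguments.
Unset Strict Implicit.
Unset Printing Implicit Defensive.

Import Order.TTheory GRing.Theory Num.Theory.
Import numFieldNormedType.Exports.

Local Open Scope classical_set_scope.
Local Open Scope ring_scope.

(** * Embeddings, trace and discriminant *)

Section Embeddings.
Variables (F : fieldExtType rat) (K : numClosedFieldType).
Local Notation n := (\dim {:F}).
Implicit Types (s t : {rmorphism F -> K}) (p q : {poly rat}).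

Lemma embedding_scale s (a : rat) (x : F) : s (a *: x) = ratr a * s x.
Proof.
rewrite -mulr_algl rmorphM; congr (_ * _).
exact: (fmorph_eq_rat (s \o in_alg F)).
Qed.

Lemma embedding_horner s p (x : F) :
  s (map_poly (in_alg F) p).[x] = (map_poly ratr p).[s x].
Proof.
rewrite -horner_map -map_poly_comp /=; congr _.[_].
by apply: eq_map_poly => a /=; exact: (fmorph_eq_rat (s \o in_alg F)).
Qed.

Lemma primitive_element : exists th : F, <<1; th>>%VS = fullv.
Proof.
have sep : separable 1%AS {:F}.
  by apply/separableP => y _; apply: pcharf0_separable => q;
     rewrite (pchar_lalg F) pchar_num.
exists (separable_generator 1%AS {:F}).
by rewrite -(eq_adjoin_separable_generator sep) ?sub1v.
Qed.

(** Writing the elements of the field as polynomials in [th], evaluation at [r]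
    is well defined since [r] is a root of the minimal polynomial. *)
Lemma embedding_of_root (th : F) (r : K) q : <<1; th>>%VS = fullv ->
  minPoly 1%VS th = map_poly (in_alg F) q -> root (map_poly ratr q) r ->
  exists s : {rmorphism F -> K}, s th = r.
Proof.
move=> thF qE qr.
have gen x : exists p, x = (map_poly (in_alg F) p).[th].
  have : x \in <<1; th>>%VS by rewrite thF memvf.
  by move=> /Fadjoin_polyP[p /polyOver1P[p' ->] ->]; exists p'.
have [f fE] := choice gen.
have wd p p' : (map_poly (in_alg F) p).[th] = (map_poly (in_alg F) p').[th] ->
    (map_poly ratr p).[r] = (map_poly ratr p').[r].
  move=> /eqP; rewrite -subr_eq0 -hornerN -hornerD -rmorphB/= => rt.
  apply/eqP; rewrite -subr_eq0 -hornerN -hornerD -rmorphB/=.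
  have : minPoly 1%VS th %| map_poly (in_alg F) (p - p').
    by apply: minPoly_dvdp => //; apply/polyOver1P; exists (p - p').
  rewrite qE dvdp_map => /dvdpP[u ->].
  by rewrite rmorphM/= hornerM (rootP qr) mulr0.
pose g x := (map_poly ratr (f x)).[r].
have gE p x : x = (map_poly (in_alg F) p).[th] -> g x = (map_poly ratr p).[r].
  by move=> xE; apply: wd; rewrite -fE.
have gB : zmod_morphism g.
  move=> x y; rewrite (gE (f x - f y)) ?rmorphB/= ?hornerD ?hornerN// -?fE//.
have gM : monoid_morphism g.
  split; first by rewrite (gE 1) ?rmorph1 ?hornerC.
  by move=> x y; rewrite (gE (f x * f y)) ?rmorphM/= ?hornerM// -?fE.
pose s : {rmorphism F -> K} := HB.pack g
  (GRing.isZmodMorphism.Build _ _ g gB) (GRing.isMonoidMorphism.Build _ _ g gM).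
exists s; rewrite /= (gE 'X) ?map_polyX ?hornerX//.
Qed.

Lemma embedding_eq_gen (th : F) s t : <<1; th>>%VS = fullv ->
  s th = t th -> s =1 t.
Proof.
move=> thF st x.
have : x \in <<1; th>>%VS by rewrite thF memvf.
move=> /Fadjoin_polyP[p /polyOver1P[p' ->] ->].
by rewrite !embedding_horner st.
Qed.

(** Over an algebraically closed field of characteristic zero the minimal
    polynomial of a primitive element has as many roots as its degree, and each
    root is the image of that element under exactly one embedding. *)
Lemma embeddings_exist : exists s : 'I_n -> {rmorphism F -> K},
  [/\ forall k l, s k =1 s l -> k = l,
      forall t, exists k, t =1 s k &
      forall c : 'rV[K]_n, (forall x, \sum_k c 0 k * s k x = 0) -> c = 0].
Proof.
have [th thF] := primitive_element.
have /polyOver1P[q qE] := minPolyOver 1%AS th.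
have szq : size q = n.+1.
  rewrite -(size_map_poly (in_alg F)) -qE size_minPoly /adjoin_degree thF.
  by rewrite dimv1 divn1 prednK// adim_gt0.
have sepq : separable_poly q.
  rewrite -(separable_map (in_alg F)) -qE.
  by apply: pcharf0_separable => l; rewrite (pchar_lalg F) pchar_num.
have q0 : q != 0 by rewrite -size_poly_eq0 szq.
have [rs rsE] := closed_field_poly_normal (map_poly (@ratr K) q).
have lc0 : lead_coef (map_poly (@ratr K) q) != 0.
  by rewrite lead_coef_eq0 map_poly_eq0.
have szrs : size rs = n.
  apply/eqP; rewrite -eqSS -szq -(size_map_poly (@ratr K)) rsE size_scale//.
  by rewrite size_prod_XsubC.
have uniq_rs : uniq rs.
  rewrite -separable_prod_XsubC.
  have : separable_poly (map_poly (@ratr K) q) by rewrite separable_map.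
  by rewrite rsE (eqp_separable (eqp_scale _ lc0)).
have rt z : root (map_poly ratr q) z = (z \in rs).
  by rewrite rsE rootZ// root_prod_XsubC.
have /choice[s sE] (k : 'I_n) : exists s : {rmorphism F -> K}, s th = rs`_k.
  by apply: (embedding_of_root thF qE); rewrite rt mem_nth// szrs.
exists s; split.
- move=> k l /(_ th); rewrite !sE => /eqP.
  by rewrite nth_uniq ?szrs// => /eqP/val_inj.
- move=> t.
  have : t th \in rs.
    rewrite -rt; apply/rootP; rewrite -embedding_horner -qE.
    by rewrite (rootP (root_minPoly _ _)) rmorph0.
  move=> /(nthP 0)[k]; rewrite szrs => kn tk.
  by exists (Ordinal kn); apply: (embedding_eq_gen thF); rewrite sE -tk.
(* A linear relation is tested on the powers of the primitive element. *)
- move=> c c0; pose a : 'rV[K]_n := \row_k rs`_k.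
  have aU : Vandermonde n a \in unitmx.
    rewrite unitmxE unitfE det_Vandermonde; apply/prodf_neq0 => i _.
    apply/prodf_neq0 => j ij; rewrite !mxE subr_eq0 nth_uniq ?szrs//.
    by rewrite gt_eqF.
  apply: trmx_inj; rewrite trmx0 -[LHS](mulKmx aU).
  suff -> : Vandermonde n a *m c^T = 0 by rewrite mulmx0.
  apply/matrixP => i j; rewrite !mxE ord1 -[RHS](c0 (th ^+ i)).
  by apply: eq_bigr => k _; rewrite !mxE rmorphXn/= sE mulrC.
Qed.

(** The matrix of multiplication by [x] is diagonalised by the matrix of the
    embeddings at the basis vectors, which is invertible by independence of the
    embeddings. *)
Lemma field_trace_embeddings (s : 'I_n -> {rmorphism F -> K}) :
  (forall c : 'rV[K]_n, (forall x, \sum_k c 0 k * s k x = 0) -> c = 0) ->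
  forall x, ratr (field_trace x) = \sum_k s k x.
Proof.
move=> sfree x; pose b := vbasis {:F}.
pose T : 'M[rat]_n := \matrix_(i, j) coord b j (x * b`_i).
pose B : 'M[K]_n := \matrix_(i, k) s k b`_i.
have sumE y k : s k y = \sum_j ratr (coord b j y) * s k b`_j.
  rewrite {1}(coord_vbasis (memvf y)) rmorph_sum.
  by apply: eq_bigr => j _; rewrite embedding_scale.
have BU : B \in unitmx.
  rewrite -unitmx_tr -row_free_unit; apply: inj_row_free => c cB.
  apply: sfree => y; under eq_bigr => k _ do rewrite sumE mulr_sumr.
  rewrite exchange_big big1// => j _.
  move/matrixP/(_ 0 j): cB; rewrite !mxE => cB.
  rewrite -[RHS](mulr0 (ratr (coord b j y))) -[in RHS]cB mulr_sumr.
  by apply: eq_bigr => k _; rewrite !mxE mulrCA.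
have TB : map_mx ratr T *m B = B *m diag_mx (\row_k s k x).
  apply/matrixP => i k; rewrite mul_mx_diag !mxE -rmorphM mulrC sumE.
  by apply: eq_bigr => j _; rewrite !mxE.
have -> : ratr (field_trace x) = \tr (map_mx (@ratr K) T).
  by rewrite trace_map_mx.
rewrite -[map_mx ratr T](mulmxK BU) TB mxtrace_mulC mulKmx// mxtrace_diag.
by apply: eq_bigr => k _; rewrite mxE.
Qed.

Definition trace_disc (b : 'I_n -> F) : rat :=
  \det (\matrix_(i, j) field_trace (b i * b j)).

(** The trace form is the product of the matrix of embeddings with its
    transpose.  Every use of the discriminant goes through this identity: over
    [algC] for integrality, over [R[i]] for volumes. *)
Lemma trace_disc_embeddings (s : 'I_n -> {rmorphism F -> K}) (b : 'I_n -> F) :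
  (forall c : 'rV[K]_n, (forall x, \sum_k c 0 k * s k x = 0) -> c = 0) ->
  ratr (trace_disc b) = (\det (\matrix_(k, i) s k (b i))) ^+ 2.
Proof.
move=> sfree; pose M : 'M[K]_n := \matrix_(k, i) s k (b i).
rewrite -det_map_mx expr2 -[X in X * _]det_tr -det_mulmx; congr (\det _).
apply/matrixP => i j; rewrite !mxE/= (field_trace_embeddings sfree).
by apply: eq_bigr => k _; rewrite !mxE rmorphM.
Qed.
End Embeddings.

(** * Algebraic integers *)

Section Integrality.
Variable F : fieldExtType rat.
Local Notation n := (\dim {:F}).

Lemma ringint0 : @ringint F 0. Proof. exact: (mxpoly.integral0 intr). Qed.
Lemma ringint1 : @ringint F 1. Proof. exact: (mxpoly.integral1 intr). Qed.
Lemma ringintB (x y : F) : ringint x -> ringint y -> ringint (x - y).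
Proof. exact: integral_sub. Qed.
Lemma ringintD (x y : F) : ringint x -> ringint y -> ringint (x + y).
Proof. exact: integral_add. Qed.
Lemma ringintM (x y : F) : ringint x -> ringint y -> ringint (x * y).
Proof. exact: integral_mul. Qed.
Lemma ringint_int (z : int) : @ringint F z%:~R.
Proof. exact: (integral_id intr z). Qed.

Lemma ringint_embedding (s : {rmorphism F -> algC}) x :
  ringint x -> s x \in Aint.
Proof.
move=> [p p_monic px]; apply: (@root_monic_Aint (map_poly intr p)).
- apply/rootP; move/rootP: px => /(congr1 s); rewrite rmorph0 -horner_map.
  rewrite -map_poly_comp => <-; congr _.[_].
  by apply: eq_map_poly => a /=; rewrite rmorph_int.
- exact: monic_map.
- by apply/polyOverP => i; rewrite coef_map /= intr_int.
Qed.

(** The trace is a rational number and a sum of algebraic integers. *)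
Lemma ringint_trace x : @ringint F x -> field_trace x \is a Num.int.
Proof.
move=> xO; have [s [_ _ sfree]] := embeddings_exist F algC.
have : (ratr (field_trace x) : algC) \in Num.int.
  apply: Cint_rat_Aint; first exact: Crat_rat.
  rewrite (field_trace_embeddings sfree) rpred_sum// => k _.
  exact: ringint_embedding.
move=> /intrP[z zE]; apply/intrP; exists z; apply: (fmorph_inj (@ratr algC)).
by rewrite [LHS]zE rmorph_int.
Qed.

(** A multiplier of a finitely generated group is a root of the characteristic
    polynomial of its integer matrix. *)
Lemma ringint_of_stable (m : nat) (b : 'I_m -> F) (C : 'M[int]_m) (x : F) :
  (exists i, b i != 0) -> (forall i, x * b i = \sum_j b j *~ C i j) ->
  ringint x.
Proof.
move=> [i0 bi0] xb; exists (char_poly C^T); first exact: char_poly_monic.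
rewrite map_char_poly -eigenvalue_root_char; apply/eigenvalueP.
exists (\row_i b i); last first.
  by apply/negP => /eqP/rowP/(_ i0); rewrite !mxE; apply/eqP.
apply/rowP => i; rewrite !mxE xb; apply: eq_bigr => j _.
by rewrite !mxE mulrzr.
Qed.

Lemma rat_common_denominator (I : finType) (f : I -> rat) :
  exists2 d : nat, (0 < d)%N & forall i, exists z : int, f i *+ d = z%:~R.
Proof.
exists (\prod_i `|denq (f i)|)%N; first by rewrite prodn_gt0// => i; rewrite absz_gt0.
move=> i; rewrite (bigD1 i)//= mulrnA; set d := (\prod_(_ | _) _)%N.
exists (numq (f i) *+ d).
rewrite rmorphMn/= numqE; congr (_ *+ _).
by rewrite -mulr_natr natr_absz normr_denq.
Qed.

(** A common denominator of the matrix of multiplication by [x] makes the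
    coordinate lattice stable. *)
Lemma ringint_multiple (x : F) : exists2 d : nat, (0 < d)%N & ringint (x *+ d).
Proof.
pose b := vbasis {:F}.
have [d d0 dP] := rat_common_denominator
  (fun ij : 'I_n * 'I_n => coord b ij.2 (x * b`_ij.1)).
exists d => //.
have /choice[C CE] (ij : 'I_n * 'I_n) := dP ij.
pose M : 'M[int]_n := \matrix_(i, j) C (i, j).
apply: (@ringint_of_stable _ (fun i => b`_i) M).
  have k : 'I_n := Ordinal (adim_gt0 {:F}%AS).
  exists k; apply: (basis_not0 (vbasisP {:F})).
  by rewrite mem_nth// size_tuple.
move=> i; rewrite mulrnAl {1}(coord_vbasis (memvf (x * b`_i))) -sumrMnl.
apply: eq_bigr => j _; rewrite mxE scalerMnl (CE (i, j)).
by rewrite scaler_int.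
Qed.

End Integrality.

(** * Integral bases of subgroups of a number field *)

Section Lattices.
Variable F : fieldExtType rat.
Local Notation n := (\dim {:F}).
Implicit Types (A B : set F) (b w : 'I_n -> F).

Lemma field_trace_lin (a : rat) (x y : F) :
  field_trace (a *: x + y) = a * field_trace x + field_trace y.
Proof.
have [s [_ _ sfree]] := embeddings_exist F algC.
apply: (fmorph_inj (@ratr algC)); rewrite rmorphD rmorphM/=.
rewrite !(field_trace_embeddings sfree) mulr_sumr -big_split; apply: eq_bigr => k _.
by rewrite rmorphD embedding_scale.
Qed.

Lemma field_trace0 : field_trace (0 : F) = 0.
Proof.
by have := field_trace_lin (-1) 0 0; rewrite scaler0 addr0 mulN1r addNr.
Qed.

Lemma field_trace_comb m (c : 'I_m -> rat) (v : 'I_m -> F) (y : F) :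
  field_trace ((\sum_i c i *: v i) * y) = \sum_i c i * field_trace (v i * y).
Proof.
elim/big_rec2: _ => [|i t u _ IH]; first by rewrite mul0r field_trace0.
by rewrite mulrDl -scalerAl field_trace_lin IH.
Qed.

Lemma field_trace1 : field_trace (1 : F) = n%:R.
Proof.
have [s [_ _ sfree]] := embeddings_exist F algC.
apply: (fmorph_inj (@ratr algC)); rewrite rmorph_nat [LHS](field_trace_embeddings sfree).
under eq_bigr do rewrite rmorph1.
by rewrite sumr_const card_ord.
Qed.

Lemma trace_disc_change (C : 'M[rat]_n) b w :
  (forall i, w i = \sum_j C i j *: b j) ->
  trace_disc w = (\det C) ^+ 2 * trace_disc b.
Proof.
move=> wE; pose G (v : 'I_n -> F) : 'M[rat]_n := \matrix_(i, j) field_trace (v i * v j).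
have -> : trace_disc w = \det (C *m G b *m C^T).
  congr (\det _); apply/matrixP => i j; rewrite !mxE (wE i) field_trace_comb.
  under eq_bigr => k _ do rewrite (wE j) [b k * _]mulrC field_trace_comb mulr_sumr.
  rewrite exchange_big/=; apply: eq_bigr => l _; rewrite !mxE mulr_suml.
  by apply: eq_bigr => k _; rewrite !mxE [b l * _]mulrC; ring.
by rewrite !det_mulmx det_tr mulrAC expr2.
Qed.

Lemma trace_disc_free b (c : 'I_n -> rat) :
  trace_disc b != 0 -> \sum_i c i *: b i = 0 -> forall i, c i = 0.
Proof.
move=> b0 cb.
have GU : (\matrix_(i, j) field_trace (b i * b j)) \in unitmx.
  by rewrite unitmxE unitfE.
suff : \row_i c i = 0 by move=> /rowP c0 i; have := c0 i; rewrite !mxE.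
rewrite -[LHS](mulmxK GU); set u := (X in X *m invmx _).
suff -> : u = 0 by rewrite mul0mx.
apply/rowP => j; rewrite /u !mxE.
transitivity (field_trace ((\sum_i c i *: b i) * b j)).
  rewrite field_trace_comb.
  by apply: eq_bigr => i _; rewrite !mxE.
by rewrite cb mul0r field_trace0.
Qed.

(** The trace form is nondegenerate: an element [x] in its kernel would satisfy
    [field_trace (x * x^-1) = 0], against [field_trace1]. *)
Lemma trace_disc_vbasis : trace_disc (fun i => (vbasis {:F})`_i) != 0.
Proof.
set b := fun i => _.
rewrite -unitfE -unitmxE -row_free_unit; apply: inj_row_free => c cG.
pose x := \sum_i c 0 i *: b i.
have trx y : field_trace (x * y) = 0.
  rewrite (coord_vbasis (memvf y)) mulrC field_trace_comb big1// => j _.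
  rewrite [_ * x]mulrC field_trace_comb; move/rowP/(_ j): cG; rewrite !mxE => cG.
  rewrite -[RHS](mulr0 (coord (vbasis fullv) j y)) -[in RHS]cG; congr (_ * _).
  by apply: eq_bigr => i _; rewrite !mxE.
have x0 : x = 0.
  apply/eqP; apply/negP => /negP x0; have := trx x^-1.
  by rewrite divff// field_trace1 => /eqP; rewrite pnatr_eq0 gtn_eqF// (adim_gt0 {:F}%AS).
apply/rowP => i; rewrite mxE.
exact: (elimT (freeP (X := vbasis {:F})) (basis_free (vbasisP {:F})) (c 0) x0).
Qed.

Lemma trace_disc_span b : trace_disc b != 0 ->
  forall x, exists c : 'I_n -> rat, x = \sum_i c i *: b i.
Proof.
move=> b0 x; pose v := fun i : 'I_n => (vbasis {:F})`_i.
pose C : 'M[rat]_n := \matrix_(i, j) coord (vbasis {:F}) j (b i).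
have bE i : b i = \sum_j C i j *: v j.
  rewrite {1}(coord_vbasis (memvf (b i))); apply: eq_bigr => j _.
  by rewrite mxE.
have CU : C \in unitmx.
  rewrite unitmxE unitfE; apply: contra_neq b0 => C0.
  by rewrite (trace_disc_change bE) C0 expr0n/= mul0r.
have vE i : v i = \sum_j invmx C i j *: b j.
  under eq_bigr => j _ do rewrite bE scaler_sumr.
  rewrite exchange_big/= (bigD1 i)//= [X in _ + X]big1 ?addr0 => [|k ki].
    under eq_bigr do rewrite scalerA.
    rewrite -scaler_suml; have -> : \sum_j invmx C i j * C j i = 1; last first.
      by rewrite scale1r.
    by move/matrixP/(_ i i): (mulVmx CU); rewrite !mxE eqxx.
  under eq_bigr do rewrite scalerA.
  rewrite -scaler_suml; move/matrixP/(_ i k): (mulVmx CU); rewrite !mxE.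
  by rewrite eq_sym (negbTE ki) => ->; rewrite scale0r.
exists (fun j => \sum_i coord (vbasis {:F}) i x * invmx C i j).
rewrite {1}(coord_vbasis (memvf x)).
under eq_bigr => i _ do rewrite -/(v i) vE scaler_sumr.
rewrite exchange_big/=; apply: eq_bigr => j _.
by rewrite scaler_suml; apply: eq_bigr => i _; rewrite scalerA.
Qed.

(** The nonzero discriminant is what makes [b] linearly independent; it is
    stated in this form because discriminants are what is computed. *)
Definition zbasis A b : Prop :=
  [/\ forall i, A (b i), trace_disc b != 0 &
      forall x, A x -> exists c : 'I_n -> int, x = \sum_i b i *~ c i].

Lemma submodD A x y : is_submod A -> A x -> A y -> A (x + y).
Proof.
move=> [A0 AB] Ax Ay; rewrite -[y]opprK; apply: (AB) => //.
by rewrite -sub0r; apply: AB.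
Qed.

Lemma submod_sum A (I : Type) (r : seq I) (P : pred I) (f : I -> F) :
  is_submod A -> (forall i, P i -> A (f i)) -> A (\sum_(i <- r | P i) f i).
Proof.
move=> AS Af; elim/big_ind: _ => //; first by case: AS.
by move=> x y; exact: submodD.
Qed.

Lemma submodMz A x (z : int) : is_submod A -> A x -> A (x *~ z).
Proof.
move=> AS Ax; have [A0 AB] := AS; have Ak (k : nat) : A (x *+ k).
  by elim: k => // k IH; rewrite mulrS; exact: submodD.
case: z => k; first by rewrite -pmulrn.
by rewrite NegzE mulrNz -pmulrn -sub0r; apply: AB.
Qed.

Lemma submod_comb A m (v : 'I_m -> F) (c : 'I_m -> int) : is_submod A ->
  (forall i, A (v i)) -> A (\sum_i v i *~ c i).
Proof. by move=> AS Av; apply: submod_sum => // i _; exact: submodMz. Qed.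

(** Among the maximal independent families of [A], one whose discriminant is
    smallest generates [A]: if an element had a coordinate that is not an
    integer, putting its fractional part in place of a basis vector would
    multiply the discriminant by a factor in the open unit interval.  The
    discriminants have bounded denominator, so a smallest one exists. *)
Lemma zbasis_exists A (d : nat) : is_submod A -> (0 < d)%N ->
  (forall x, A x -> ringint (x *+ d)) ->
  (exists b, (forall i, A (b i)) /\ trace_disc b != 0) ->
  exists b, zbasis A b.
Proof.
move=> AS d0 Ad [b1 [Ab1 b10]].
have dn0 : d%:R ^+ n != 0 :> rat by rewrite expf_neq0// pnatr_eq0 -lt0n.
(* Scaling the family by [d] multiplies its discriminant by [d ^ (2 n)]. *)
have integral b : (forall i, A (b i)) ->
    (d%:R ^+ n) ^+ 2 * trace_disc b \is a Num.int.
  move=> Ab; rewrite -[d%:R ^+ n](@det_scalar _ n d%:R).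
  rewrite -(@trace_disc_change _ b (fun i => b i *+ d)) => [|i].
    rewrite /trace_disc /determinant; apply: rpred_sum => s _.
    apply: rpredM; first by rewrite rpredX// rpredN1.
    apply: rpred_prod => i _; rewrite mxE; apply: ringint_trace.
    by apply: ringintM; exact: Ad.
  rewrite (bigD1 i)//= mxE eqxx mulr1n big1 ?addr0 ?scaler_nat// => j ji.
  by rewrite mxE eq_sym (negbTE ji) mulr0n scale0r.
pose size b := `|Num.floor ((d%:R ^+ n) ^+ 2 * trace_disc b)|%N.
have sizeE b : (forall i, A (b i)) ->
    (size b)%:R = (d%:R ^+ n) ^+ 2 * `|trace_disc b|.
  move=> Ab; rewrite /size natr_absz intr_norm floorK ?integral//.
  by rewrite normrM ger0_norm ?exprn_even_ge0.
pose P k := `[< exists b, [/\ forall i, A (b i), trace_disc b != 0 & size b = k] >].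
have exP : exists k, P k by exists (size b1); apply/asboolP; exists b1.
case: (ex_minnP exP) => k /asboolP[b [Ab b0 bk]] kmin.
exists b; split=> // x Ax.
have [c xE] := trace_disc_span b0 x.
suff cint i : c i \is a Num.int.
  exists (fun i => Num.floor (c i)); rewrite xE; apply: eq_bigr => i _.
  by rewrite -scaler_int floorK.
apply/negPn/negP => ci.
pose r := c i - (Num.floor (c i))%:~R.
have r0 : 0 < r.
  rewrite lt_neqAle subr_ge0 floor_le// andbT eq_sym subr_eq0.
  by apply: contra ci => /eqP ->; rewrite intr_int.
have r1 : r < 1 by have := floorD1_gt (c i); rewrite intrD ltrBlDl.
pose b' j := if j == i then x - b i *~ Num.floor (c i) else b j.
have Ab' j : A (b' j).
  rewrite /b'; case: eqP => // _; have [_ AB] := AS; apply: AB => //.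
  exact: submodMz.
pose C : 'M[rat]_n := \matrix_(j, l)
  (if j == i then c l - (Num.floor (c i))%:~R *+ (l == i) else (j == l)%:R).
have b'E j : b' j = \sum_l C j l *: b l.
  rewrite /b'; have [->|ji] := eqVneq j i.
    rewrite xE -scaler_int; under [RHS]eq_bigr do rewrite mxE eqxx scalerBl.
    rewrite big_split/=; congr (_ + _); rewrite (bigD1 i)//= eqxx mulr1n.
    by rewrite big1 ?addr0// => l /negbTE ->; rewrite mulr0n scale0r oppr0.
  rewrite (bigD1 j)//= mxE (negbTE ji) eqxx scale1r big1 ?addr0// => l lj.
  by rewrite mxE (negbTE ji) eq_sym (negbTE lj) scale0r.
have detC : \det C = r.
  rewrite (expand_det_col _ i) (bigD1 i)//= mxE eqxx mulr1n -/r.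
  rewrite big1 ?addr0 => [|j ji]; last by rewrite mxE (negbTE ji) mul0r.
  rewrite /cofactor addnn -signr_odd odd_double expr0 mul1r.
  suff -> : row' i (col' i C) = 1%:M by rewrite det1 mulr1.
  by apply/matrixP => j l; rewrite !mxE (inj_eq lift_inj) eq_sym (negbTE (neq_lift _ _)).
have db' := trace_disc_change b'E; rewrite detC in db'.
have b'0 : trace_disc b' != 0 by rewrite db' mulf_neq0// expf_neq0// gt_eqF.
have : P (size b') by apply/asboolP; exists b'.
move=> /kmin; rewrite -bk -(ler_nat rat) !sizeE// db' normrM.
rewrite ler_pM2l ?exprn_even_gt0 ?dn0//= leNgt => /negP; apply.
rewrite gtr_pMl ?normr_gt0// ger0_norm ?exprn_even_ge0//.
by rewrite expr_lt1// ltW.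
Qed.

End Lattices.

(** * Index and discriminant *)

Section Index.
Variable F : fieldExtType rat.
Local Notation n := (\dim {:F}).
Implicit Types (A B : set F) (b w v : 'I_n -> F) (M : 'M[int]_n).

Definition coset (B : set F) (x : F) : set F := [set x + y | y in B].

Definition coset_count (A B : set F) : nat :=
  #|` fset_set [set coset B x | x in A] |.

Lemma eq_coset B x y : is_submod B -> (coset B x = coset B y) <-> B (x - y).
Proof.
move=> BS; have [B0 BB] := BS; split=> [xy|Bxy].
  have : coset B y x by rewrite -xy; exists 0 => //; rewrite addr0.
  by move=> [z Bz <-]; rewrite [y + z]addrC addrK.
apply/seteqP; split=> _ [z Bz <-].
  by exists (x - y + z); [exact: submodD|rewrite addrA subrKC].
exists (z - (x - y)); first exact: BB.
by ring.
Qed.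

Definition int_comb b (c : 'rV[int]_n) : F := \sum_j b j *~ c 0 j.
Definition int_change M b : 'I_n -> F := fun i => \sum_j b j *~ M i j.

Lemma int_combM M b c : int_comb (int_change M b) c = int_comb b (c *m M).
Proof.
rewrite /int_comb /int_change; under eq_bigr do rewrite mulrz_suml.
rewrite exchange_big; apply: eq_bigr => j _; rewrite mxE mulrz_sumr.
by apply: eq_bigr => i _; rewrite -mulrzA mulrC.
Qed.

Lemma trace_disc_int_change M b :
  trace_disc (int_change M b) = ((\det M)%:~R) ^+ 2 * trace_disc b.
Proof.
rewrite -det_map_mx; apply: trace_disc_change => i.
by apply: eq_bigr => j _; rewrite mxE scaler_int.
Qed.

Lemma int_comb_inj b c : trace_disc b != 0 -> int_comb b c = 0 -> c = 0.
Proof.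
move=> b0 cb; apply/rowP => i; rewrite mxE; apply: (@intr_inj rat).
apply: (@trace_disc_free _ b (fun i => (c 0 i)%:~R)) => //.
by rewrite -[RHS]cb; apply: eq_bigr => j _; rewrite scaler_int.
Qed.

Lemma int_combB b c c' : int_comb b (c - c') = int_comb b c - int_comb b c'.
Proof.
rewrite /int_comb -sumrB; apply: eq_bigr => j _.
by rewrite !mxE mulrzBr.
Qed.

Lemma zbasis_comb A b x : is_submod A -> zbasis A b ->
  A x <-> exists c, x = int_comb b c.
Proof.
move=> AS [Ab _ Aspan]; split=> [/Aspan[c ->]|[c ->]]; last exact: submod_comb.
by exists (\row_j c j); apply: eq_bigr => j _; rewrite mxE.
Qed.

(** In a basis adapted to the sublattice by the Smith normal form, the cosets
    are represented by the integer points of a box. *)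
Lemma coset_count_zbasis A B b w : is_submod A -> is_submod B -> B `<=` A ->
  zbasis A b -> zbasis B w ->
  finite_set [set coset B x | x in A] /\
  trace_disc w = (coset_count A B)%:R ^+ 2 * trace_disc b.
Proof.
move=> AS BS BA Ab Bw; have [_ b0 _] := Ab; have [Bw' w0 _] := Bw.
have /choice[c wE] (i : 'I_n) : exists c, w i = int_comb b c.
  by apply/(zbasis_comb _ AS Ab); apply: BA.
pose C : 'M[int]_n := \matrix_i c i.
have {}wE i : w i = int_change C b i.
  by rewrite wE; apply: eq_bigr => j _; rewrite mxE.
have [L LU [R RU [d _ CE]]] := int_Smith_normal_form C.
pose D : 'M[int]_n := diag_mx (\row_i d`_i).
have {}CE : C = L *m D *m R.
  by rewrite CE; congr (_ *m _ *m _); apply/matrixP => i j; rewrite !mxE.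
have unit_det M : M \in unitmx -> (\det M) ^+ 2 = 1.
  by rewrite unitmxE => /orP[] /eqP->; rewrite ?sqrrN expr1n.
pose v := int_change R b.
have discw : trace_disc w = (\det D)%:~R ^+ 2 * trace_disc b.
  have -> : trace_disc w = trace_disc (int_change C b).
    by rewrite /trace_disc; congr (\det _); apply/matrixP => i j; rewrite !mxE !wE.
  rewrite trace_disc_int_change CE !det_mulmx -!rmorphXn/= !exprMn.
  by rewrite (unit_det L)// (unit_det R)// mul1r mulr1.
have v0 : trace_disc v != 0.
  by rewrite /v trace_disc_int_change -rmorphXn/= unit_det// mul1r.
have Av x : A x <-> exists z, x = int_comb v z.
  rewrite (zbasis_comb _ AS Ab); split=> -[z ->]; last first.
    by exists (z *m R); rewrite -int_combM.
  by exists (z *m invmx R); rewrite int_combM mulmxKV.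
have Bv x : B x <-> exists z, x = int_comb v (z *m D).
  have wC z : int_comb w z = int_comb v (z *m L *m D).
    rewrite int_combM.
    have -> : z *m L *m D *m R = z *m C by rewrite CE !mulmxA.
    rewrite -int_combM.
    by apply: eq_bigr => j _; rewrite wE.
  rewrite (zbasis_comb _ BS Bw); split=> -[z ->]; first by exists (z *m L).
  by exists (z *m invmx L); rewrite wC mulmxKV.
have d0 (i : 'I_n) : d`_i != 0.
  move: w0; rewrite discw mulf_eq0 negb_or => /andP[+ _].
  rewrite expf_eq0/= intr_eq0 det_diag => /prodf_neq0/(_ i isT).
  by rewrite mxE.
pose T := {dffun forall i : 'I_n, 'I_`|d`_i|}.
pose pt (r : T) : 'rV[int]_n := \row_i (r i : nat)%:Z.
pose f r := coset B (int_comb v (pt r)).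
have cosetsE : [set coset B x | x in A] = f @` [set: T].
  apply/seteqP; split=> [_ [x /Av[z ->] <-]|_ [r _ <-]]; last first.
    by exists (int_comb v (pt r)) => //; apply/Av; exists (pt r).
  have lt_r (i : 'I_n) : is_true (leq (absz (modz (z 0 i) d`_i)).+1 (absz d`_i)).
    by rewrite -ltz_nat gez0_abs ?modz_ge0// ltz_mod.
  exists ([ffun i => Ordinal (lt_r i)] : T) => //.
  apply/eq_coset => //; rewrite -int_combB; apply/Bv.
  exists (- \row_i divz (z 0 i) d`_i); congr int_comb; apply/rowP => i.
  rewrite mul_mx_diag !mxE ffunE /= gez0_abs ?modz_ge0// mulNr.
  by rewrite {2}(divz_eq (z 0 i) d`_i) ; ring.
have f_inj : injective f.
  move=> r r' /(eq_coset _ _ BS); rewrite -int_combB => /Bv[z /eqP].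
  rewrite -subr_eq0 -int_combB => /eqP/(int_comb_inj v0) rz.
  apply/ffunP => i; apply: val_inj; move/rowP/(_ i): rz.
  rewrite mul_mx_diag !mxE => /eqP; rewrite subr_eq0 => /eqP E.
  apply/eqP; rewrite -eqz_nat.
  have small (t : 'I_`|d`_i|) : modz (t : nat)%:Z d`_i = t.
    by rewrite -modz_abs modz_small// ltz_nat ltn_ord.
  rewrite -[(r i : nat)%:Z]small -[(r' i : nat)%:Z]small.
  have {}E : (r i : nat)%:Z = z 0 i * d`_i + (r' i : nat)%:Z by rewrite -E subrK.
  by apply/eqP; rewrite E modzMDl.
have finT : finite_set [set: T] by exact: finite_finset.
have finf : finite_set (f @` [set: T]) by exact: finite_image.
split; first by rewrite cosetsE.
rewrite discw; congr (_ * _); rewrite /coset_count cosetsE.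
have -> : fset_set (f @` [set: T]) = [fset f r | r in T]%fset.
  apply/fsetP => X; rewrite in_fset_set//.
  apply/idP/imfsetP => [/set_mem[r _ <-]|[r _ ->]]; first by exists r.
  by apply/mem_set; exists r.
rewrite card_imfset//= -cardE card_dep_ffun foldrE big_image det_diag.
rewrite (eq_bigr (fun i : 'I_n => absz d`_i)) => [|i _]; last by rewrite card_ord.
rewrite rmorph_prod/= natr_prod -!prodrXl; apply: eq_bigr => i _.
by rewrite mxE natr_absz intr_norm real_normK ?num_real.
Qed.

End Index.

(** * Fractional ideals *)

Section FractionalIdeals.
Variable F : fieldExtType rat.
Local Notation n := (\dim {:F}).
Local Notation O := (@ringint F).
Implicit Types (A B C J P : set F) (b w : 'I_n -> F).

Definition is_omod A : Prop :=
  is_submod A /\ forall a x, ringint a -> A x -> A (a * x).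

Definition is_frac A : Prop :=
  [/\ is_omod A, exists2 x, A x & x != 0 &
      exists2 d, d != 0 & forall x, A x -> ringint (d * x)].

Lemma frac_submod A : is_frac A -> is_submod A.
Proof. by case=> [[]]. Qed.

Lemma is_omod_ringint : is_omod O.
Proof. by split; [exact: zmod_ringint|exact: ringintM]. Qed.

Lemma is_omod_ideal P : is_ideal P -> is_omod P.
Proof.
move=> [_ P0 PD PM]; split=> //; split=> // x y Px Py.
by rewrite -[- y]mulN1r; apply: PD => //; apply: PM => //; exact: (ringint_int F (-1)).
Qed.

Lemma is_ideal_omod P : is_omod P -> P `<=` O -> is_ideal P.
Proof. by move=> [PS PM] PO; split=> //; [case: PS|move=> x y; exact: submodD]. Qed.

Lemma is_omod_mul A B : is_omod A -> is_omod (ideal_mul A B).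
Proof.
move=> [AS AM]; split; first exact: zmod_ideal_mul.
move=> a _ aO [s [sAB ->]]; exists [seq (a * p.1, p.2) | p <- s]; split.
  by move=> _ /mapP[p ps ->] /=; have [Ap Bp] := sAB p ps; split=> //; exact: AM.
by rewrite big_map mulr_sumr; apply: eq_bigr => p _; rewrite mulrA.
Qed.

Lemma is_omod_inv A : is_omod (ideal_inv A).
Proof.
split; first exact: zmod_ideal_inv.
by move=> a x aO xA y Ay; rewrite -mulrA; apply: ringintM => //; exact: xA.
Qed.

Lemma mem_ideal_mul A B x y : A x -> B y -> ideal_mul A B (x * y).
Proof.
move=> Ax By; exists [:: (x, y)]; rewrite big_seq1; split=> // p.
by rewrite inE => /eqP ->.
Qed.

Lemma ideal_mul_sub A B C : is_submod C ->
  (forall x y, A x -> B y -> C (x * y)) -> ideal_mul A B `<=` C.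
Proof.
move=> CS ABC _ [s [sAB ->]]; rewrite big_seq; apply: submod_sum => // p ps.
by have [Ap Bp] := sAB p ps; exact: ABC.
Qed.

Lemma ideal_mulS A A' B : is_submod A' -> A `<=` A' ->
  ideal_mul A B `<=` ideal_mul A' B.
Proof.
move=> A'S AA'; apply: ideal_mul_sub; first exact: zmod_ideal_mul.
by move=> x y /AA' Ax By; exact: mem_ideal_mul.
Qed.

Lemma ideal_mulC A B : is_submod A -> is_submod B ->
  ideal_mul A B = ideal_mul B A.
Proof.
by move=> AS BS; apply/seteqP; split; apply: ideal_mul_sub;
  try exact: zmod_ideal_mul; move=> x y Ax By; rewrite mulrC; exact: mem_ideal_mul.
Qed.

Lemma ideal_mulA A B C : is_submod A -> is_submod B -> is_submod C ->
  ideal_mul A (ideal_mul B C) = ideal_mul (ideal_mul A B) C.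
Proof.
move=> AS BS CS; have mS := @zmod_ideal_mul F.
apply/seteqP; split; apply: ideal_mul_sub; do ?exact: mS; do ?exact/mS/mS.
- move=> x _ Ax [s [sBC ->]]; rewrite mulr_sumr big_seq.
  apply: submod_sum => [|p /sBC[Bp Cp]]; first exact/mS/mS.
  by rewrite mulrA; apply: mem_ideal_mul => //; exact: mem_ideal_mul.
- move=> _ z [s [sAB ->]] Cz; rewrite mulr_suml big_seq.
  apply: submod_sum => [|p /sAB[Ap Bp]]; first exact/mS.
  by rewrite -mulrA; apply: mem_ideal_mul => //; exact: mem_ideal_mul.
Qed.

Lemma ideal_mulO A : is_omod A -> ideal_mul O A = A.
Proof.
move=> [AS AM]; apply/seteqP; split; first exact: ideal_mul_sub.
by move=> x Ax; rewrite -[x]mul1r; apply: mem_ideal_mul => //; exact: ringint1.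
Qed.

Lemma is_frac_ringint : is_frac O.
Proof.
split; first exact: is_omod_ringint; first by exists 1; [exact: ringint1|exact: oner_neq0].
by exists 1; [exact: oner_neq0|move=> x; rewrite mul1r].
Qed.

Lemma is_frac_mul A B : is_frac A -> is_frac B -> is_frac (ideal_mul A B).
Proof.
move=> [AM [x Ax x0] [d d0 dA]] [BM [y By y0] [e e0 eB]]; split.
- exact: is_omod_mul.
- by exists (x * y); [exact: mem_ideal_mul|rewrite mulf_neq0].
- exists (d * e); first by rewrite mulf_neq0.
  move=> _ [s [sAB ->]]; rewrite mulr_sumr big_seq; apply: submod_sum.
    exact: zmod_ringint.
  by move=> p /sAB[Ap Bp]; rewrite mulrACA; apply: ringintM; [exact: dA|exact: eB].
Qed.

Lemma is_frac_inv A : is_frac A -> is_frac (ideal_inv A).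
Proof.
move=> [AM [x Ax x0] [d d0 dA]]; split; first exact: is_omod_inv.
  by exists d.
by exists x => // y yA; rewrite mulrC; exact: yA.
Qed.

Lemma is_frac_ideal P : is_ideal P -> (exists2 x, P x & x != 0) -> is_frac P.
Proof.
move=> PI Pn0; have [PO _ _ _] := PI; split=> //; first exact: is_omod_ideal.
by exists 1; [exact: oner_neq0|move=> x /PO; rewrite mul1r].
Qed.

(** Multiplying a rational basis by a common denominator and by an element of
    [A] gives an independent family of the right size inside [A]. *)
Lemma zbasis_frac A : is_frac A -> exists b, zbasis A b.
Proof.
move=> [[AS AM] [a Aa a0] [d d0 dA]].
have [m m0 mO] := ringint_multiple d^-1.
apply: (@zbasis_exists F A m) => //.
  move=> x Ax; rewrite -[x](mulKf d0) -mulrnAl.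
  by apply: ringintM => //; exact: dA.
pose v (i : 'I_n) := (vbasis {:F})`_i.
have /choice[k kP] (i : 'I_n) : exists k, (0 < k)%N /\ ringint (v i *+ k).
  by have [k k0 kO] := ringint_multiple (v i); exists k.
pose w i := v i *+ k i * a.
exists w; split; first by move=> i; apply: AM => //; have [] := kP i.
apply: contra_neq (trace_disc_vbasis F) => w0.
pose C : 'M[rat]_n :=
  \matrix_(i, j) (coord (vbasis {:F}) j (v i / a) / (k j)%:R).
rewrite (@trace_disc_change _ C w) ?w0 ?mulr0// => i.
rewrite -/(v i) -[LHS](divfK a0) {1}(coord_vbasis (memvf (v i / a))) mulr_suml.
apply: eq_bigr => j _; rewrite mxE /w -/(v j) -scaler_nat -!scalerAl scalerA.
by rewrite divfK// pnatr_eq0 -lt0n; have [] := kP j.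
Qed.

Lemma finite_coset A B : is_frac A -> is_frac B -> B `<=` A ->
  finite_set [set coset B x | x in A].
Proof.
move=> Af Bf BA; have [b Ab] := zbasis_frac Af; have [w Bw] := zbasis_frac Bf.
by have [] := coset_count_zbasis (frac_submod Af) (frac_submod Bf) BA Ab Bw.
Qed.

Lemma zbasis_disc_unique A b w : is_submod A -> zbasis A b -> zbasis A w ->
  trace_disc b = trace_disc w.
Proof.
move=> AS Ab Aw; have [_ ->] := coset_count_zbasis AS AS (@subset_refl _ A) Ab Aw.
suff -> : coset_count A A = 1%N by rewrite expr1n mul1r.
rewrite /coset_count (_ : [set _ | _ in _] = [set A]).
  by rewrite fset_set1 cardfs1.
have cosetA x : A x -> coset A x = A.
  move=> Ax; transitivity (coset A 0); last first.
    apply/seteqP; split=> [_ [y Ay <-]|y Ay]; first by rewrite add0r.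
    by exists y; rewrite ?add0r.
  by apply/eq_coset => //; rewrite subr0.
apply/seteqP; split=> [_ [x Ax <-]|_ ->]; first exact: cosetA.
by exists 0; [case: AS|rewrite cosetA//; case: AS].
Qed.

Definition lattice_disc A : rat := trace_disc (xget (fun=> 0) [set b | zbasis A b]).

Lemma lattice_discE A b : is_submod A -> zbasis A b -> trace_disc b = lattice_disc A.
Proof.
move=> AS Ab; apply: (zbasis_disc_unique AS Ab).
exact: (@xgetPex _ _ [set b | zbasis A b]) (ex_intro _ b Ab).
Qed.

Lemma lattice_disc_neq0 A : is_frac A -> lattice_disc A != 0.
Proof.
move=> Af; have [b Ab] := zbasis_frac Af; rewrite -(lattice_discE (frac_submod Af) Ab).
by case: Ab.
Qed.

Lemma lattice_disc_sub A B : is_frac A -> is_frac B -> B `<=` A ->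
  lattice_disc B = (coset_count A B)%:R ^+ 2 * lattice_disc A.
Proof.
move=> Af Bf BA; have [b Ab] := zbasis_frac Af; have [w Bw] := zbasis_frac Bf.
have [_] := coset_count_zbasis (frac_submod Af) (frac_submod Bf) BA Ab Bw.
by rewrite (lattice_discE (frac_submod Af) Ab) (lattice_discE (frac_submod Bf) Bw).
Qed.

(** The definition of [disc F] takes an integral basis picked by choice; one
    exists by [zbasis_frac], and any of them is a [zbasis] of the ring of
    integers, so that independence of the choice applies. *)
Lemma discE : disc F = lattice_disc O.
Proof.
have OS := @zmod_ringint F.
have [b Ob] := zbasis_frac is_frac_ringint; have [bO b0 bspan] := Ob.
rewrite /disc; set w := xget _ _.
suff wO : zbasis O w by rewrite -(lattice_discE OS wO).
have : is_integral_basis w.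
  apply: (@xgetPex _ _ [set w | is_integral_basis w]).
  exists [ffun i => b i]; split=> [i|x /bspan[c xE]]; first by rewrite ffunE.
  exists [ffun i => c i]; split.
    by rewrite xE; apply: eq_bigr => i _; rewrite !ffunE.
  move=> c' xE'; apply/ffunP => i; rewrite ffunE; apply/eqP; rewrite -subr_eq0.
  have /rowP/(_ i) : (\row_i (c i - c' i)) = 0.
    apply: (int_comb_inj b0); rewrite /int_comb.
    under eq_bigr do rewrite mxE mulrzBr.
    rewrite sumrB -xE xE'; apply/eqP; rewrite subr_eq0; apply/eqP.
    by apply: eq_bigr => j _; rewrite ffunE.
  by rewrite !mxE => ->.
move=> [wO wspan]; split=> //; last by move=> x /wspan[c [xE _]]; exists c.
have /choice[c cE] (i : 'I_n) : exists c : {ffun 'I_n -> int}, b i = \sum_j w j *~ c j.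
  by have [c [cE _]] := wspan _ (bO i); exists c.
apply: contra_neq b0 => w0.
have <- : trace_disc (int_change (\matrix_(i, j) c i j) w) = trace_disc b.
  rewrite /trace_disc; congr (\det _); apply/matrixP => i j; rewrite !mxE.
  by rewrite !cE; congr field_trace; congr (_ * _); apply: eq_bigr => k _; rewrite mxE.
by rewrite trace_disc_int_change w0 mulr0.
Qed.

End FractionalIdeals.

(** * Invertibility of maximal ideals *)

Section MaximalIdeals.
Variable F : fieldExtType rat.
Local Notation n := (\dim {:F}).
Local Notation O := (@ringint F).
Implicit Types (A B C J P : set F).

Definition is_invertible A : Prop :=
  is_frac A /\ exists2 B, is_frac B & ideal_mul A B = O.

(** The traces of the powers of [1/2] are the numbers [n / 2^k]; for [k = n]
    this is not an integer. *)
Lemma half_not_ringint : ~ @ringint F 2^-1.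
Proof.
move=> h; have hX k : @ringint F (2^-1 ^+ k).
  by elim: k => [|k IH]; rewrite ?exprS; [exact: ringint1|exact: ringintM].
have := ringint_trace (hX n).
have -> : (2^-1 ^+ n : F) = (2^-1 ^+ n : rat) *: 1 + 0.
  by rewrite addr0 -(rmorph_nat (in_alg F) 2) -fmorphV -rmorphXn.
rewrite field_trace_lin field_trace0 addr0 field_trace1 => /intrP[z zE].
have n0 : (0 < n)%N by exact: (adim_gt0 {:F}%AS).
have : (0 < z < 1)%R.
  rewrite -!(ltr_int rat) -zE; apply/andP; split.
    by rewrite mulr_gt0 ?exprn_gt0 ?invr_gt0 ?ltr0n.
  by rewrite exprVn mulrC ltr_pdivrMr ?exprn_gt0// mul1r -natrX ltr_nat ltn_expl.
by move=> /andP[z0]; rewrite ltNge -gtz0_ge1 z0.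
Qed.

(** The zero ideal is not maximal, because the ideal generated by [2] lies
    strictly between it and the whole ring. *)
Lemma maximal_nonzero P : is_maximal P -> exists2 x, P x & x != 0.
Proof.
move=> [PI PnO Pmax]; apply: contrapT => P0.
have {}P0 x : P x -> x = 0.
  by move=> Px; apply/eqP; apply: contra_notT P0 => x0; exists x.
pose J : set F := [set x | ringint (x / 2)].
have two : (2 : F) != 0 by rewrite -(rmorph_nat (in_alg F)) fmorph_eq0 pnatr_eq0.
have JO : J `<=` O.
  move=> x Jx; rewrite -[x](divfK two); apply: ringintM => //.
  exact: (ringint_int F 2).
have JI : is_ideal J.
  split=> //; rewrite /J/=.
  - by rewrite mul0r; exact: ringint0.
  - by move=> x y; rewrite mulrDl; exact: ringintD.
  - by move=> a x aO; rewrite -mulrA; exact: ringintM.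
have J2 : J 2 by rewrite /J/= divff//; exact: ringint1.
case: (Pmax J JI).
- by move=> x /P0 ->; case: JI.
- by move=> JP; move: J2; rewrite JP => /P0 /eqP; apply/negP.
- move=> JO'; have : J 1 by rewrite JO'; exact: ringint1.
  by rewrite /J/= mul1r; exact: half_not_ringint.
Qed.

Lemma ideal_eqT P : is_ideal P -> P 1 -> P = O.
Proof.
move=> [PO _ _ PM] P1; apply/seteqP; split=> // x Ox.
by rewrite -[x]mulr1; exact: PM.
Qed.

Lemma maximal_not1 P : is_maximal P -> ~ P 1.
Proof. by move=> [PI PnO _] /(ideal_eqT PI). Qed.

Lemma maximal_prime P x y : is_maximal P -> ringint x -> ringint y ->
  P (x * y) -> ~ P y -> P x.
Proof.
move=> [PI PnO Pmax] xO yO Pxy nPy; have [PO P0 PD PM] := PI.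
have [PS _] := is_omod_ideal PI.
pose J : set F := [set z | exists p u, [/\ P p, ringint u & z = p + u * y]].
have JI : is_ideal J.
  split.
  - move=> _ [p [u [Pp uO ->]]]; apply: ringintD; first exact: PO.
    exact: ringintM.
  - by exists 0, 0; split=> //; [exact: ringint0|rewrite mul0r addr0].
  - move=> _ _ [p [u [Pp uO ->]]] [p' [u' [Pp' uO' ->]]].
    exists (p + p'), (u + u'); split; [exact: PD|exact: ringintD|].
    by rewrite mulrDl addrACA.
  - move=> a _ aO [p [u [Pp uO ->]]].
    exists (a * p), (a * u); split; [exact: PM|exact: ringintM|].
    by rewrite mulrDr mulrA.
have PJ : P `<=` J.
  by move=> p Pp; exists p, 0; split=> //; [exact: ringint0|rewrite mul0r addr0].
have Jy : J y by exists 0, 1; split=> //; [exact: ringint1|rewrite add0r mul1r].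
case: (Pmax J JI PJ) => JE; first by rewrite JE in Jy.
have : J 1 by rewrite JE; exact: ringint1.
move=> [p [u [Pp uO E]]]; rewrite -[x]mulr1 E mulrDr; apply: PD; first exact: PM.
by rewrite mulrCA; apply: PM.
Qed.

(** A nonzero maximal ideal [P] is the annihilator of some element [b] of
    [O / aO], for any nonzero [a] in [P]: take [b] such that the annihilator is
    as large as possible among those contained in [P].  Elements outside [P] are
    then regular modulo the annihilator, so by finiteness (pigeonhole on powers)
    the elements of [P] are nilpotent modulo it, and a power just outside the
    annihilator would give a larger one. *)
Lemma maximal_annihilator P a : is_maximal P -> P a -> a != 0 ->
  exists b, [/\ ringint b, ~ ringint (b / a) &
                forall y, P y -> ringint (b / a * y)].
Proof.
move=> Pmax Pa a0; have [PI PnO _] := Pmax; have [PO P0 PD PM] := PI.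
have [PS _] := is_omod_ideal PI; have [_ PB] := PS.
pose K b : set F := [set y | ringint y /\ ringint (b / a * y)].
pose aO : set F := [set x | ringint (x / a)].
have aOO : aO `<=` O.
  by move=> x xa; rewrite -[x](divfK a0); apply: ringintM => //; exact: PO.
have aOI : is_ideal aO.
  split=> //; rewrite /aO/=.
  - by rewrite mul0r; exact: ringint0.
  - by move=> x y; rewrite mulrDl; exact: ringintD.
  - by move=> c x cO; rewrite -mulrA; exact: ringintM.
have aOS : is_submod aO by have [] := is_omod_ideal aOI.
have fin : finite_set [set coset aO x | x in O].
  apply: finite_coset => //; first exact: is_frac_ringint.
  by apply: is_frac_ideal => //; exists a; rewrite // /aO/= divff//; exact: ringint1.
have finK b : finite_set [set coset aO x | x in K b].
  by apply: sub_finite_set fin => _ [x [xO _] <-]; exists x.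
pose size b := #|` fset_set [set coset aO x | x in K b] |.
have sizeN b : (size b <= #|` fset_set [set coset aO x | x in O] |)%N.
  apply: fsubset_leq_card; apply/fsubsetP => X; rewrite !in_fset_set//.
  by move=> /set_mem[x [xO _] <-]; apply/mem_set; exists x.
pose Q k := `[< exists b, [/\ ringint b, K b `<=` P & size b = k] >].
have exQ : exists k, Q k.
  exists (size 1); apply/asboolP; exists 1; split=> //; first exact: ringint1.
  move=> y [yO]; rewrite mul1r => ya; rewrite -[y](mulVKf a0) mulrC.
  exact: PM.
have bQ k : Q k -> (k <= #|` fset_set [set coset aO x | x in O] |)%N.
  by move=> /asboolP[b [_ _ <-]].
case: (ex_maxnP exQ bQ) => k /asboolP[b [bO KP bk]] kmax.
have Kmax c : ringint c -> K b `<=` K (b * c) -> K (b * c) `<=` P ->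
    K (b * c) `<=` K b.
  move=> cO Ksub KcP y Ky.
  have : Q (size (b * c)) by apply/asboolP; exists (b * c); split=> //; exact: ringintM.
  move=> /kmax; rewrite -bk => le_size.
  have E : fset_set [set coset aO x | x in K b] =
           fset_set [set coset aO x | x in K (b * c)].
    apply/eqP; rewrite eqEfcard le_size andbT; apply/fsubsetP => X.
    rewrite !in_fset_set// => /set_mem[x Kx <-]; apply/mem_set.
    by exists x => //; exact: Ksub.
  have : coset aO y \in fset_set [set coset aO x | x in K b].
    by rewrite E in_fset_set//; apply/mem_set; exists y.
  rewrite in_fset_set// => /set_mem[x [xO Kx]] /(eq_coset _ _ aOS) xy.
  have [yO _] := Ky; split=> //.
  rewrite -[y](subKr x) mulrBr; apply: ringintB => //.
  by rewrite mulrAC -mulrA; exact: ringintM.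
have KS c y : ringint c -> K b y -> K b (c * y).
  by move=> cO [yO by_]; split; [exact: ringintM|rewrite mulrCA; exact: ringintM].
have Kc c y : ringint c -> ringint y -> K b (c * y) -> K (b * c) y.
  move=> cO yO [_ bcy]; split=> //.
  by move: bcy; rewrite mulrA [b / a * c]mulrAC.
have cK c y : ringint c -> K (b * c) y -> K b (c * y).
  move=> cO [yO bcy]; split; first exact: ringintM.
  by rewrite mulrA [b / a * c]mulrAC.
have Ksub c : ringint c -> K b `<=` K (b * c).
  by move=> cO y Ky; have [yO _] := Ky; apply: Kc => //; exact: KS.
have regular z w : ringint z -> ringint w -> ~ P z -> K b (z * w) -> K b w.
  move=> zO wO nPz Kzw; apply: (Kmax z) => //; [exact: Ksub| |exact: Kc].
  move=> y Ky; apply: (maximal_prime Pmax _ zO) => //; first by case: Ky.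
  by rewrite mulrC; apply: KP; exact: cK.
have not1 := maximal_not1 Pmax.
exists b; split=> //.
  move=> ba; apply: not1; apply: KP; split; first exact: ringint1.
  by rewrite mulr1.
suff PK : P `<=` K b by move=> y /PK[].
move=> y Py; apply: contrapT => nKy.
have yO := PO _ Py.
have yXO i : ringint (y ^+ i).
  by elim: i => [|i IH]; rewrite ?exprS; [exact: ringint1|exact: ringintM].
have [i [m Kim]] : exists i m, K b (y ^+ i * (1 - y ^+ m.+1)).
  apply: contrapT => nK.
  pose f i := coset aO (y ^+ i).
  have H i j : (i < j)%N -> f i <> f j.
    move=> ij /esym/(eq_coset _ _ aOS) aij; apply: nK; exists i, (j - i).-1.
    rewrite prednK ?subn_gt0// mulrBr mulr1 -exprD subnKC ?(ltnW ij)//.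
    rewrite -opprB -[- _]mulN1r; apply: KS; first exact: (ringint_int F (-1)).
    by split; [exact: ringintB|rewrite mulrAC -mulrA; exact: ringintM].
  have f_inj : injective f.
    move=> i j fij; apply/eqP; apply: contrapT => /negP.
    rewrite neq_ltn => /orP[ij|ji]; first exact: (H _ _ ij fij).
    exact: (H _ _ ji (esym fij)).
  pose N := #|` fset_set [set coset aO x | x in O] |.
  have : (N.+1 <= N)%N.
    have <- : #|` [fset f (val i) | i in 'I_N.+1]%fset| = N.+1.
      by rewrite card_imfset/= -?cardE ?card_ord// => i j /f_inj/val_inj.
    apply: fsubset_leq_card; apply/fsubsetP => _ /imfsetP[i _ ->].
    by rewrite in_fset_set//; apply/mem_set; exists (y ^+ val i).
  by rewrite ltnn.
have {m Kim} Kyi : K b (y ^+ i).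
  apply: (regular (1 - y ^+ m.+1)) => //.
  - by apply: ringintB => //; exact: ringint1.
  - move=> P1; apply: not1; rewrite -[1](subrK (y ^+ m.+1)); apply: PD => //.
    by rewrite exprSr; exact: PM.
  - by rewrite mulrC.
have exi : exists i, `[< K b (y ^+ i) >] by exists i; apply/asboolP.
case: (ex_minnP exi) => -[|j] /asboolP Kj jmin.
  by apply: not1; apply: KP; move: Kj; rewrite expr0.
pose w := y ^+ j.
have nKw : ~ K b w.
  by move=> Kw; have := jmin j (asboolT Kw); rewrite ltnn.
have Kwy : K (b * w) y by apply: (Kc _ _ (yXO j) yO); rewrite -exprSr.
have [KwP|/existsNP[z /not_implyP[Kwz nPz]]] := pselect (K (b * w) `<=` P).
  by apply: nKy; by apply: (Kmax w _ _ KwP) => //; [exact: yXO|apply: Ksub; exact: yXO].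
apply: nKw; have [zO _] := Kwz; apply: (regular z) => //; first exact: yXO.
by rewrite mulrC; apply: cK => //; exact: yXO.
Qed.

Lemma maximal_is_frac P : is_maximal P -> is_frac P.
Proof.
by move=> Pmax; apply: is_frac_ideal; [case: Pmax|exact: maximal_nonzero].
Qed.

(** The product of [P] and its inverse is an ideal between [P] and [O].  It is
    not [P], since the elements of the inverse would then stabilise a finitely
    generated group and be integral. *)
Lemma maximal_mul_inv P : is_maximal P -> ideal_mul P (ideal_inv P) = O.
Proof.
move=> Pmax; have [PI PnO Pmax'] := Pmax; have [PO P0 PD PM] := PI.
have Pf := maximal_is_frac Pmax; have PS := frac_submod Pf.
have [a Pa a0] := maximal_nonzero Pmax.
have [b [bO nba bP]] := maximal_annihilator Pmax Pa a0.
pose M := ideal_mul P (ideal_inv P).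
have MO : M `<=` O.
  apply: ideal_mul_sub; first exact: zmod_ringint.
  by move=> x y Px yP; rewrite mulrC; exact: yP.
have PM' : P `<=` M.
  move=> x Px; rewrite -[x]mulr1; apply: mem_ideal_mul => // y /PO.
  by rewrite mul1r.
case: (Pmax' M) => //.
  by apply: is_ideal_omod => //; apply: is_omod_mul; exact: is_omod_ideal.
move=> MP; exfalso; apply: nba; have [w [Pw w0 wspan]] := zbasis_frac Pf.
(* If the product were [P], multiplication by [b / a] would map [P] to itself. *)
have stable i : P (b / a * w i).
  by rewrite -MP mulrC; apply: mem_ideal_mul.
have /choice[C CE] (i : 'I_n) : exists c : 'I_n -> int,
  b / a * w i = \sum_j w j *~ c j by exact: wspan.
apply: (@ringint_of_stable _ _ w (\matrix_(i, j) C i j)).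
  apply: contrapT => nw; have wz i : w i = 0.
    by apply/eqP; apply: contra_notT nw => wi; exists i.
  have n0 : (0 < n)%N by exact: (adim_gt0 {:F}%AS).
  have sum0 : \sum_i (1 : rat) *: w i = 0.
    by rewrite big1// => i _; rewrite wz scaler0.
  have /eqP := @trace_disc_free _ w (fun=> 1) w0 sum0 (Ordinal n0).
  by rewrite oner_eq0.
by move=> i; rewrite CE; apply: eq_bigr => j _; rewrite mxE.
Qed.

Lemma invertible_ringint : is_invertible O.
Proof.
split; first exact: is_frac_ringint.
by exists O; [exact: is_frac_ringint|apply: ideal_mulO; exact: is_omod_ringint].
Qed.

Lemma invertible_mul A B : is_invertible A -> is_invertible B ->
  is_invertible (ideal_mul A B).
Proof.
move=> [Af [A' A'f AA']] [Bf [B' B'f BB']]; split; first exact: is_frac_mul.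
exists (ideal_mul B' A'); first exact: is_frac_mul.
have sub (X : set F) : is_frac X -> is_submod X by exact: frac_submod.
have mS (X Y : set F) : is_frac X -> is_frac Y -> is_submod (ideal_mul X Y).
  by move=> Xf Yf; exact: frac_submod (is_frac_mul Xf Yf).
rewrite -ideal_mulA; do ?[exact: sub|exact: mS].
rewrite [ideal_mul B _]ideal_mulA ?BB'; do ?[exact: sub].
by rewrite ideal_mulO//; case: A'f.
Qed.

Lemma invertible_maximal P : is_maximal P -> is_invertible P.
Proof.
move=> Pmax; split; first exact: maximal_is_frac.
by exists (ideal_inv P); [exact/is_frac_inv/maximal_is_frac|exact: maximal_mul_inv].
Qed.

Lemma invertible_maximal_inv P : is_maximal P -> is_invertible (ideal_inv P).
Proof.
move=> Pmax; have Pf := maximal_is_frac Pmax.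
split; first exact: is_frac_inv.
exists P => //; rewrite ideal_mulC ?maximal_mul_inv//; apply: frac_submod => //.
exact: is_frac_inv.
Qed.

End MaximalIdeals.

(** * Discriminants of fractional ideals *)

Section IdealDiscriminant.
Variable F : fieldExtType rat.
Local Notation O := (@ringint F).
Implicit Types (A B C J P : set F).

Lemma frac_omod A : is_frac A -> is_omod A. Proof. by case. Qed.

(** [J / PJ] is a one-dimensional vector space over [O / P]: since [J] is
    invertible there is no module strictly between [PJ] and [J], so any element
    [a] of [J] outside [PJ] gives a bijection [x |-> x a] of the cosets. *)
Lemma coset_count_maximal P J : is_maximal P -> is_invertible J ->
  coset_count J (ideal_mul P J) = idealN P.
Proof.
move=> Pmax [Jf [J' J'f JJ']]; have [PI PnO Pmax'] := Pmax.
have [PO P0 PD PM] := PI.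
have Pf := maximal_is_frac Pmax.
have [PS JS J'S] := And3 (frac_submod Pf) (frac_submod Jf) (frac_submod J'f).
have [JM J'M PoM] := And3 (frac_omod Jf) (frac_omod J'f) (frac_omod Pf).
pose PJ := ideal_mul P J.
have PJf : is_frac PJ by exact: is_frac_mul.
have PJS := frac_submod PJf; have PJM := frac_omod PJf.
have PJJ : PJ `<=` J.
  by apply: ideal_mul_sub => // x y /PO xO Jy; case: JM => _; apply.
have cancel A : is_omod A -> ideal_mul (ideal_mul A J) J' = A.
  move=> AM; have [AS _] := AM.
  by rewrite -ideal_mulA// JJ' ideal_mulC ?ideal_mulO//; exact: zmod_ringint.
have cancel' A : is_omod A -> ideal_mul (ideal_mul A J') J = A.
  move=> AM; have [AS _] := AM.
  rewrite -ideal_mulA// [ideal_mul J' J]ideal_mulC// JJ' ideal_mulC ?ideal_mulO//.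
  exact: zmod_ringint.
have [a Ja nPJa] : exists2 a, J a & ~ PJ a.
  apply: contrapT => nex; apply: PnO; rewrite -(cancel P PoM) -JJ'.
  congr (ideal_mul _ J'); apply/seteqP; split=> // x Jx.
  by apply: contrapT => nPJx; apply: nex; exists x.
have kerE x : ringint x -> PJ (x * a) -> P x.
  move=> xO xa; pose L : set F := [set y | ringint y /\ PJ (y * a)].
  have LI : is_ideal L.
    split; first by move=> y [].
    - by split; [exact: ringint0|rewrite mul0r; case: PJS].
    - move=> y z [yO ya] [zO za]; split; first exact: ringintD.
      by rewrite mulrDl; exact: submodD.
    - move=> c y cO [yO ya]; split; first exact: ringintM.
      by rewrite -mulrA; case: PJM => _; apply.
  case: (Pmax' L) => //.
  - by move=> y Py; split; [exact: PO|exact: mem_ideal_mul].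
  - by move=> <-.
  - move=> LO; exfalso; apply: nPJa; have : L 1 by rewrite LO; exact: ringint1.
    by case=> _; rewrite mul1r.
have surj y : J y -> exists2 x, ringint x & PJ (y - x * a).
  pose N : set F := [set z | exists2 x, ringint x & PJ (z - x * a)].
  have NM : is_omod N.
    split; first split.
    - by exists 0; [exact: ringint0|rewrite mul0r subr0; case: PJS].
    - move=> z t [x xO zx] [u uO tu]; exists (x - u); first exact: ringintB.
      have -> : z - t - (x - u) * a = (z - x * a) - (t - u * a) by ring.
      by case: PJS => _; apply.
    - move=> c z cO [x xO zx]; exists (c * x); first exact: ringintM.
      by rewrite -mulrA -mulrBr; case: PJM => _; apply.
  have NS : is_submod N by case: NM.
  have Na : N a by exists 1; [exact: ringint1|rewrite mul1r subrr; case: PJS].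
  have PJN : PJ `<=` N.
    by move=> z zPJ; exists 0; [exact: ringint0|rewrite mul0r subr0].
  have NJ : N `<=` J.
    move=> z [x xO /PJJ zx]; rewrite -[z](subrK (x * a)); apply: submodD => //.
    by case: JM => _; apply.
  have NJ'O : ideal_mul N J' `<=` O by rewrite -JJ'; exact: ideal_mulS.
  case: (Pmax' (ideal_mul N J')).
  - by apply: is_ideal_omod => //; exact: is_omod_mul.
  - by rewrite -{1}(cancel P PoM); exact: ideal_mulS.
  - move=> NE; exfalso; apply: nPJa.
    by move: Na; rewrite -(cancel' N NM) NE.
  - move=> NE; suff -> : J = N by [].
    by rewrite -(cancel' N NM) NE ideal_mulO.
have finP : finite_set [set coset P x | x in O].
  by apply: finite_coset => //; exact: is_frac_ringint.
have finJ : finite_set [set coset PJ x | x in J] by exact: finite_coset.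
pose h (X : set F) := [set u | exists x, [/\ O x, X = coset P x & coset PJ (x * a) u]].
have hE x : O x -> h (coset P x) = coset PJ (x * a).
  move=> xO; apply/seteqP; split=> [u [y [yO /(eq_coset _ _ PS) xy yu]]|u xu].
    suff -> : coset PJ (x * a) = coset PJ (y * a) by [].
    by apply/eq_coset => //; rewrite -mulrBl; exact: mem_ideal_mul.
  by exists x.
rewrite /coset_count /idealN -/PJ.
have -> : fset_set [set coset PJ x | x in J] =
    [fset h X | X in fset_set [set coset P x | x in O]]%fset.
  rewrite -fset_set_image//; congr fset_set; apply/seteqP; split.
    move=> _ [y Jy <-]; have [x xO yx] := surj y Jy.
    exists (coset P x); first by exists x.
    by rewrite hE//; apply/esym/eq_coset.
  move=> _ [_ [x xO <-] <-]; exists (x * a); last by rewrite hE.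
  by case: JM => _; apply.
apply: card_in_imfset => X Y; rewrite !in_fset_set// => /set_mem[x xO <-] /set_mem[y yO <-].
rewrite !hE// => /(eq_coset _ _ PJS); rewrite -mulrBl => xy.
by apply/eq_coset => //; apply: kerE => //; exact: ringintB.
Qed.

Lemma lattice_disc_maximal P J : is_maximal P -> is_invertible J ->
  lattice_disc (ideal_mul P J) = (idealN P)%:R ^+ 2 * lattice_disc J.
Proof.
move=> Pmax Ji; have [Jf _] := Ji.
have Pf := maximal_is_frac Pmax.
rewrite -(coset_count_maximal Pmax Ji); apply: lattice_disc_sub => //.
  exact: is_frac_mul.
apply: ideal_mul_sub; first exact: frac_submod.
have [[PO _ _ _] _ _] := Pmax; have [_ JM] := frac_omod Jf.
by move=> x y /PO xO; exact: JM.
Qed.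

(** The count of an infinite set of cosets would be zero, so this includes the
    finiteness; it is read off from the nonvanishing of discriminants. *)
Lemma idealN_gt0 P : is_maximal P -> (0 < idealN P)%N.
Proof.
move=> Pmax; rewrite lt0n; apply/negP => /eqP N0.
have := lattice_disc_maximal Pmax (invertible_ringint F).
rewrite N0 expr0n mul0r => /eqP; apply/negP; apply: lattice_disc_neq0.
by apply: is_frac_mul; [exact: maximal_is_frac|exact: is_frac_ringint].
Qed.

Lemma lattice_disc_maximal_inv P J : is_maximal P -> is_invertible J ->
  lattice_disc (ideal_mul (ideal_inv P) J) = (idealN P)%:R ^- 2 * lattice_disc J.
Proof.
move=> Pmax Ji; have [Jf _] := Ji.
have Pf := maximal_is_frac Pmax; have P'f := is_frac_inv Pf.
have N0 : (idealN P)%:R ^+ 2 != 0 :> rat.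
  by rewrite expf_neq0// pnatr_eq0 -lt0n idealN_gt0.
apply: (mulfI N0); rewrite -lattice_disc_maximal//; last first.
  by apply: invertible_mul => //; exact: invertible_maximal_inv.
rewrite ideal_mulA ?maximal_mul_inv//; do ?exact: frac_submod.
by rewrite ideal_mulO ?mulVKf//; exact: frac_omod.
Qed.

Lemma invertible_exp P k : is_maximal P -> is_invertible (ideal_exp P k).
Proof.
move=> Pmax; have H A m : is_invertible A ->
    is_invertible (iter m (ideal_mul A) O).
  move=> Ai; elim: m => [|m IH] /=; first exact: invertible_ringint.
  exact: invertible_mul.
by case: k => m; apply: H; [exact: invertible_maximal|exact: invertible_maximal_inv].
Qed.

(** Each factor [P] or [P^-1] changes the lattice by an index [N(P)], so the
    discriminant changes by the square. *)
Lemma lattice_disc_exp P k J : is_maximal P -> is_invertible J ->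
  lattice_disc (ideal_mul (ideal_exp P k) J) =
  ((idealN P)%:R ^ k) ^+ 2 * lattice_disc J.
Proof.
move=> Pmax Ji; have [Jf _] := Ji.
have itm A c m : is_invertible A ->
    (forall J, is_invertible J ->
      lattice_disc (ideal_mul A J) = c * lattice_disc J) ->
    lattice_disc (ideal_mul (iter m (ideal_mul A) O) J) = c ^+ m * lattice_disc J.
  move=> Ai cA; have [Af _] := Ai; have H k' : is_invertible (iter k' (ideal_mul A) O).
    elim: k' => [|k' IH] /=; [exact: invertible_ringint|exact: invertible_mul].
  elim: m => [|m IH]; first by rewrite mul1r ideal_mulO//; exact: frac_omod.
  rewrite iterS -ideal_mulA; do ?exact: frac_submod; last by case: (H m) => /frac_submod.
  rewrite cA; last exact: invertible_mul.
  by rewrite IH mulrA -exprS.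
case: k => m; rewrite /ideal_exp.
  rewrite (itm _ _ _ _ (fun J => @lattice_disc_maximal P J Pmax)).
    by rewrite -exprM mulnC exprM.
  exact: invertible_maximal.
rewrite (itm _ _ _ _ (fun J => @lattice_disc_maximal_inv P J Pmax)).
  by rewrite NegzE /= -exprVn -exprM mulnC exprM exprVn.
exact: invertible_maximal_inv.
Qed.

Section Divisor.
Variables (R : realType) (S : infinite_places F R) (D : arakelov_divisor S).

(** The norm of the fractional ideal enters the theorem only through this
    discriminant. *)
Lemma frac_ideal_disc : is_frac (frac_ideal D) /\
  lattice_disc (frac_ideal D) = disc F *
    \prod_(P <- finsupp (fin_coef D)) ((idealN (val P))%:R ^ (- fin_coef D P)) ^+ 2.
Proof.
suff H (s : seq (max_ideal F)) :
    let I := \big[@ideal_mul F/O]_(P <- s) ideal_exp (val P) (- fin_coef D P) in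
    is_invertible I /\ lattice_disc I =
      disc F * \prod_(P <- s) ((idealN (val P))%:R ^ (- fin_coef D P)) ^+ 2.
  by have [[]] := H (finsupp (fin_coef D)).
elim: s => [|P s [IHi IHd]] /=.
  by rewrite !big_nil mulr1 discE; split=> //; exact: invertible_ringint.
have Pmax : is_maximal (val P) by apply/asboolP; exact: valP P.
rewrite !big_cons; split; first by apply: invertible_mul => //; exact: invertible_exp.
by rewrite lattice_disc_exp// IHd mulrCA.
Qed.

End Divisor.
End IdealDiscriminant.

(** * Sums and integrals over the line *)

Section IntegralTools.
Local Open Scope ereal_scope.
Variable R : realType.
Local Notation mu := (@lebesgue_measure R).

Lemma esum_countType (I : countType) (A : set I) (a : I -> \bar R) :
  (forall i, 0 <= a i) ->
  \esum_(i in A) a i = \sum_(k <oo)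
    oapp (fun i => if i \in A then a i else 0) 0 (@pickle_inv I k).
Proof.
move=> a0; pose b (k : nat) : \bar R :=
  oapp (fun i => if i \in A then a i else 0) 0 (@pickle_inv I k).
change (\esum_(i in A) a i = \sum_(k <oo) b k).
have b0 k : 0 <= b k.
  by rewrite /b; case: pickle_inv => //= i; case: ifP.
rewrite nneseries_esumT// (esum_mkcond A).
rewrite [RHS](esumID (range (@choice.pickle I)))// setTI [X in _ + X]esum1 ?adde0.
  rewrite (reindex_esum [set: I] _ (@choice.pickle I)).
    by apply: eq_esum => i _; rewrite /b pickleK_inv.
  by split=> [i _|i j _ _|k [i _ <-]]; [by exists i|exact: (pcan_inj (@pickleK_inv I))|by exists i].
move=> k [_ nk]; rewrite /b; case E : (pickle_inv k) => [i|//].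
by exfalso; apply: nk; exists i => //; have := @pickle_invK I k; rewrite E.
Qed.

(** Countable sums of nonnegative functions commute with integration; this is
    the statement for series, transported along a numbering of the index set. *)
Lemma integral_esum d (X : measurableType d) (m : {measure set X -> \bar R})
    (I : countType) (A : set I) (D : set X) (f : I -> X -> \bar R) :
  measurable D -> (forall i, measurable_fun D (f i)) ->
  (forall i x, 0 <= f i x) ->
  \int[m]_(x in D) (\esum_(i in A) f i x) = \esum_(i in A) \int[m]_(x in D) f i x.
Proof.
move=> mD mf f0; rewrite [RHS]esum_countType; last first.
  by move=> i; apply: integral_ge0.
under eq_integral do rewrite esum_countType//.
rewrite integral_nneseries//; last 2 first.
- move=> k; case: pickle_inv => [i|]/=; last exact: measurable_cst.
  by case: (i \in A); [exact: mf|exact: measurable_cst].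
- by move=> k x _; case: pickle_inv => //= i; case: ifP.
apply: eq_eseriesr => k _; case: pickle_inv => [i|]/=; last exact: integral0.
by case: (i \in A) => //; exact: integral0.
Qed.

Lemma measurable_fun_shift (s : R) :
  measurable_fun [set: R] (fun t : measurableTypeR R => (t + s)%R).
Proof. by apply: measurable_funD => //; exact: measurable_cst. Qed.

Lemma lebesgue_measure_shift (s : R) (A : set R) : measurable A ->
  pushforward mu (fun t : measurableTypeR R => (t + s)%R) A = mu A.
Proof.
move=> mA; pose g (t : measurableTypeR R) : measurableTypeR R := (t + s)%R.
have ms : measurable_fun setT g := measurable_fun_shift s.
pose H := isMeasurableFun.Build _ _ _ _ g ms.
pose f : {mfun measurableTypeR R >-> measurableTypeR R} := HB.pack g H.
apply/esym/(@lebesgue_measure_unique _ (pushforward mu f)) => //= _ [[a b]] _ <-.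
rewrite /pushforward.
have -> : f @^-1` `]a, b]%classic = `]a - s, b - s]%classic%R.
  by apply/seteqP; split=> t /=; rewrite !in_itv/= ltrBlDr lerBrDr.
rewrite !lebesgue_measure_itv/= !lte_fin ltrD2r; case: ifP => // _.
by rewrite -!EFinB; congr (_%:E); ring.
Qed.

Lemma lebesgue_integral_shift (s : R) (D : set R) (g : R -> \bar R) :
  measurable D -> measurable_fun setT g -> (forall t, 0 <= g t) ->
  \int[mu]_(t in [set t | D (t + s)%R]) g (t + s)%R = \int[mu]_(t in D) g t.
Proof.
move=> mD mg g0; rewrite -[LHS]/(\int[mu]_(t in (fun t => t + s)%R @^-1` D)
  (g \o (fun t => t + s)%R) t).
have mg' : measurable_fun D g by exact: measurable_funS mg.
rewrite -(@ge0_integral_pushforward _ _ (measurableTypeR R) (measurableTypeR R)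
  R _ (measurable_fun_shift s) mu D g mD mg'); last by move=> y _; exact: g0.
apply: eq_measure_integral; first exact: measurable_fun_shift.
by move=> ? A mA _; exact: lebesgue_measure_shift.
Qed.

Lemma esum_unit_interval (y : \bar R) (s t : R) : 0 <= y ->
  \esum_(k in [set: int]) (y * (\1_(`[s, (s + 1)%R[%classic) (t + k%:~R)%R)%:E) = y.
Proof.
move=> y0; pose k0 : int := (- Num.floor (t - s))%R.
have k0P (k : int) : ((t + k%:~R)%R \in `[s, (s + 1)%R[%classic) = (k == k0).
  apply/idP/eqP => [/set_mem|->]; last first.
    apply/mem_set; rewrite /= in_itv/=.
    have := floor_le (t - s)%R; have := floorD1_gt (t - s)%R.
    rewrite /k0 mulrNz intrD => h1 h2; apply/andP; split; lra.
  rewrite /= in_itv/= => /andP[h1 h2].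
  suff : Num.floor (t - s)%R = (- k)%R by rewrite /k0 => ->; rewrite opprK.
  by apply/floor_def; rewrite intrD mulrNz; apply/andP; split; lra.
rewrite (_ : (fun k : int => _) = (fun k : int => if k \in [set k0] then y else 0)).
  by rewrite -esum_mkcond esum_set1.
apply/funext => k; rewrite indicE k0P; case: eqP => [->|kk0].
  by rewrite mule1 mem_set.
by rewrite mule0 memNset.
Qed.

Lemma measurable_indic_shift (s r : R) :
  measurable_fun setT (fun t : R => (\1_(`[s, (s + 1)%R[%classic) (t + r)%R)%:E : \bar R).
Proof.
apply/measurable_EFinP.
rewrite (_ : (fun t : R => _) = \1_(`[s - r, s - r + 1[%classic))%R.
  by apply: measurable_indic; exact: measurable_itv.
apply/funext => t; rewrite !indicE; congr (_ %:R)%R; congr nat_of_bool.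
by apply/idP/idP => /set_mem; rewrite /= in_itv/= => /andP[h1 h2];
  apply/mem_set; rewrite /= in_itv/=; apply/andP; split; lra.
Qed.

(** Cutting the line into translates of a unit interval. *)
Lemma lebesgue_integral_unfold (g : R -> \bar R) (s : R) :
  measurable_fun setT g -> (forall t, 0 <= g t) ->
  \int[mu]_t g t =
  \esum_(k in [set: int]) \int[mu]_(t in `[s, (s + 1)%R[) g (t + k%:~R)%R.
Proof.
move=> mg g0.
have mi := measurable_itv `[s, (s + 1)%R[.
pose F (k : int) t := g t * (\1_(`[s, (s + 1)%R[%classic) (t + k%:~R)%R)%:E.
have mF k : measurable_fun setT (F k).
  by apply: emeasurable_funM => //; exact: measurable_indic_shift.
have F0 k t : 0 <= F k t by rewrite mule_ge0.
transitivity (\int[mu]_t \esum_(k in [set: int]) F k t).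
  by apply: eq_integral => t _; rewrite esum_unit_interval.
rewrite integral_esum// (reindex_esum [set: int] _ (-%R)); last first.
  split=> [k //|x y _ _|k _]; first exact: oppr_inj.
  by exists (- k)%R; rewrite ?opprK.
apply: eq_esum => k _.
have -> : \int[mu]_t F (- k)%R t = \int[mu]_(t in [set: R]) F (- k)%R (t + k%:~R)%R.
  by rewrite -[LHS](lebesgue_integral_shift k%:~R).
rewrite [RHS]integral_mkcond; apply: eq_integral => t _.
rewrite /F mulrNz addrK indicE patchE.
by case: ifP => _; rewrite ?mule1 ?mule0.
Qed.

Lemma lebesgue_integral_periodic (g : R -> \bar R) (s : R) :
  measurable_fun setT g -> (forall t, 0 <= g t) ->
  (forall t (k : int), g (t + k%:~R)%R = g t) ->
  \int[mu]_(t in `[0%R, 1%R[) g (t + s)%R = \int[mu]_(t in `[0%R, 1%R[) g t.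
Proof.
move=> mg g0 gk.
have m1 : measurable (`[0%R, 1%R[%classic : set R) by exact: measurable_itv.
have ms : measurable (`[s, (s + 1)%R[%classic : set R) by exact: measurable_itv.
have -> : \int[mu]_(t in `[0%R, 1%R[) g (t + s)%R = \int[mu]_(t in `[s, (s + 1)%R[) g t.
  rewrite -[RHS](lebesgue_integral_shift s)//; congr integral.
  by apply/seteqP; split=> t /=; rewrite !in_itv/= => /andP[h1 h2];
     apply/andP; split; lra.
pose h t := g t * (\1_(`[0%R, (0 + 1)%R[%classic) t)%:E.
have mh : measurable_fun setT h.
  apply: emeasurable_funM => //; have := measurable_indic_shift 0 0.
  by apply: eq_measurable_fun => t _; rewrite addr0.
have -> : \int[mu]_(t in `[0%R, 1%R[) g t = \int[mu]_t h t.
  rewrite [LHS]integral_mkcond; apply: eq_integral => t _.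
  by rewrite /h indicE patchE add0r; case: ifP => _; rewrite ?mule1 ?mule0.
rewrite (lebesgue_integral_unfold s mh); last by move=> t; rewrite mule_ge0.
rewrite -integral_esum//.
- apply: eq_integral => t _; rewrite -[LHS](esum_unit_interval 0 t)//.
  by apply: eq_esum => k _; rewrite /h gk.
- move=> k; apply: measurable_funTS; apply: (measurableT_comp mh).
  exact: measurable_fun_shift.
- by move=> k t; rewrite mule_ge0.
Qed.

End IntegralTools.

(** * Invariant probabilities on groups generated by circles *)

Section Torus.
Local Open Scope ereal_scope.
Variables (R : realType) (T : topologicalZmodType).
Local Notation mu := (@lebesgue_measure R).
Local Notation bT := (borel T).
Local Notation mR := (measurableTypeR R).
Implicit Types (c : R -> T) (m : probability bT R).

Lemma open_borel (U : set T) : open U -> measurable (U : set bT).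
Proof. by move=> oU; apply: sub_sigma_algebra. Qed.

(** Only the first factor needs a countable base: around each of its points, an
    open set contains a product of a basic interval by the interior of the set
    of all second coordinates that are allowed over that interval. *)
Lemma open_prod_measurable (W : set (R * T)) :
  open W -> measurable (W : set (mR * bT)).
Proof.
move=> oW.
pose B (p : rat * nat) : set R := ball (ratr p.1 : R) (p.2.+1%:R^-1)%R.
pose V (p : rat * nat) : set T := interior [set x | forall t, B p t -> W (t, x)].
have -> : (W : set (mR * bT)) = \bigcup_p (B p `*` V p : set (mR * bT)).
  apply/seteqP; split=> [[t x] Wtx|[t x] [p _ [/= Bt Vx]]]; last first.
    by have := interior_subset Vx; apply.
  have : nbhs (t, x) W by exact: open_nbhs_nbhs.
  move=> [[A C] /= [/nbhs_ballP[e /= e0 eA] nC] ACW].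
  have [k [d [dE d0 de]]] : exists k (d : R), [/\ d = k.+1%:R^-1, 0 < d & d < e / 2]%R.
    have e20 : (0 < e / 2)%R by rewrite divr_gt0.
    have [k _ /(_ k (leqnn _))] := near_infty_natSinv_lt (PosNum e20).
    by move=> /= ?; exists k, (k.+1%:R^-1)%R; split=> //; rewrite invr_gt0 ltr0n.
  have lt_d : (t - d < t + d)%R by lra.
  have [q] := rat_in_itvoo lt_d.
  rewrite in_itv/= => /andP[q1 q2].
  exists (q, k) => //; split => /=.
    by rewrite /B /ball/= -dE ltr_norml; apply/andP; split; lra.
  apply: filterS nC => y Cy r; rewrite /B /ball/= -dE ltr_norml => /andP[r1 r2].
  apply: (ACW (r, y)); split => //=; apply: eA.
  by rewrite /ball/= ltr_norml; apply/andP; split; lra.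
apply: countable_bigcupT_measurable; first exact: countableP.
move=> p; apply: measurableX.
  by apply: open_measurable; apply: ball_open; rewrite invr_gt0.
by apply: open_borel; exact: open_interior.
Qed.

Lemma continuous_borel (h : T -> R) : continuous h ->
  measurable_fun setT (h : bT -> R).
Proof.
move=> /continuousP ch; apply: (measurability _ (RGenOpens.measurableE R)).
move=> _ [_ [a [b ->] <-]]; rewrite setTI; apply: open_borel; apply: ch.
exact: interval_open.
Qed.

Lemma continuous_borel_prod (h : R * T -> T) : continuous h ->
  measurable_fun setT (h : mR * bT -> bT).
Proof.
move=> /continuousP ch; apply: (@measurability _ _ (mR * bT)%type bT _ _ (@open T)) => //.
by move=> _ [U oU <-]; rewrite setTI; apply: open_prod_measurable; exact: ch.
Qed.

Lemma continuous_borel2 (h : T -> T) : continuous h ->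
  measurable_fun setT (h : bT -> bT).
Proof.
move=> /continuousP ch; apply: (@measurability _ _ bT bT _ _ (@open T)) => //.
by move=> _ [U oU <-]; rewrite setTI; apply: open_borel; exact: ch.
Qed.

Lemma translate_continuous (z : T) : continuous (fun x => z + x)%R.
Proof.
move=> x; apply: (@continuous_comp _ _ _ (fun x => (z, x)) (fun p => p.1 + p.2)%R).
  by apply: cvg_pair => /=; [exact: cvg_cst|exact: cvg_id].
exact: add_continuous.
Qed.

Lemma measurable_translate (z : T) :
  measurable_fun setT ((fun x : T => z + x)%R : bT -> bT).
Proof. by apply: continuous_borel2; exact: translate_continuous. Qed.

Lemma translateE (z : T) (A : set T) :
  [set (z + y)%R | y in A] = (fun x => - z + x)%R @^-1` A.
Proof.
apply/seteqP; split=> [_ [y Ay <-]|x Ax] /=; first by rewrite addKr.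
by exists (- z + x)%R => //; rewrite addNKr.
Qed.

Definition invariant m (z : T) : Prop := forall A : set bT, measurable A ->
  m [set (z + y : T)%R | y in A] = m A.

Lemma invariant_integral m z (f : bT -> \bar R) : invariant m z ->
  measurable_fun setT f -> (forall x, 0 <= f x) ->
  \int[m]_x f (- z + x)%R = \int[m]_x f x.
Proof.
move=> mz mf f0; have mt := measurable_translate (- z)%R.
rewrite -[LHS]/(\int[m]_(x in (fun x : T => - z + x)%R @^-1` setT)
   (f \o (fun x : T => - z + x)%R) x).
rewrite -(@ge0_integral_pushforward _ _ _ _ _ _ mt m setT f) //.
by apply: eq_measure_integral => A mA _; rewrite -[RHS](mz A mA) translateE.
Qed.

(** A homomorphism from the circle, seen as a map of period one on the line, so
    that averaging over it is integrating over the unit interval. *)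
Definition is_circle c : Prop :=
  [/\ continuous c, {morph c : s t / (s + t)%R >-> (s + t)%R} & c 1%R = 0%R].

Lemma circle0 c : is_circle c -> c 0%R = 0%R.
Proof. by move=> [_ cD _]; apply: (@addrI _ (c 0%R)); rewrite -cD !addr0. Qed.

Lemma circleN c s : is_circle c -> c (- s)%R = (- c s)%R.
Proof.
move=> ci; have [_ cD _] := ci.
by apply/eqP; rewrite -addr_eq0 -cD addNr circle0.
Qed.

Lemma circle_int c (k : int) : is_circle c -> c k%:~R%R = 0%R.
Proof.
move=> ci; have [_ cD c1] := ci.
have H (j : nat) : c j%:R%R = 0%R.
  by elim: j => [|j IH]; rewrite ?circle0// -[j.+1]addn1 natrD cD IH c1 addr0.
by case: k => j; rewrite ?NegzE ?mulrNz ?circleN -?pmulrn ?H ?oppr0.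
Qed.

Lemma circle_act_measurable c : is_circle c ->
  measurable_fun setT ((fun p : R * T => c p.1 + p.2)%R : mR * bT -> bT).
Proof.
move=> [cc _ _]; apply: continuous_borel_prod => p.
apply: (@continuous_comp _ _ _ (fun p : R * T => (c p.1, p.2)) (fun p => p.1 + p.2)%R).
  apply: cvg_pair => /=; last exact: cvg_snd.
  by apply: continuous_comp; [exact: cvg_fst|exact: cc].
exact: add_continuous.
Qed.

Definition circle_mean c (f : T -> \bar R) (x : T) : \bar R :=
  \int[mu]_(t in `[0%R, 1%R[) f (c t + x)%R.

Lemma circle_orbit_measurable c (f : bT -> \bar R) x : is_circle c ->
  measurable_fun setT f -> measurable_fun setT (fun t : R => f (c t + x)%R).
Proof.
move=> ci mf.
have mact := circle_act_measurable ci.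
have := measurableT_comp (measurableT_comp mf mact) (@measurable_pair2 _ _ mR bT x).
exact.
Qed.

Lemma circle_mean_ge0 c f x : (forall x, 0 <= f x) -> 0 <= circle_mean c f x.
Proof. by move=> f0; apply: integral_ge0. Qed.

Lemma circle_mean_shift c (f : bT -> \bar R) x s : is_circle c ->
  measurable_fun setT f -> (forall x, 0 <= f x) ->
  circle_mean c f (c s + x)%R = circle_mean c f x.
Proof.
move=> ci mf f0; have [_ cD _] := ci.
rewrite /circle_mean -[RHS](lebesgue_integral_periodic s (g := fun t => f (c t + x)%R))//.
- by apply: eq_integral => t _; rewrite cD addrA.
- exact: circle_orbit_measurable.
- by move=> t k; rewrite cD circle_int// addr0.
Qed.

Let U : probability (measurableTypeR R) R := uniform_prob (@ltr01 R).

Lemma integral_uniform01 (g : R -> \bar R) : measurable_fun setT g ->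
  (forall t, 0 <= g t) -> \int[U]_t g t = \int[mu]_(t in `[0%R, 1%R[) g t.
Proof.
move=> mg g0; rewrite integral_uniform// subr0 invr1 mul1e.
by rewrite [RHS]integral_itv_bndo_bndc//; exact: measurable_funTS.
Qed.

Lemma measurable_circle_mean c (f : bT -> \bar R) : is_circle c ->
  measurable_fun setT f -> (forall x, 0 <= f x) ->
  measurable_fun setT (circle_mean c f : bT -> \bar R).
Proof.
move=> ci mf f0; have mact := circle_act_measurable ci.
have := measurable_fun_fubini_tonelli_G (m1 := U) _ (measurableT_comp mf mact).
move=> /(_ (fun _ => f0 _)); apply: eq_measurable_fun => x _.
rewrite /fubini_G /circle_mean /= integral_uniform01//.
exact: circle_orbit_measurable.
Qed.

(** A mean along a circle does not change the integral for a measure that is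
    invariant under this circle. *)
Lemma integral_circle_mean m c (f : bT -> \bar R) : is_circle c ->
  (forall t, invariant m (c t)) ->
  measurable_fun setT f -> (forall x, 0 <= f x) ->
  \int[m]_x circle_mean c f x = \int[m]_x f x.
Proof.
move=> ci minv mf f0; have mact := circle_act_measurable ci.
transitivity (\int[m]_x \int[U]_t f (c t + x)%R).
  apply: eq_integral => x _; rewrite integral_uniform01//.
  exact: circle_orbit_measurable.
rewrite -(fubini_tonelli (m1 := U) (m2 := m) (fun p => f (c p.1 + p.2)%R))//=; last first.
  exact: (measurableT_comp mf mact).
rewrite (eq_integral (cst (\int[m]_x f x))) => [|t _]; last first.
  by rewrite -[t in LHS]opprK circleN// invariant_integral.
by rewrite integral_cst//= probability_setT mule1.
Qed.

(** The law of [c t + x], for [t] uniform in the unit interval and [x] drawn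
    independently from [m]. *)
Lemma circle_law c m : is_circle c -> exists m' : probability bT R,
  forall f : bT -> \bar R, measurable_fun setT f -> (forall x, 0 <= f x) ->
    \int[m']_x f x = \int[m]_x circle_mean c f x.
Proof.
move=> ci; have mact := circle_act_measurable ci.
pose M : {measure set bT -> \bar R} :=
  measure_function_pushforward__canonical__measure_function_Measure (U \x m)%E mact.
have MT : M setT = 1.
  transitivity (U setT * m setT); last by rewrite !probability_setT mule1.
  by rewrite -product_measure1E// setXTT.
pose m' : probability bT R :=
  HB.pack (M : set bT -> \bar R) (Measure.class M) (Measure_isProbability.Build _ _ _ M MT).
exists m' => f mf f0.
rewrite -[LHS]/(\int[M]_x f x) /M.
rewrite (ge0_integral_pushforward mact)//= preimage_setT.
have mfact := measurableT_comp mf mact.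
have fact0 z : 0 <= (f \o (fun p : R * T => c p.1 + p.2)%R) z by exact: f0.
rewrite (fubini_tonelli1 (m1 := U) (m2 := m) _ mfact fact0).
rewrite (fubini_tonelli (m1 := U) (m2 := m) _ mfact fact0).
apply: eq_integral => x _ /=; rewrite integral_uniform01//.
exact: circle_orbit_measurable.
Qed.

Fixpoint circles_gen (cs : seq (R -> T)) : set T :=
  if cs is c :: cs' then [set z | exists s y, circles_gen cs' y /\ z = (c s + y)%R]
  else [set 0%R].

(** Averaging a measure along one circle makes it invariant under that circle,
    and keeps the translations that already left it invariant. *)
Lemma invariant_probability_exists (cs : seq (R -> T)) :
  (forall c, List.In c cs -> is_circle c) ->
  exists m : probability bT R, forall z, circles_gen cs z -> invariant m z.
Proof.
elim: cs => [|c cs IH] cP.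
  exists (dirac (0%R : bT)) => _ -> A mA; congr dirac.
  apply/seteqP; split=> [_ [y Ay <-]|y Ay]; first by rewrite add0r.
  by exists y; rewrite ?add0r.
have [|m minv] := IH; first by move=> d dcs; apply: cP; right.
have ci : is_circle c by apply: cP; left.
have [m' m'E] := circle_law m ci.
exists m' => _ [s [y [gy ->]]] A mA.
have indicE' (B : set bT) : measurable B -> m' B = \int[m']_x (\1_B x)%:E.
  by move=> mB; rewrite integral_indic// setIT.
have mtA : measurable ([set (c s + y + y0)%R | y0 in A] : set bT).
  by rewrite translateE -[X in measurable X]setTI; exact: measurable_translate.
have mindic (B : set bT) : measurable B ->
    measurable_fun setT (fun x => (\1_B x)%:E : \bar R).
  by move=> mB; apply/measurable_EFinP; exact: measurable_indic.
have ind0 (B : set bT) (x : bT) : 0 <= (\1_B x)%:E :> \bar R by rewrite lee_fin.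
rewrite (indicE' _ mtA) (indicE' _ mA).
rewrite (m'E _ (mindic _ mtA) (ind0 _)) (m'E _ (mindic _ mA) (ind0 _)).
pose g := circle_mean c (fun x : T => (\1_A x)%:E).
have g0 x : 0 <= g x by apply: circle_mean_ge0 => z; rewrite lee_fin.
have mg : measurable_fun setT (g : bT -> \bar R).
  by apply: measurable_circle_mean => //; exact: mindic.
rewrite -[RHS](invariant_integral (minv _ gy) mg g0).
congr integral; apply/funext => x.
rewrite -[RHS](@circle_mean_shift c _ _ (- s)%R ci (mindic _ mA) (ind0 A)).
rewrite /circle_mean; congr integral; apply/funext => t; rewrite translateE !indicE.
have -> : (c t + (c (- s)%R + (- y + x)) = - (c s + y) + (c t + x))%R.
  by rewrite circleN// opprD [RHS]addrCA -[(- c s - y + x)%R]addrA.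
by [].
Qed.

End Torus.

(** * Positivity on open sets and uniqueness of densities *)

Section HaarDensity.
Local Open Scope ereal_scope.
Variables (R : realType) (T : topologicalZmodType).
Local Notation bT := (borel T).
Implicit Types (c : R -> T) (m : probability bT R).

Lemma open_translate (z : T) (U : set T) : open U -> open [set (z + y)%R | y in U].
Proof.
move=> oU; rewrite translateE.
by move/continuousP: (@translate_continuous T (- z)%R); apply.
Qed.

Lemma circles_gen_sum (I : eqType) (s : seq I) (c : I -> R -> T) (a : I -> R) :
  circles_gen [seq c i | i <- s] (\sum_(i <- s) c i (a i))%R.
Proof.
elim: s => [|i s IH] /=; first by rewrite big_nil.
by exists (a i), (\sum_(j <- s) c j (a j))%R; rewrite big_cons.
Qed.

(** Rational parameters suffice to translate [V] over the whole circle because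
    [V] is open, and a countable union of null sets is null. *)
Lemma null_open_saturate m c (V : set T) : is_circle c ->
  (forall t, invariant m (c t)) -> open V -> m V = 0 ->
  exists W : set T, [/\ open W, m W = 0 & forall t x, V x -> W (c t + x)%R].
Proof.
move=> ci minv oV mV; have [cc cD _] := ci.
pose W : set T := \bigcup_(q : rat) [set (c (ratr q) + y)%R | y in V].
have oq (q : rat) : open [set (c (ratr q) + y)%R | y in V] by exact: open_translate.
exists W; split.
- by apply: bigcup_open => q _.
- apply/eqP; rewrite eq_le measure_ge0 andbT.
  pose G (k : nat) : set bT :=
    if @pickle_inv rat k is Some q then [set (c (ratr q) + y)%R | y in V] else set0.
  have mG k : measurable (G k).
    by rewrite /G; case: pickle_inv => [q|//]; exact: open_borel.
  have WG : W `<=` \bigcup_k G k.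
    move=> x [q _ qx]; exists (choice.pickle q); first exact: I.
    by rewrite /G pickleK_inv.
  have mW : measurable (W : set bT).
    by apply: open_borel; apply: bigcup_open => q _.
  have G0 k : m (G k) = 0.
    rewrite /G; case: pickle_inv => [q|]; last exact: measure0.
    by rewrite minv//; exact: open_borel.
  have := measure_sigma_subadditive m mG mW WG.
  by rewrite eseries0// => k _ _; exact: G0.
- move=> t x Vx.
  have ct : continuous (fun r : R => (c (t - r) + x)%R).
    move=> r; apply: (@continuous_comp _ _ _ (fun r => (c (t - r)%R, x)) (fun p => p.1 + p.2)%R).
      apply: cvg_pair => /=; last exact: cvg_cst.
      apply: (@continuous_comp _ _ _ (fun r : R => (t - r)%R) c); last exact: cc.
      by apply: cvgB; [exact: cvg_cst|exact: cvg_id].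
    exact: add_continuous.
  have /ct : nbhs (c (t - t) + x)%R V.
    by rewrite subrr circle0// add0r; exact: open_nbhs_nbhs.
  move=> /nbhs_ballP[e /= e0 eV].
  have lt_e : (t - e < t + e)%R by lra.
  have [q] := rat_in_itvoo lt_e; rewrite in_itv/= => /andP[q1 q2].
  exists q => //; exists (c (t - ratr q) + x)%R.
    by apply: eV; rewrite /ball/= ltr_norml; apply/andP; split; lra.
  by rewrite addrA -cD subrKC.
Qed.

(** A nonempty open set is not null: its translates by rational parameters
    along circles that generate the group cover the group. *)
Lemma invariant_open_gt0 m (cs : seq (R -> T)) (V : set T) :
  (forall c, List.In c cs -> is_circle c) -> (forall z, circles_gen cs z) ->
  (forall z, invariant m z) -> open V -> V !=set0 -> 0 < m V.
Proof.
move=> cP gen minv oV [v0 Vv0].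
rewrite lt_neqAle measure_ge0 andbT eq_sym; apply/eqP => mV.
have [W [oW mW genW]] : exists W : set T,
    [/\ open W, m W = 0 & forall z, circles_gen cs z -> forall x, V x -> W (z + x)%R].
  elim: cs cP {gen} => [|c cs IH] cP.
    by exists V; split=> // _ -> x; rewrite add0r.
  have [|W [oW mW genW]] := IH; first by move=> d dcs; apply: cP; right.
  have ci : is_circle c by apply: cP; left.
  have [W' [oW' mW' cW']] := null_open_saturate ci (fun t => minv (c t)) oW mW.
  exists W'; split=> // _ [s [y [gy ->]]] x Vx.
  by rewrite -addrA; apply: cW'; exact: genW.
have WT : W = setT.
  apply/seteqP; split=> // x _; rewrite -[x](subrK v0).
  by apply: genW => //; exact: gen.
have := probability_setT m; rewrite -WT mW => /eqP.
by rewrite eq_sym onee_eq0.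
Qed.

Lemma integrable_on_small m (h : T -> R) (U : set T) (a d : R) : continuous h ->
  open U -> (forall x, U x -> `|h x - a| < d)%R -> m.-integrable (U : set bT) (EFin \o h).
Proof.
move=> ch oU hU; apply: measurable_bounded_integrable.
- exact: open_borel.
- by apply: le_lt_trans (probability_le1 _ _) _; [exact: open_borel|rewrite ltry].
- by apply: measurable_funTS; exact: continuous_borel.
exists (`|a| + d)%R; split; first exact: num_real.
move=> M aM x Ux /=; apply: le_trans (ltW aM).
rewrite -[h x](subrK a) (le_trans (ler_normD _ _))// addrC lerD2l.
exact/ltW/hU.
Qed.

(** If [h1] exceeded [h2] at a point it would do so by a fixed amount on an open
    neighbourhood, which has positive measure. *)
Lemma density_le m (h1 h2 : T -> R) :
  (forall U : set T, open U -> U !=set0 -> 0 < m U) ->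
  continuous h1 -> continuous h2 ->
  (forall A : set bT, measurable A ->
     \int[m]_(x in A) (h1 x)%:E = \int[m]_(x in A) (h2 x)%:E) ->
  forall x, (h1 x <= h2 x)%R.
Proof.
move=> mpos c1 c2 h12 x0; rewrite leNgt; apply/negP => h21.
(* A third of the gap: each function may vary by one third around [x0]. *)
pose d : R := ((h1 x0 - h2 x0) / 3)%R.
have d0 : (0 < d)%R by rewrite divr_gt0// subr_gt0.
pose U1 := h1 @^-1` ball (h1 x0) d; pose U2 := h2 @^-1` ball (h2 x0) d.
pose U : set T := U1 `&` U2.
have oball (r : R) : open (ball r d) by exact: ball_open.
have oU : open U.
  by apply: openI; [move/continuousP: c1|move/continuousP: c2]; apply.
have Ux0 : U x0 by split; exact: ballxx.
have mU : 0 < m U by apply: mpos => //; exists x0.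
have mUf : m U \is a fin_num by apply: fin_num_measure; exact: open_borel.
have mUm : measurable (U : set bT) by exact: open_borel.
have H1 x : U x -> (`|h1 x - h1 x0| < d)%R.
  by move=> [+ _]; rewrite /U1/= /ball/= distrC.
have H2 x : U x -> (`|h2 x - h2 x0| < d)%R.
  by move=> [_ +]; rewrite /U2/= /ball/= distrC.
have i1 := integrable_on_small m c1 oU H1; have i2 := integrable_on_small m c2 oU H2.
have gap x : U x -> (d <= h1 x - h2 x)%R.
  move=> Ux; have := H1 x Ux; have := H2 x Ux; rewrite !ltr_norml /d.
  by move=> /andP[? ?] /andP[? ?]; lra.
have E : \int[m]_(x in U) (h1 x - h2 x)%:E = 0.
  under eq_integral do rewrite EFinB.
  by rewrite integralB// h12// subee//; exact: integrable_fin_num.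
have : \int[m]_(x in U) (cst d%:E) x <= \int[m]_(x in U) (h1 x - h2 x)%:E.
  apply: ge0_le_integral => //.
  - by move=> x _; rewrite lee_fin ltW.
  - apply/measurable_EFinP; apply: measurable_funTS.
    by apply: measurable_funB; exact: continuous_borel.
by rewrite E integral_cst// leNgt mule_gt0.
Qed.

End HaarDensity.

(** * Positive definite forms and Gaussians *)

Section Cholesky.
Variable R : realType.

Definition posdef n (A : 'M[R]_n) : Prop :=
  A^T = A /\ forall s : 'rV[R]_n, s != 0 -> 0 < (s *m A *m s^T) 0 0.

Definition unitriangular n (U : 'M[R]_n) : Prop :=
  (forall i, U i i = 1) /\ forall i j : 'I_n, (j < i)%N -> U i j = 0.

(** Completing the square, one variable after the other. *)
Lemma posdef_factor n (A : 'M[R]_n) : posdef A ->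
  exists (U : 'M[R]_n) (d : 'rV[R]_n),
    [/\ unitriangular U, forall i, 0 < d 0 i, A = U^T *m diag_mx d *m U &
        \det U = 1].
Proof.
elim: n A => [|n IH] A [Asym Apos].
  exists 1%:M, 0; split; [|by case|by apply/matrixP => -[]|by rewrite det1].
  by split=> -[].
pose M : 'M[R]_(1 + n) := A.
pose a := M 0 0; pose l : 'M[R]_(1, n) := ursubmx M; pose B : 'M[R]_n := drsubmx M.
have ulE : ulsubmx M = a%:M by rewrite [LHS]mx11_scalar !mxE lshift0.
have dlE : dlsubmx M = l^T by rewrite /l trmx_ursub /M Asym.
have Bsym : B^T = B by rewrite /B trmx_drsub /M Asym.
have ME : M = block_mx a%:M l l^T B by rewrite -[LHS]submxK ulE dlE.
have form (x : R) (s : 'rV[R]_n) : let v : 'rV_(1 + n) := row_mx x%:M s in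
    (v *m M *m v^T) 0 0 = a * x ^+ 2 + 2 * x * (s *m l^T) 0 0 + (s *m B *m s^T) 0 0.
  move=> v.
  have -> : v *m M *m v^T =
      (x * a * x)%:M + x *: (s *m l^T) + (x *: (l *m s^T) + s *m B *m s^T).
    rewrite ME mul_row_block tr_row_mx mul_row_col !mulmxDl tr_scalar_mx.
    by rewrite -!scalar_mxM !mul_mx_scalar !mul_scalar_mx -scalemxAl.
  have : (l *m s^T) 0 0 = (s *m l^T) 0 0.
    by rewrite -[l *m s^T]trmxK trmx_mul trmxK mxE.
  move: (s *m l^T) (l *m s^T) (s *m B *m s^T) => p q r lE.
  by rewrite !mxE lE eqxx mulr1n; ring.
have pos (x : R) (s : 'rV[R]_n) : row_mx x%:M s != 0 :> 'rV_(1 + n) ->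
    0 < a * x ^+ 2 + 2 * x * (s *m l^T) 0 0 + (s *m B *m s^T) 0 0.
  by move=> v0; rewrite -form; exact: Apos.
have a0 : 0 < a.
  have := pos 1 0; rewrite !mul0mx !mxE expr1n !mulr1 mulr0 !addr0; apply.
  apply/eqP => /rowP/(_ (lshift n 0)); rewrite row_mxEl !mxE eqxx.
  by move/eqP; rewrite oner_eq0.
have aN0 : a != 0 by rewrite gt_eqF.
pose B' := B - a^-1 *: (l^T *m l).
have B'pos : posdef B'.
  split; first by rewrite /B' linearB/= linearZ/= trmx_mul trmxK Bsym.
  move=> s s0; pose y := (s *m l^T) 0 0.
  have := pos (- (y / a)) s; rewrite -/y.
  have -> : (s *m B' *m s^T) 0 0 = (s *m B *m s^T) 0 0 - a^-1 * y ^+ 2.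
    rewrite /B' mulmxBr mulmxBl -scalemxAr -scalemxAl mulmxA -[s *m l^T *m l *m _]mulmxA.
    rewrite [s *m l^T]mx11_scalar -/y mul_scalar_mx.
    have -> : l *m s^T = y%:M.
      by rewrite [LHS]mx11_scalar; congr _%:M; rewrite -[l *m s^T]trmxK trmx_mul trmxK mxE.
    move: (s *m B *m s^T) => p; rewrite !mxE eqxx mulr1n; ring.
  have -> : a * (- (y / a)) ^+ 2 + 2 * - (y / a) * y + (s *m B *m s^T) 0 0 =
      (s *m B *m s^T) 0 0 - a^-1 * y ^+ 2 by field.
  apply; apply: contra_neq s0 => /(congr1 (@rsubmx _ 1 1 n)).
  by rewrite row_mxKr linear0.
have [U' [d' [[U'1 U'0] d'0 B'E detU']]] := IH _ B'pos.
pose U : 'M[R]_(1 + n) := block_mx 1%:M (a^-1 *: l) 0 U'.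
pose d : 'rV[R]_(1 + n) := row_mx a%:M d'.
have U1 (i : 'I_(1 + n)) : U i i = 1.
  by rewrite /U; case: (split_ordP i) => k ->;
    [rewrite block_mxEul mxE eqxx|rewrite block_mxEdr U'1].
have U0 (i j : 'I_(1 + n)) : (j < i)%N -> U i j = 0.
  rewrite /U; case: (split_ordP i) => k ->; case: (split_ordP j) => k' -> ij.
  + by move: ij; rewrite /= !ord1.
  + by move: ij; rewrite /= ord1.
  + by rewrite block_mxEdl mxE.
  + by rewrite block_mxEdr U'0.
have d0 (i : 'I_(1 + n)) : 0 < d 0 i.
  rewrite /d; case: (split_ordP i) => k ->; last by rewrite row_mxEr.
  by rewrite row_mxEl mxE ord1 eqxx.
have AE : M = U^T *m diag_mx d *m U.
  rewrite ME /U /d tr_block_mx diag_mx_row.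
  have -> : diag_mx (a%:M : 'rV[R]_1) = a%:M.
    by apply/matrixP => i j; rewrite !mxE !ord1 eqxx.
  rewrite !mulmx_block !trmx0 !trmx1 !mulmx0 !mul0mx !addr0 !add0r !mul1mx !mulmx1.
  have tE : (a^-1 *: l)^T = a^-1 *: l^T by apply/matrixP => i j; rewrite !mxE.
  rewrite -B'E tE !mul_scalar_mx !mul_mx_scalar mul0mx addr0 !scalerA.
  rewrite mulfV// !scale1r.
  by rewrite -scalemxAr addrC subrK.
have detU : \det U = 1 by rewrite /U det_ublock det1 mul1r.
exists U, d; split; [split; [exact: U1|exact: U0]|exact: d0| |].
- exact: AE.
- exact: detU.
Qed.

End Cholesky.

Section Gaussian.
Variable R : realType.
Local Notation mu := (@lebesgue_measure R).
Local Open Scope ereal_scope.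

(** The total mass of the normal density of variance [1 / (2 pi d)]. *)
Lemma gaussian_integral (d l : R) : (0 < d)%R ->
  \int[mu]_t (expR (- pi * (d * (l + t) ^+ 2)))%:E = ((Num.sqrt d)^-1)%:E.
Proof.
move=> d0; pose s : R := Num.sqrt ((2 * pi * d)^-1)%R.
have pi0 : (0 < pi :> R)%R := pi_gt0 R.
have piN0 : (pi != 0 :> R)%R by rewrite gt_eqF.
have dN0 : (d != 0)%R by rewrite gt_eqF.
have pd0 : (0 < (2 * pi * d)^-1)%R by rewrite invr_gt0 !mulr_gt0.
have s0 : s != 0%R by rewrite gt_eqF// sqrtr_gt0.
have s2 : (s ^+ 2 = (2 * pi * d)^-1)%R by rewrite sqr_sqrtr// ltW.
have := @integral_normal_pdf R (- l)%R s.
rewrite (normal_pdfE _ s0).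
have -> : normal_peak s = Num.sqrt d.
  rewrite /normal_peak s2.
  have -> : ((2 * pi * d)^-1 * pi *+ 2 = d^-1)%R.
    by rewrite -mulr_natr; move: (pi : R) piN0 => p pN0; field; rewrite pN0 dN0.
  by rewrite (sqrtrV (ltW d0)) invrK.
have fE t : (normal_fun (- l) s t = expR (- pi * (d * (l + t) ^+ 2)))%R.
  rewrite /normal_fun s2; congr expR; rewrite opprK [(t + l)%R]addrC -mulr_natr.
  by move: (pi : R) piN0 => p pN0; field; rewrite pN0 dN0.
under eq_integral do rewrite EFinM.
have mnf : measurable_fun setT (fun t => (normal_fun (- l)%R s t)%:E).
  by apply/measurable_EFinP; exact: measurable_normal_fun.
rewrite (ge0_integralZl mu measurableT mnf); [|by move=> t _; rewrite lee_fin expR_ge0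
  |by rewrite lee_fin sqrtr_ge0].
under eq_integral do rewrite fE.
have sd0 : (Num.sqrt d != 0)%R by rewrite gt_eqF// sqrtr_gt0.
move=> /(congr1 (fun x => (Num.sqrt d)^-1%:E * x)).
by rewrite muleA -EFinM mulVf// mul1e mule1.
Qed.

Lemma ge0_esumZl (I : countType) (A : set I) (a : I -> \bar R) (c : R) :
  (0 <= c)%R -> (forall i, 0 <= a i) ->
  \esum_(i in A) (c%:E * a i) = c%:E * \esum_(i in A) a i.
Proof.
move=> c0 a0; rewrite !esum_countType// => [|i]; last by rewrite mule_ge0.
rewrite -nneseriesZl//; last by move=> k _; case: pickle_inv => //= i; case: ifP.
apply: eq_eseriesr => k _; case: pickle_inv => [i|]/=; last by rewrite mule0.
by case: ifP; rewrite ?mule0.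
Qed.

(** Comparison with an integral: [(x + t)^2 <= 2 x^2 + 2] for [t] in the unit
    interval bounds each term of the sum by the integral of a wider Gaussian
    over a unit interval. *)
Lemma gaussian_sum_bound (d : R) : (0 < d)%R -> exists2 C : R, (0 <= C)%R &
  forall l : R, \esum_(k in [set: int]) (expR (- pi * (d * (l + k%:~R) ^+ 2)))%:E <= C%:E.
Proof.
move=> d0; pose C : R := (expR (pi * d) * (Num.sqrt (d / 2))^-1)%R.
exists C; first by rewrite mulr_ge0 ?expR_ge0// invr_ge0 sqrtr_ge0.
have d20 : (0 < d / 2)%R by rewrite divr_gt0.
move=> l; pose g (t : R) : \bar R := (expR (- pi * (d / 2 * (l + t) ^+ 2)))%:E.
have mg : measurable_fun setT g.
  apply/measurable_EFinP.
  have mh : measurable_fun setT (fun t : R => - pi * (d / 2 * (l + t) ^+ 2))%R.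
    apply: measurable_funM; first exact: measurable_cst.
    apply: measurable_funM; first exact: measurable_cst.
    by apply: measurable_funX; apply: measurable_funD => //; exact: measurable_cst.
  exact: (measurableT_comp (@measurable_expR R) mh).
have -> : C%:E = (expR (pi * d))%:E * \int[mu]_t g t.
  by rewrite gaussian_integral// -EFinM.
have g0 t : 0 <= g t by rewrite lee_fin expR_ge0.
rewrite (lebesgue_integral_unfold 0%R)// -ge0_esumZl ?expR_ge0//; last first.
  by move=> k; apply: integral_ge0.
apply: le_esum => k _; rewrite add0r.
have m01 : measurable (`[0%R, 1%R[%classic : set R) by exact: measurable_itv.
have mgk : measurable_fun setT (fun t : R => g (t + k%:~R)%R).
  exact: (measurableT_comp mg (measurable_fun_shift k%:~R)).
rewrite -(ge0_integralZl mu m01 (measurable_funTS mgk)); [|by []|by rewrite lee_fin expR_ge0].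
have -> : (expR (- pi * (d * (l + k%:~R) ^+ 2)))%:E =
    \int[mu]_(t in `[0%R, 1%R[) (cst (expR (- pi * (d * (l + k%:~R) ^+ 2)))%:E) t.
  by rewrite integral_cst//= lebesgue_measure_itv/= lte_fin ltr01 sube0 mule1.
apply: ge0_le_integral => //.
- by move=> t _; rewrite lee_fin expR_ge0.
- apply: measurable_funTS; apply: emeasurable_funM; first exact: measurable_cst.
  exact: mgk.
- move=> t; rewrite /= in_itv/= => /andP[t0 t1].
  rewrite /g -EFinM lee_fin -expRD ler_expR.
  have pd0 : (0 < pi * d)%R by rewrite mulr_gt0// pi_gt0.
  rewrite -subr_ge0; set x := (l + k%:~R)%R.
  have -> : (pi * d + - pi * (d / 2 * (l + (t + k%:~R)) ^+ 2) - - pi * (d * x ^+ 2) =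
    pi * d / 2 * ((x - t) ^+ 2 + 2 * (1 - t ^+ 2)))%R by rewrite /x; field.
  rewrite mulr_ge0 ?divr_ge0 ?(ltW pd0)// addr_ge0 ?sqr_ge0// mulr_ge0//.
  by rewrite subr_ge0 expr_le1// ltW.
Qed.

End Gaussian.

(** * Theta series, one coordinate at a time *)

Section LatticeSums.
Variables (R : realType) (n : nat) (U : 'M[R]_n) (d : 'rV[R]_n).
Hypothesis U_tri : unitriangular U.
Hypothesis d_gt0 : forall i, 0 < d 0 i.
Local Notation mu := (@lebesgue_measure R).
Implicit Types (s : 'rV[R]_n) (k : 'rV[int]_n) (i j : 'I_n).

Definition tri_coord i s : R := \sum_j U i j * s 0 j.

(** The part of the diagonalised quadratic form that does not involve the first
    [j] coordinates. *)
Definition tail_form (j : nat) s : R :=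
  \sum_(i < n | (j <= i)%N) d 0 i * tri_coord i s ^+ 2.

Definition tail_lattice (j : nat) : set 'rV[int]_n :=
  [set k | forall i, (i < j)%N -> k 0 i = 0].

(** What is left of the theta series after the first [j] coordinates have been
    integrated out: the sum runs over the remaining coordinates only. *)
Definition tail_theta (j : nat) s : \bar R :=
  (\esum_(k in tail_lattice j)
    (expR (- pi * tail_form j (s + map_mx intr k)))%:E)%E.

Lemma tri_coordD i s s' : tri_coord i (s + s') = tri_coord i s + tri_coord i s'.
Proof. by rewrite -big_split; apply: eq_bigr => j _; rewrite mxE mulrDr. Qed.

Lemma tri_coordZ i j (t : R) : tri_coord i (t *: delta_mx 0 j) = t * U i j.
Proof.
rewrite /tri_coord (bigD1 j)//= !mxE !eqxx mulr1 mulrC big1 ?addr0// => l lj.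
by rewrite !mxE (negbTE lj) andbF !mulr0.
Qed.

Lemma tail_form_split j s :
  tail_form j s = d 0 j * tri_coord j s ^+ 2 + tail_form j.+1 s.
Proof.
rewrite /tail_form (bigD1 j)//=; congr (_ + _); apply: eq_bigl => i.
by rewrite ltn_neqAle andbC eq_sym.
Qed.

Lemma tail_form_shift j s (t : R) : tail_form j.+1 (s + t *: delta_mx 0 j) = tail_form j.+1 s.
Proof.
have [_ U0] := U_tri; apply: eq_bigr => i ij.
by rewrite tri_coordD tri_coordZ U0// mulr0 addr0.
Qed.

Lemma tail_form_end s : tail_form n s = 0.
Proof. by rewrite /tail_form big1// => i; rewrite leqNgt ltn_ord. Qed.

Definition theta_term j s (k : 'rV[int]_n) (m : int) : \bar R :=
  ((expR (- pi * tail_form j.+1 (s + map_mx intr k)))%:E *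
   (expR (- pi * (d 0 j * (tri_coord j (s + map_mx intr k) + m%:~R) ^+ 2)))%:E)%E.

Lemma theta_term_ge0 j s k m : (0 <= theta_term j s k m)%E.
Proof. by rewrite /theta_term -EFinM lee_fin mulr_ge0 ?expR_ge0. Qed.

(** Since the form is triangular, the first remaining coordinate [j] occurs only
    in one square, where it enters as a translation by an integer. *)
Lemma tail_theta_pairs j s : (tail_theta j s =
  \esum_(p in tail_lattice j.+1 `*`` (fun=> setT)) theta_term j s p.1 p.2)%E.
Proof.
have [U1 U0] := U_tri.
pose e (p : 'rV[int]_n * int) : 'rV[int]_n := p.1 + p.2 *: delta_mx 0 j.
rewrite /tail_theta (reindex_esum (tail_lattice j.+1 `*`` (fun=> setT)) _ e).
  apply: eq_esum => -[k m] _; rewrite /theta_term/= -EFinM -expRD; congr (expR _)%:E.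
  have -> : s + map_mx intr (e (k, m)) = s + map_mx intr k + m%:~R *: delta_mx 0 j :> 'rV[R]_n.
    rewrite -addrA; congr (_ + _); apply/rowP => i.
    by rewrite !mxE rmorphD rmorphM/= rmorph_nat.
  by rewrite tail_form_split tail_form_shift tri_coordD tri_coordZ U1 mulr1; ring.
have eE p i : e p 0 i = p.1 0 i + p.2 *+ (i == j).
  by rewrite !mxE eqxx/= mulr_natr.
split.
- move=> p [/= kp _] i ij; rewrite eE kp ?(ltnW ij)//; last by rewrite ltnS ltnW.
  by rewrite -val_eqE/= (ltn_eqF ij).
- move=> p q; rewrite !inE => -[/= kp _] [/= kq _] epq.
  have pq2 : p.2 = q.2.
    by move/rowP/(_ j): epq; rewrite !eE eqxx kp// kq// !add0r.
  rewrite [p]surjective_pairing [q]surjective_pairing pq2; congr (_, _).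
  apply/rowP => i; move/rowP/(_ i): epq; rewrite !eE pq2; exact: addIr.
- move=> k kj; exists (k - k 0 j *: delta_mx 0 j, k 0 j); last first.
    by rewrite /e/= subrK.
  split=> //= i; rewrite ltnS leq_eqVlt => /orP[/eqP/val_inj ->|ij].
    by rewrite !mxE !eqxx mulr1 subrr.
  have ne : (i == j) = false by rewrite -val_eqE/= (ltn_eqF ij).
  by rewrite !mxE (kj _ ij) ne andbF mulr0 subrr.
Qed.

Lemma tail_lattice_end : tail_lattice n = [set 0].
Proof.
apply/seteqP; split=> [k k0|_ -> i _]; last by rewrite mxE.
by apply/rowP => i; rewrite k0// mxE.
Qed.

Lemma tail_theta_end s : (tail_theta n s = 1)%E.
Proof.
rewrite /tail_theta tail_lattice_end esum_set1 ?lee_fin ?expR_ge0//.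
by rewrite tail_form_end mulr0 expR0.
Qed.

(** A bound that is uniform in the translation [s], from the last coordinate
    upwards, because the bound of [gaussian_sum_bound] is uniform. *)
Lemma tail_theta_bound (j : nat) : (j <= n)%N ->
  exists2 C : R, 0 <= C & forall s, (tail_theta j s <= C%:E)%E.
Proof.
(* Downward induction on [j], as an induction on [m = n - j]. *)
move=> jn; rewrite -(subKn jn); elim: (n - j)%N (leq_subr j n) => [|m IH] mn.
  by exists 1 => // s; rewrite subn0 tail_theta_end.
have [C C0 CP] := IH (ltnW mn).
have ltm : (n - m.+1 < n)%N by rewrite ltn_subrL (leq_trans _ mn).
pose i : 'I_n := Ordinal ltm; have iE : (n - m = i.+1)%N by rewrite /= subnSK.
have [B B0 BP] := gaussian_sum_bound (d_gt0 i).
exists (B * C); first exact: mulr_ge0.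
move=> s.
rewrite -[(n - m.+1)%N]/(i : nat) tail_theta_pairs -esum_esum; last first.
  by move=> k z _ _; exact: theta_term_ge0.
apply: (@le_trans _ _ (\esum_(k in tail_lattice i.+1)
   (B%:E * (expR (- pi * tail_form i.+1 (s + map_mx intr k)))%:E))%E).
  apply: le_esum => k _; rewrite /theta_term ge0_esumZl ?expR_ge0//.
  by rewrite muleC lee_wpmul2r ?lee_fin ?expR_ge0.
rewrite ge0_esumZl//.
by rewrite EFinM lee_wpmul2l// -iE; exact: CP.
Qed.

(** Integrating over one period in the direction of coordinate [j] unfolds the
    sum over that coordinate into a Gaussian integral over the line. *)
Lemma tail_theta_mean j s :
  (\int[mu]_(t in `[0%R, 1%R[) tail_theta j (s + t *: delta_mx 0 j)%R =
   (Num.sqrt (d 0 j))^-1%:E * tail_theta j.+1 s)%E.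
Proof.
have [U1 U0] := U_tri.
pose c k : R := expR (- pi * tail_form j.+1 (s + map_mx intr k)).
pose g k (t : R) : \bar R :=
  (expR (- pi * (d 0 j * (tri_coord j (s + map_mx intr k) + t) ^+ 2)))%:E.
have mg k : measurable_fun setT (g k).
  apply/measurable_EFinP; set l := tri_coord _ _.
  have mh : measurable_fun setT (fun t : R => - pi * (d 0 j * (l + t) ^+ 2)).
    apply: measurable_funM; first exact: measurable_cst.
    apply: measurable_funM; first exact: measurable_cst.
    by apply: measurable_funX; apply: measurable_funD => //; exact: measurable_cst.
  exact: (measurableT_comp (@measurable_expR R) mh).
have mgs k (m : int) : measurable_fun setT (fun t : R => g k (t + m%:~R)).
  exact: (measurableT_comp (mg k) (measurable_fun_shift m%:~R)).
have m01 : measurable (`[0, 1[%classic : set R) by exact: measurable_itv.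
have termE t k m : theta_term j (s + t *: delta_mx 0 j) k m =
    ((c k)%:E * g k (t + m%:~R)%R)%E.
  have E : s + t *: delta_mx 0 j + map_mx intr k =
      s + map_mx intr k + t *: delta_mx 0 j :> 'rV[R]_n by rewrite addrAC.
  rewrite /theta_term E tail_form_shift tri_coordD tri_coordZ U1 mulr1.
  by rewrite /g addrA.
under eq_integral => t _ do rewrite tail_theta_pairs.
rewrite integral_esum//; last 2 first.
- move=> p; apply: measurable_funTS.
  rewrite (_ : (fun t : R => _) = (fun t : R => (c p.1)%:E * g p.1 (t + p.2%:~R)%R)%E).
    by apply: emeasurable_funM => //; exact: mgs.
  by apply/funext => t; rewrite termE.
- by move=> p t; exact: theta_term_ge0.
rewrite -(esum_esum (a := fun k m => (\int[mu]_(t in `[0%R, 1%R[)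
   theta_term j (s + t *: delta_mx 0 j)%R k m)%E)); last first.
  by move=> k m _ _; apply: integral_ge0 => t _; exact: theta_term_ge0.
rewrite -ge0_esumZl ?invr_ge0 ?sqrtr_ge0//.
apply: eq_esum => k _.
rewrite (eq_esum (b := fun m : int => ((c k)%:E *
   \int[mu]_(t in `[0%R, (0 + 1)%R[) g k (t + m%:~R)%R)%E)) => [|m _]; last first.
  rewrite add0r; under eq_integral => t _ do rewrite termE.
  have c0 : (0 <= (c k)%:E)%E by rewrite lee_fin expR_ge0.
  have g0 (t : R) : (0 <= g k (t + m%:~R)%R)%E by rewrite lee_fin expR_ge0.
  by rewrite (ge0_integralZl mu m01 (measurable_funTS (mgs k m)) (fun t _ => g0 t) c0).
have g0 t : (0 <= g k t)%E by rewrite lee_fin expR_ge0.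
rewrite ge0_esumZl ?expR_ge0//; last first.
  by move=> m; apply: integral_ge0.
rewrite -(lebesgue_integral_unfold 0)//.
by rewrite gaussian_integral// muleC.
Qed.

End LatticeSums.

(** * The Gram matrix of an Arakelov divisor *)

Section Places.
Variables (F : fieldExtType rat) (R : realType) (S : infinite_places F R).
Local Notation n := (\dim {:F}).
Local Notation C := R[i].
Local Notation E := ('I_(nreal S) + ('I_(ncplx S) + 'I_(ncplx S)))%type.
Local Notation Re := complex.Re.
Local Notation toC := (real_complex R).
Implicit Types (e : E) (b : 'I_n -> F) (s : 'rV[R]_n) (z : tensorR S).

(** The index type lists each complex place twice, for its two conjugate
    embeddings, so that it enumerates all the embeddings into [R[i]]. *)
Definition place_embedding e : {rmorphism F -> C} :=
  match e with
  | inl k => [the {rmorphism F -> C} of toC \o real_place k]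
  | inr (inl j) => cplx_place j
  | inr (inr j) => [the {rmorphism F -> C} of conjc \o cplx_place j]
  end.

Definition place_coord e z : C :=
  match e with
  | inl k => toC (z.1 0 k)
  | inr (inl j) => z.2 0 j
  | inr (inr j) => conjc (z.2 0 j : C)
  end.

Lemma place_embedding_inj e e' :
  place_embedding e =1 place_embedding e' -> e = e'.
Proof.
have nonreal_toC j (f : F -> R) : ~ (cplx_place (i := S) j =1 (fun x => toC (f x))).
  by move=> H; have [x] := cplx_place_nonreal j; rewrite H eqxx.
have nonreal_conj j : ~ (forall x, cplx_place (i := S) j x = conjc (cplx_place j x)).
  move=> H; have [x] := cplx_place_nonreal j; move: (H x).
  case: (cplx_place j x) => u v /= [/eqP]; rewrite -subr_eq0 opprK => /eqP.
  by move=> v0 /eqP; apply; lra.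
have uniq_j j j' : (cplx_place (i := S) j =1 cplx_place j' \/
    forall x, cplx_place j x = conjc (cplx_place j' x)) -> j = j'.
  move=> H; have [k [_ kuniq]] := @cplx_placeP F R S _ (cplx_place_nonreal j).
  by rewrite -(kuniq j (or_introl (frefl _))) (kuniq j' H).
case: e => [k|[j|j]]; case: e' => [k'|[j'|j']] H //.
- have [l [_ luniq]] := real_placeP S (real_place k).
  congr inl; rewrite -(luniq k (frefl _)); apply: luniq => x.
  by have [] := H x.
- by exfalso; apply: (nonreal_toC j' (real_place k)) => x; rewrite -(H x).
- exfalso; apply: (nonreal_toC j' (real_place k)) => x.
  by rewrite -[LHS]conjcK -[conjc (cplx_place j' x)](H x) /= oppr0.
- by exfalso; apply: (nonreal_toC j (real_place k')) => x; rewrite (H x).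
- by congr (inr (inl _)); apply: uniq_j; left.
- exfalso; have jj' := uniq_j _ _ (or_intror H); subst j'.
  by apply: (nonreal_conj j).
- exfalso; apply: (nonreal_toC j (real_place k')) => x.
  by rewrite -[LHS]conjcK [conjc (cplx_place j x)](H x) /= oppr0.
- exfalso; have H' x : cplx_place j' x = conjc (cplx_place j x) by rewrite -(H x).
  have jj' := uniq_j _ _ (or_intror H'); subst j'.
  by apply: (nonreal_conj j).
- congr (inr (inr _)); apply: uniq_j; left => x.
  by rewrite -[LHS]conjcK [conjc (cplx_place j x)](H x) conjcK.
Qed.

Lemma place_embedding_surj (t : {rmorphism F -> C}) :
  exists e, t =1 place_embedding e.
Proof.
have [tn|treal] := pselect (nonreal t).
  have [j [[tj|tj] _]] := @cplx_placeP F R S _ tn; first by exists (inr (inl j)).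
  by exists (inr (inr j)).
have tE x : t x = toC (Re (t x)).
  case tx : (t x) => [u v] /=; congr (_ +i* _)%C.
  apply/eqP/negPn/negP => v0; apply: treal; by exists x; rewrite tx.
pose r x := Re (t x).
have rB : zmod_morphism r.
  by move=> x y; rewrite /r rmorphB; case: (t x) (t y) => [? ?] [].
have rM : monoid_morphism r.
  split; first by rewrite /r rmorph1.
  by move=> x y; rewrite /r rmorphM (tE x) (tE y) /= mul0r subr0.
pose r' : {rmorphism F -> R} := HB.pack r
  (GRing.isZmodMorphism.Build _ _ r rB) (GRing.isMonoidMorphism.Build _ _ r rM).
have [k [rk _]] := real_placeP S r'.
by exists (inl k) => x /=; rewrite tE -(rk x).
Qed.

(** The places account for every complex embedding exactly once; in particular
    their number, with multiplicity, is the degree of the field. *)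
Lemma place_numbering : exists2 io : 'I_n -> E, bijective io &
  forall c : 'rV[C]_n, (forall x, \sum_k c 0 k * place_embedding (io k) x = 0) -> c = 0.
Proof.
have [t [tinj tsurj tfree]] := embeddings_exist F C.
have /choice[io ioE] k := place_embedding_surj (t k).
have /choice[oi oiE] e := tsurj (place_embedding e).
exists io.
  exists oi => [k|e].
    by apply: tinj => x; rewrite -oiE -ioE.
  by apply: place_embedding_inj => x; rewrite -ioE -oiE.
move=> c c0; apply: tfree => x; rewrite -[RHS](c0 x).
by apply: eq_bigr => k _; rewrite ioE.
Qed.

Definition basis_map b s : tensorR S :=
  (\row_k \sum_i s 0 i * real_place k (b i),
   \row_j \sum_i toC (s 0 i) * cplx_place j (b i)).

Lemma basis_mapD b s s' : basis_map b (s + s') = basis_map b s + basis_map b s'.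
Proof.
congr (_, _); apply/rowP => k; rewrite !mxE -big_split; apply: eq_bigr => i _.
  by rewrite mxE mulrDl.
by rewrite mxE rmorphD mulrDl.
Qed.

Lemma basis_map_int b (k : 'rV[int]_n) :
  basis_map b (map_mx intr k) = canon S (int_comb b k).
Proof.
congr (_, _); apply/rowP => j; rewrite !mxE rmorph_sum; apply: eq_bigr => i _.
  by rewrite mxE rmorphMz mulrzl.
have toCz (m : int) : toC m%:~R = m%:~R by exact: (rmorph_int toC).
rewrite mxE [RHS]rmorphMz -[RHS]mulrzl; congr (_ * _); exact: toCz.
Qed.

Lemma place_coord_basis e b s : place_coord e (basis_map b s) =
  \sum_i toC (s 0 i) * place_embedding e (b i).
Proof.
case: e => [k|[j|j]] /=; rewrite mxE ?rmorph_sum//=; apply: eq_bigr => i _.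
  by rewrite rmorphM.
by rewrite rmorphM/= oppr0.
Qed.

(** The conjugate of a solution of the linear system given by the embeddings is
    a solution for the conjugate data, so its real part is a solution. *)
Lemma basis_map_surj b z : trace_disc b != 0 -> exists s, z = basis_map b s.
Proof.
move=> b0; have [io [oi ioK oiK] iofree] := place_numbering.
pose M : 'M[C]_n := \matrix_(k, i) place_embedding (io k) (b i).
have MU : M \in unitmx.
  rewrite unitmxE unitfE -sqrf_eq0.
  by rewrite -(trace_disc_embeddings (s := fun k => place_embedding (io k)) b iofree) fmorph_eq0.
pose v : 'cV[C]_n := \col_k place_coord (io k) z.
pose c := invmx M *m v.
have cE e : \sum_i c i 0 * place_embedding e (b i) = place_coord e z.
  have <- : v (oi e) 0 = place_coord e z by rewrite mxE oiK.
  rewrite -(mulKVmx MU v) -/c mxE; apply: eq_bigr => i _.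
  by rewrite [M _ _]mxE oiK mulrC.
have ReD (x y : C) : Re (x + y) = Re x + Re y by case: x y => [? ?] [].
have Re_sum (f : 'I_n -> C) : Re (\sum_i f i) = \sum_i Re (f i).
  by elim/big_rec2: _ => // i x y _ <-; rewrite ReD.
exists (\row_i Re (c i 0)); rewrite [z]surjective_pairing; congr (_, _).
  apply/rowP => k; rewrite mxE.
  have /(congr1 (@complex.Re R)) := cE (inl k); rewrite /= => <-; rewrite Re_sum.
  by apply: eq_bigr => i _; rewrite mxE; case: (c i 0) => u w /=; rewrite mulr0 subr0.
apply/rowP => j; rewrite mxE; have E1 := cE (inr (inl j)); have E2 := cE (inr (inr j)).
have {}E2 : \sum_i conjc (c i 0) * cplx_place j (b i) = z.2 0 j.
  rewrite -[RHS]conjcK -[conjc (z.2 0 j)]E2 rmorph_sum; apply: eq_bigr => i _.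
  by rewrite rmorphM /= conjcK.
have two : (2 : C) != 0 by rewrite pnatr_eq0.
apply: (mulfI two); rewrite mulr_sumr.
transitivity (place_coord (inr (inl j)) z + \sum_i conjc (c i 0) * cplx_place j (b i)).
  by rewrite E2 mulr_natl mulr2n.
rewrite -E1 -big_split; apply: eq_bigr => i _ /=.
rewrite mxE -mulrDl mulrA; congr (_ * _); case: (c i 0) => u w.
by apply/eqP; rewrite eq_complex /=; apply/andP; split; apply/eqP; ring.
Qed.

Section Gram.
Variables (D : arakelov_divisor S).

(** The coefficient [2 e^(-x)] of a complex place is shared equally between its
    two embeddings, which removes the factor [2] from the norm. *)
Definition place_weight e : R :=
  match e with
  | inl k => expR (- 2 * real_coef D k)
  | inr (inl j) | inr (inr j) => expR (- cplx_coef D j)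
  end.

Lemma sqnorm_places z :
  sqnorm D z = \sum_e place_weight e * ComplexField.Normc.normc (place_coord e z) ^+ 2.
Proof.
rewrite /sqnorm !big_sumType/=; congr (_ + _).
  apply: eq_bigr => k _; rewrite mulrC; congr (_ * _).
  by rewrite sqr_sqrtr ?expr0n/= ?addr0 ?sqr_ge0// real_normK ?num_real.
rewrite -big_split; apply: eq_bigr => j _ /=; case: (z.2 0 j) => u v /=.
by rewrite sqrrN; ring.
Qed.

(** The matrix of the scalar product of the norm in the real basis given by a
    [zbasis]. *)
Definition gram b : 'M[R]_n := \matrix_(i, j) \sum_e place_weight e *
  Re (conjc (place_embedding e (b i)) * place_embedding e (b j)).

Lemma normc_comb e b s :
  ComplexField.Normc.normc (\sum_i toC (s 0 i) * place_embedding e (b i)) ^+ 2 =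
  \sum_i \sum_j s 0 i * s 0 j *
    Re (conjc (place_embedding e (b i)) * place_embedding e (b j)).
Proof.
have normE (x : C) : ComplexField.Normc.normc x ^+ 2 = Re (conjc x * x).
  case: x => u v /=; rewrite sqr_sqrtr ?addr_ge0 ?sqr_ge0//; ring.
have ReD (x y : C) : Re (x + y) = Re x + Re y by case: x y => [? ?] [].
have Re_sum (f : 'I_n -> C) : Re (\sum_i f i) = \sum_i Re (f i).
  by elim/big_rec2: _ => // i x y _ <-; rewrite ReD.
rewrite normE rmorph_sum mulr_suml Re_sum; apply: eq_bigr => i _.
rewrite mulr_sumr Re_sum; apply: eq_bigr => j _; rewrite rmorphM/= oppr0.
case: (place_embedding e (b i)) => u v; case: (place_embedding e (b j)) => u' v' /=.
by ring.
Qed.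

Lemma sqnorm_basis b s : sqnorm D (basis_map b s) = (s *m gram b *m s^T) 0 0.
Proof.
rewrite sqnorm_places mxE.
under [RHS]eq_bigr => j _.
  rewrite !mxE mulr_suml.
  under eq_bigr => i _ do rewrite mxE mulr_sumr mulr_suml.
  over.
rewrite [RHS]exchange_big/=.
under [RHS]eq_bigr => i _ do rewrite exchange_big/=.
rewrite [RHS]exchange_big/=; apply: eq_bigr => e _.
rewrite place_coord_basis normc_comb mulr_sumr; apply: eq_bigr => i _.
by rewrite mulr_sumr; apply: eq_bigr => j _; ring.
Qed.

(** A vector of norm zero has all its coordinates at the places equal to zero,
    and the matrix of embeddings is invertible. *)
Lemma gram_posdef b : trace_disc b != 0 -> posdef (gram b).
Proof.
move=> b0; split.
  apply/matrixP => i j; rewrite !mxE; apply: eq_bigr => e _; congr (_ * _).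
  case: (place_embedding e (b i)) => u v; case: (place_embedding e (b j)) => u' v' /=.
  by ring.
move=> s s0; rewrite -sqnorm_basis sqnorm_places.
have wt0 e : 0 < place_weight e by case: e => [k|[j|j]]; exact: expR_gt0.
have t0 e : 0 <= place_weight e *
    ComplexField.Normc.normc (place_coord e (basis_map b s)) ^+ 2.
  by rewrite mulr_ge0 ?sqr_ge0// ltW.
rewrite lt_neqAle sumr_ge0// andbT eq_sym; apply: contra_neq s0 => /eqP.
rewrite psumr_eq0// => /allP all0.
have [io [oi ioK oiK] iofree] := place_numbering.
pose M : 'M[C]_n := \matrix_(k, i) place_embedding (io k) (b i).
have MU : M \in unitmx.
  rewrite unitmxE unitfE -sqrf_eq0.
  by rewrite -(trace_disc_embeddings (s := fun k => place_embedding (io k)) b iofree) fmorph_eq0.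
have : M *m (map_mx toC s)^T = 0.
  apply/colP => k; rewrite !mxE.
  have := all0 (io k) (mem_index_enum _).
  rewrite mulf_eq0 (gt_eqF (wt0 _)) sqrf_eq0/= => /eqP/ComplexField.Normc.eq0_normc.
  rewrite place_coord_basis => {2}<-; apply: eq_bigr => i _.
  by rewrite !mxE mulrC.
move=> /(congr1 (mulmx (invmx M))); rewrite mulKmx// mulmx0 => /colP H.
by apply/rowP => i; have := H i; rewrite !mxE => /(congr1 (@complex.Re R)).
Qed.

(** The Gram matrix is [M^* W M], with [M] the matrix of embeddings and [W] the
    diagonal of weights: the factor [|det M|^2] is the discriminant, and the
    product of the weights is the exponential of minus twice the degree at the
    infinite places. *)
Lemma det_gram b : \det (gram b) = `|ratr (trace_disc b)| *
  (expR (\sum_k real_coef D k + \sum_j cplx_coef D j)) ^- 2.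
Proof.
have [io iobij iofree] := place_numbering.
pose M : 'M[C]_n := \matrix_(k, i) place_embedding (io k) (b i).
pose W : 'rV[C]_n := \row_k toC (place_weight (io k)).
have gramE : map_mx toC (gram b) = (map_mx conjc M)^T *m diag_mx W *m M.
  apply/matrixP => i j; rewrite !mxE.
  transitivity (\sum_e toC (place_weight e) *
      (conjc (place_embedding e (b i)) * place_embedding e (b j))).
    rewrite rmorph_sum !big_sumType/= -!big_split/=; congr (_ + _).
      apply: eq_bigr => k _ /=.
      by apply/eqP; rewrite eq_complex /=; apply/andP; split; apply/eqP; ring.
    apply: eq_bigr => l _; case: (cplx_place l (b i)) => u v.
    case: (cplx_place l (b j)) => u' v' /=.
    by apply/eqP; rewrite eq_complex /=; apply/andP; split; apply/eqP; ring.
  rewrite (reindex io)/=; last exact: onW_bij.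
  apply: eq_bigr => k _.
  by rewrite mul_mx_diag !mxE; ring.
have detM : ratr (trace_disc b) = \det M ^+ 2.
  exact: (trace_disc_embeddings (s := fun k => place_embedding (io k)) b iofree).
have prodW : \prod_k W 0 k = toC ((expR (\sum_k real_coef D k + \sum_j cplx_coef D j)) ^- 2).
  transitivity (\prod_k toC (place_weight (io k))).
    by apply: eq_bigr => k _; rewrite mxE.
  rewrite -(reindex io (P := predT) (F := fun e => toC (place_weight e))); last exact: onW_bij.
  rewrite -rmorph_prod; congr toC.
  rewrite !big_sumType/= -big_split/=.
  under eq_bigr do rewrite mulNr expRN.
  under [X in _ * X]eq_bigr do rewrite /= -expRD -opprD expRN.
  rewrite !prodfV -!expR_sum -invfM -expRD; congr (_^-1).
  rewrite expr2 -expRD; congr expR.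
  by rewrite -mulr_sumr big_split/=; ring.
have : toC (\det (gram b)) = toC (`|ratr (trace_disc b)| *
    (expR (\sum_k real_coef D k + \sum_j cplx_coef D j)) ^- 2).
  rewrite -det_map_mx gramE !det_mulmx det_tr det_diag prodW det_map_mx rmorphM.
  rewrite mulrAC; congr (_ * _).
  transitivity (`|ratr (trace_disc b) : C|).
    by rewrite detM normrX sqr_normc mulrC.
  rewrite -(fmorph_eq_rat [the {rmorphism rat -> C} of toC \o ratr]) /=.
  by rewrite normc_def /= expr0n/= addr0 sqrtr_sqr.
by move=> /(congr1 (@complex.Re R)).
Qed.

End Gram.
End Places.

(** * Continuity of theta sums *)

Section DominatedSums.
Local Open Scope ereal_scope.
Variables (R : realType) (X : topologicalType) (I : choiceType).

(** One finite set of indices serves for all the families dominated by [g]. *)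
Lemma esum_tail (A : set I) (g : I -> R) (e : R) : (forall i, 0 <= g i)%R -> (0 < e)%R ->
  \esum_(i in A) (g i)%:E < +oo ->
  exists s : seq I, [/\ uniq s, forall i, i \in s -> A i &
    forall f : I -> R, (forall i, 0 <= f i <= g i)%R ->
      (\sum_(i <- s) f i <= fine (\esum_(i in A) (f i)%:E) <= \sum_(i <- s) f i + e)%R].
Proof.
move=> g0 e0 gfin.
have g0e i : 0 <= (g i)%:E by rewrite lee_fin.
have gf : \esum_(i in A) (g i)%:E \is a fin_num by rewrite ge0_fin_numE// esum_ge0.
have [_ [B [finB BA] <-] HB] := ub_ereal_sup_adherent e0 gf.
pose s : seq I := fset_set B.
have inB i : (i \in s) = (i \in B) by rewrite /s in_fset_set.
have split_sum (f : I -> R) : (forall i, 0 <= f i)%R -> \esum_(i in A) (f i)%:E =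
    (\sum_(i <- s) f i)%:E + \esum_(i in A `&` ~` B) (f i)%:E.
  move=> f0; rewrite (esumID B) => [|i _]; last by rewrite lee_fin.
  rewrite (setIidr BA) esum_fset// => [|i _]; last by rewrite lee_fin.
  by rewrite fsbig_finite// sumEFin.
exists s; split=> [|i|f fg]; first exact: fset_uniq.
  by rewrite inB => /set_mem/BA.
have f0 i : (0 <= f i)%R by have /andP[] := fg i.
have tail_g : \esum_(i in A `&` ~` B) (g i)%:E <= e%:E.
  have {}HB : \esum_(i in A) (g i)%:E - e%:E < (\sum_(i <- s) g i)%:E.
    by move: HB; rewrite fsbig_finite// sumEFin.
  move: HB gf; rewrite split_sum//.
  case: (\esum_(i in _) _) => [r| |]; last 2 first.
  - by move=> _; rewrite addey.
  - by move=> _; rewrite addeNy.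
  by rewrite -!EFinD lte_fin lee_fin => ? _; lra.
have tail_f : \esum_(i in A `&` ~` B) (f i)%:E <= e%:E.
  apply: le_trans tail_g; apply: le_esum => i _; rewrite lee_fin.
  by have /andP[] := fg i.
have tail_f0 : 0 <= \esum_(i in A `&` ~` B) (f i)%:E.
  by apply: esum_ge0 => i _; rewrite lee_fin.
rewrite split_sum//; move: tail_f tail_f0.
by case: (\esum_(i in _) _) => [r|//|//]; rewrite !lee_fin => h1 h2 /=;
  apply/andP; split; lra.
Qed.

(** A dominated family of continuous nonnegative functions has a continuous
    sum: the tails are uniformly small. *)
Lemma dominated_esum_continuous (A : set I) (f : I -> X -> R) (g : I -> R) (x0 : X) :
  (forall i x, 0 <= f i x)%R -> (forall i, 0 <= g i)%R ->
  (forall i, {for x0, continuous (f i)}) ->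
  (\forall x \near x0, forall i, f i x <= g i)%R ->
  \esum_(i in A) (g i)%:E < +oo ->
  {for x0, continuous (fun x => fine (\esum_(i in A) (f i x)%:E))}.
Proof.
move=> f0 g0 fc fg gfin; apply/cvgrPdist_le => /= e e0.
have e30 : (0 < e / 3)%R by rewrite divr_gt0.
have [s [us sA tail]] := esum_tail g0 e30 gfin.
have sc : {for x0, continuous (fun x => \sum_(i <- s) f i x)%R}.
  by apply: (cvg_big (op := +%R)) => // [|i _]; [exact: add_continuous|exact: fc].
have fg0 := nbhs_singleton fg.
have /cvgrPdist_le/(_ _ e30) near_s := sc.
have b0 i : (0 <= f i x0 <= g i)%R by rewrite f0 fg0.
have /andP[l0 u0] := tail (fun i => f i x0) b0.
near=> x.
have bx i : (0 <= f i x <= g i)%R.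
  by rewrite f0/=; move: i; near: x.
have /andP[lx ux] := tail (fun i => f i x) bx.
have : (`|\sum_(i <- s) f i x0 - \sum_(i <- s) f i x| <= e / 3)%R by near: x.
by rewrite !ler_norml => /andP[? ?]; apply/andP; split; lra.
Unshelve. all: by end_near.
Qed.

End DominatedSums.

Section MatrixTopology.
Variables (T : topologicalType).

Lemma rV_coord_continuous (m : nat) (j : 'I_m) :
  continuous (fun M : 'rV[T]_m => M 0 j).
Proof.
move=> M W nW /=; exists (fun _ j' => if j' == j then W else setT).
  by move=> i j'; case: eqP => [->|_]; [rewrite (ord1 i)|exact: filterT].
by move=> N /(_ 0 j); rewrite eqxx.
Qed.

Lemma continuous_rV (X : topologicalType) (m : nat) (f : X -> 'rV[T]_m) (x : X) :
  (forall j, {for x, continuous (fun y => f y 0 j)}) -> {for x, continuous f}.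
Proof.
move=> fc W [P nP PW] /=.
have : \forall y \near x, forall j, P 0 j (f y 0 j).
  by apply: filter_forall => j; apply: fc; exact: nP.
apply: filterS => y Py; apply: PW => i j; rewrite (ord1 i); exact: Py.
Qed.
End MatrixTopology.

Section ComplexTopology.
Variable R : realType.
Local Notation normc := ComplexField.Normc.normc.
Local Notation toC := (real_complex R).

Lemma normc_ge0 (x : R[i]) : 0 <= normc x.
Proof. by case: x => u v; exact: sqrtr_ge0. Qed.

Lemma ball_normc (x y : R[i]^o) (e : R) : ball x (toC e) y <-> normc (x - y) < e.
Proof.
by rewrite -ball_normE /= -[X in X < _]/(toC (normc (x - y))) ltcR.
Qed.

Lemma normc_continuous : continuous (fun x : R[i]^o => normc x : R).
Proof.
move=> x W /nbhs_ballP[e /= e0 eW].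
apply/nbhs_ballP; exists (toC e); first by rewrite /= ltcR.
move=> y /ball_normc xy; apply: eW; rewrite /ball/=; apply: le_lt_trans xy.
have tri (a b : R[i]) : normc a - normc b <= normc (a - b).
  rewrite lerBlDr -{1}[a](subrK b); exact: le_normcD.
rewrite ler_norml tri andbT lerNl opprB (le_trans (tri _ _))//.
by rewrite -normcN opprB.
Qed.

Lemma continuous_real_mul (c : R[i]) : continuous (fun t : R => toC t * c : R[i]^o).
Proof.
move=> t W /nbhs_ballP[e /= e0 eW].
have eE : e = toC (complex.Re e).
  by case: e e0 {eW} => u v; rewrite ltcE /= => /andP[/eqP -> _].
have re0 : 0 < complex.Re e by rewrite eE ltcR in e0.
have c0 : 0 < normc c + 1 by rewrite ltr_wpDl// normc_ge0.
apply/nbhs_ballP; exists (complex.Re e / (normc c + 1)); first by rewrite /= divr_gt0.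
move=> r; rewrite /ball/= ltr_pdivlMr// => tr; apply: eW; rewrite eE.
apply/ball_normc; rewrite -mulrBl -rmorphB ComplexField.Normc.normcM.
apply: le_lt_trans tr; apply: ler_pM => //.
- exact: normc_ge0.
- exact: normc_ge0.
- by rewrite /= expr0n/= addr0 sqrtr_sqr.
- by rewrite lerDl.
Qed.
End ComplexTopology.

Section TensorTopology.
Variables (F : fieldExtType rat) (R : realType) (S : infinite_places F R).
Variable D : arakelov_divisor S.
Local Notation n := (\dim {:F}).
Local Notation V := (tensorR S).

Lemma sqnorm_continuous : continuous (sqnorm D : V -> R).
Proof.
move=> z; rewrite /sqnorm; apply: cvgD; apply: (cvg_big (op := +%R));
  try exact: add_continuous; move=> j _; apply: cvgM; try exact: cvg_cst.
  have c1 : {for z, continuous (fun z : V => z.1 0 j : R)}.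
    move=> W nW; exists ([set M : 'rV[R]_(nreal S) | W (M 0 j)], [set: 'rV[R[i]^o]_(ncplx S)]) => /=.
      by split; [exact: (@rV_coord_continuous R _ j z.1 W nW)|exact: filterT].
    by move=> [M N] [/= ? _].
  apply: (@continuous_comp _ _ _ (fun z : V => z.1 0 j : R) (fun x : R => `|x| ^+ 2)) => //.
  apply: (@continuous_comp _ _ _ (fun x : R => `|x|) (fun y : R => y ^+ 2)).
    exact: norm_continuous.
  exact: exprn_continuous.
have c2 : {for z, continuous (fun z : V => z.2 0 j : R[i]^o)}.
  move=> W nW; exists ([set: 'rV[R]_(nreal S)], [set M : 'rV[R[i]^o]_(ncplx S) | W (M 0 j)]) => /=.
    by split; [exact: filterT|exact: (@rV_coord_continuous R[i]^o _ j z.2 W nW)].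
  by move=> [M N] [/= _ ?].
apply: (@continuous_comp _ _ _ (fun z : V => z.2 0 j : R[i]^o)
  (fun x : R[i]^o => ComplexField.Normc.normc x ^+ 2)) => //.
apply: (@continuous_comp _ _ _ (fun x : R[i]^o => ComplexField.Normc.normc x)
  (fun y : R => y ^+ 2)).
  exact: normc_continuous.
exact: exprn_continuous.
Qed.

Lemma sqnormD_le (z z' : V) : sqnorm D (z + z') <= 2 * sqnorm D z + 2 * sqnorm D z'.
Proof.
have par (p q r c : R) : 0 <= c -> 0 <= p -> p <= q + r ->
    p ^+ 2 * c <= 2 * (q ^+ 2 * c) + 2 * (r ^+ 2 * c).
  move=> c0 p0 pqr; rewrite !mulrA -mulrDl ler_wpM2r//.
  have : p ^+ 2 <= (q + r) ^+ 2 by rewrite ler_sqr ?nnegrE// (le_trans p0).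
  by have := sqr_ge0 (q - r); rewrite !expr2; lra.
rewrite /sqnorm !mulrDr addrACA !mulr_sumr -!big_split.
apply: lerD; apply: ler_sum => j _ /=; rewrite mxE; apply: par.
- exact: expR_ge0.
- exact: normr_ge0.
- exact: ler_normD.
- by rewrite mulr_ge0 ?expR_ge0.
- exact: normc_ge0.
- exact: le_normcD.
Qed.

Lemma basis_line_continuous (b : 'I_n -> F) (i : 'I_n) :
  continuous (fun t : R => basis_map S b (t *: delta_mx 0 i) : V).
Proof.
move=> t.
have E : (fun t : R => basis_map S b (t *: delta_mx 0 i) : V) =
    (fun t : R => (\row_k (t * real_place k (b i)),
      \row_j (real_complex R t * cplx_place j (b i) : R[i]^o))).
  apply/funext => r; congr (_, _); apply/rowP => k; rewrite !mxE (bigD1 i)//= !mxE !eqxx mulr1.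
    by rewrite big1 ?addr0// => l li; rewrite !mxE (negbTE li) andbF mulr0 mul0r.
  by rewrite big1 ?addr0// => l li; rewrite !mxE (negbTE li) andbF mulr0 rmorph0 mul0r.
rewrite E => W [[A B] /= [nA nB] AB].
have nA' : \forall r \near t, A (\row_k (r * real_place k (b i))).
  apply: (@continuous_rV _ _ _ (fun t : R => \row_k (t * real_place k (b i))) t) nA => k.
  rewrite (_ : (fun _ => _) = fun y : R => y * real_place k (b i)).
    by apply: cvgM; [exact: cvg_id|exact: cvg_cst].
  by apply/funext => y; rewrite mxE.
have nB' : \forall r \near t, B (\row_j (real_complex R r * cplx_place j (b i) : R[i]^o)).
  apply: (@continuous_rV _ _ _
    (fun t : R => \row_j (real_complex R t * cplx_place j (b i) : R[i]^o)) t) nB => j.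
  rewrite (_ : (fun _ => _) = fun y : R => real_complex R y * cplx_place j (b i) : R[i]^o).
    exact: continuous_real_mul.
  by apply/funext => y; rewrite mxE.
by apply: filterS2 nA' nB' => r Ar Br; apply: AB.
Qed.

End TensorTopology.

(** * The torus of an Arakelov divisor *)

Lemma reflect_continuous (G : topologicalZmodType) (z : G) :
  continuous (fun x : G => z - x).
Proof.
move=> x; apply: (@continuous_comp _ _ _ (fun x : G => (z, x)) (fun p => p.1 - p.2)).
  by apply: cvg_pair => /=; [exact: cvg_cst|exact: cvg_id].
exact: sub_continuous.
Qed.

Section IdealTorus.
Variables (F : fieldExtType rat) (R : realType) (S : infinite_places F R).
Variable D : arakelov_divisor S.
Local Notation n := (\dim {:F}).
Local Notation V := (tensorR S).
Local Notation T := (torus D).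
Local Notation mu := (@lebesgue_measure R).
Local Notation L := (lattice D).
Local Notation proj := (\pi_(quot_group L)%qT : V -> T).

Variables (b : 'I_n -> F) (U : 'M[R]_n) (d : 'rV[R]_n).
Hypothesis b_basis : zbasis (frac_ideal D) b.
Hypothesis U_tri : unitriangular U.
Hypothesis d_gt0 : forall i, 0 < d 0 i.
Hypothesis gramE : gram D b = U^T *m diag_mx d *m U.

Let b_disc : trace_disc b != 0. Proof. by case: b_basis. Qed.
Let phi s : V := basis_map S b s.
Let theta j s := tail_theta U d j s.

Lemma sqnorm_tail_form s : sqnorm D (phi s) = tail_form U d 0 s.
Proof.
rewrite /phi sqnorm_basis gramE.
have -> : s *m (U^T *m diag_mx d *m U) *m s^T =
    (s *m U^T) *m diag_mx d *m (s *m U^T)^T.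
  by rewrite trmx_mul trmxK !mulmxA.
rewrite mxE; apply: eq_bigr => i _; rewrite mul_mx_diag !mxE.
have -> : \sum_j s 0 j * U^T j i = tri_coord U i s.
  by apply: eq_bigr => j _; rewrite mxE mulrC.
by ring.
Qed.

Lemma sqnorm0 : sqnorm D 0 = 0.
Proof.
rewrite /sqnorm big1 => [|j _]; last by rewrite mxE normr0 expr0n mul0r.
by rewrite add0r big1// => j _; rewrite mxE /= expr0n/= addr0 sqrtr0 expr0n mul0r.
Qed.

Lemma basis_map_inj : injective phi.
Proof.
have [_ pos] := gram_posdef D b_disc.
move=> s s' ss'; apply/eqP; rewrite -subr_eq0; apply/negPn/negP => /pos.
rewrite -sqnorm_basis; suff -> : basis_map S b (s - s') = 0.
  by rewrite sqnorm0 ltxx.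
by apply: (addIr (phi s')); rewrite -basis_mapD subrK add0r.
Qed.

Let point (k : 'rV[int]_n) : V := phi (map_mx intr k).

Lemma lattice_points (y : V) : y \in L <-> exists k, y = point k.
Proof.
have IS := zmod_frac_ideal D.
split=> [/asboolP[x Ix ->]|[k ->]].
  have [k ->] := (zbasis_comb x IS b_basis).1 Ix.
  by exists k; rewrite /point /phi basis_map_int.
apply/asboolP; exists (int_comb b k); last by rewrite /point /phi basis_map_int.
by apply/(zbasis_comb _ IS b_basis); exists k.
Qed.

Lemma point_bij : set_bij [set: 'rV[int]_n] [set y | y \in L] point.
Proof.
split=> [k _|k k' _ _ /basis_map_inj kk'|y /lattice_points[k ->]].
- by apply/lattice_points; exists k.
- apply/rowP => i; move/rowP/(_ i): kk'; rewrite !mxE; exact: intr_inj.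
- by exists k.
Qed.

Let lsum (z : V) : \bar R := (\esum_(y in [set y | y \in L]) (gauss D (z + y))%:E)%E.

Lemma lattice_sum_theta s : lsum (phi s) = theta 0 s.
Proof.
rewrite /lsum (reindex_esum [set: 'rV[int]_n] _ _ _ point_bij) /theta /tail_theta.
have -> : tail_lattice 0 = [set: 'rV[int]_n] by apply/seteqP; split.
apply: eq_esum => k _; rewrite /gauss /point /phi -basis_mapD -/(phi _).
by rewrite sqnorm_tail_form.
Qed.

Lemma basis_map0 : phi 0 = 0.
Proof. by apply: (addrI (phi 0)); rewrite -basis_mapD !addr0. Qed.

Lemma lattice_sum_bound : exists2 C : R, 0 <= C & forall z, (lsum z <= C%:E)%E.
Proof.
have [C C0 CP] := tail_theta_bound U_tri d_gt0 (leq0n n).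
exists C => // z; have [s ->] := basis_map_surj z b_disc.
by rewrite -/(phi s) lattice_sum_theta.
Qed.

Lemma gauss_gt0 (z : V) : 0 < gauss D z. Proof. exact: expR_gt0. Qed.

Lemma lattice_sum_fin z : lsum z \is a fin_num.
Proof.
have [C _ /(_ z) CP] := lattice_sum_bound.
rewrite ge0_fin_numE; first by rewrite (le_lt_trans CP)// ltry.
by apply: esum_ge0 => y _; rewrite lee_fin ltW// gauss_gt0.
Qed.

Lemma lattice_sum_gt0 z : (0 < lsum z)%E.
Proof.
have L0 : [set y | y \in L] 0 by rewrite /= rpred0.
rewrite /lsum (esumID [set 0]) => [|y _]; last by rewrite lee_fin ltW// gauss_gt0.
rewrite (_ : _ `&` _ = [set 0]); last by apply/seteqP; split=> [y []//|y ->].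
rewrite esum_set1 ?lee_fin ?ltW ?gauss_gt0//.
apply: (@lt_le_trans _ _ (gauss D (z + 0))%:E); first by rewrite lte_fin gauss_gt0.
by rewrite leeDl// esum_ge0// => y _; rewrite lee_fin ltW// gauss_gt0.
Qed.

Let Theta : R := fine (lsum 0).

Lemma Theta_gt0 : 0 < Theta.
Proof. by rewrite fine_gt0// lattice_sum_gt0 -ge0_fin_numE ?lattice_sum_fin// ltW// lattice_sum_gt0. Qed.

Lemma lattice_sum_invariant z l : l \in L -> lsum (z + l) = lsum z.
Proof.
move=> lL; rewrite /lsum [RHS](reindex_esum [set y | y \in L] _ (fun y => l + y)).
  by apply: eq_esum => y _; rewrite addrA.
split=> [y /= yL|y y' _ _|y /= yL]; first exact: rpredD.
  exact: addrI.
by exists (y - l); [exact: rpredB|rewrite /= addrC subrK].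
Qed.

Let v : T -> R := quot_weight (gauss D).

(** The weight is defined through a representative of the coset; the sum over
    the lattice is independent of it. *)
Lemma quot_weight_proj z : v (proj z) = fine (lsum z) / Theta.
Proof.
have L0 : (\esum_(y in [set y | y \in L]) (gauss D y)%:E)%E = lsum 0.
  by apply: eq_esum => y _; rewrite add0r.
have vE q : v q = fine (lsum (repr q)) / Theta by rewrite /v /quot_weight L0.
have : proj (repr (proj z)) = proj z by rewrite reprK.
move=> /quot_group_eqP zL; rewrite vE.
by rewrite -(lattice_sum_invariant z zL) addrC subrK.
Qed.

(** Domination: for [z] close to [z0] the inequality
    [|z0 + y|^2 <= 2 |z0 - z|^2 + 2 |z + y|^2] bounds every term by a constant
    times a wider Gaussian in [z0 + y]. *)
Lemma lattice_sum_continuous : continuous (fun z => fine (lsum z)).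
Proof.
move=> z0.
pose g (y : V) : R := expR pi * expR (- pi * (2^-1 * sqnorm D (z0 + y))).
apply: (dominated_esum_continuous (g := g)).
- by move=> y z; rewrite ltW// gauss_gt0.
- by move=> y; rewrite mulr_ge0 ?expR_ge0.
- move=> y; apply: (@continuous_comp _ _ _ (fun z : V => z + y) (gauss D)).
    rewrite (_ : (fun z => _) = fun z => y + z); first exact: translate_continuous.
    by apply/funext => z; rewrite addrC.
  apply: (@continuous_comp _ _ _ (sqnorm D) (fun r : R => expR (- pi * r))).
    exact: sqnorm_continuous.
  apply: (@continuous_comp _ _ _ (fun r : R => - pi * r) (@expR R)).
    by apply: cvgM; [exact: cvg_cst|exact: cvg_id].
  exact: continuous_expR.
- have cont : {for z0, continuous (fun z : V => sqnorm D (z0 - z))}.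
    apply: (@continuous_comp _ _ _ (fun z : V => z0 - z) (sqnorm D)).
      exact: reflect_continuous.
    exact: sqnorm_continuous.
  have : \forall z \near z0, sqnorm D (z0 - z) < 1.
    have nb : nbhs (sqnorm D (z0 - z0)) [set r : R | r < 1].
      apply: open_nbhs_nbhs; split; first exact: open_lt.
      by rewrite /= subrr sqnorm0 ltr01.
    exact: (cont _ nb).
  apply: filterS => z z1 y; rewrite /gauss /g -expRD ler_expR.
  have pi0 : (0 < pi :> R) := pi_gt0 R.
  have : sqnorm D (z0 + y) <= 2 * sqnorm D (z0 - z) + 2 * sqnorm D (z + y).
    by apply: le_trans (sqnormD_le _ _ _); rewrite addrA subrK.
  move: z1; move: (sqnorm D (z0 - z)) (sqnorm D (z + y)) (sqnorm D (z0 + y)) => p q r z1 h.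
  by rewrite -subr_ge0 (_ : _ - _ = pi * (1 - 2^-1 * r + q)); [rewrite mulr_ge0 ?(ltW pi0)//; lra|ring].
pose d2 := 2^-1 *: d.
have d2_gt0 i : 0 < d2 0 i by rewrite mxE mulr_gt0.
have [C C0 CP] := tail_theta_bound U_tri d2_gt0 (leq0n n).
have [s zE] := basis_map_surj z0 b_disc.
apply: (@le_lt_trans _ _ ((expR pi)%:E * C%:E)%E); last by rewrite -EFinM ltry.
rewrite (reindex_esum [set: 'rV[int]_n] _ _ _ point_bij).
under eq_esum do rewrite EFinM.
rewrite ge0_esumZl ?expR_ge0//.
rewrite lee_pmul2l// ?lte_fin ?expR_gt0//.
apply: le_trans (CP s); rewrite /tail_theta.
have -> : tail_lattice 0 = [set: 'rV[int]_n] by apply/seteqP; split.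
apply: le_esum => k _; rewrite zE /point /phi -basis_mapD -/(phi _) sqnorm_tail_form.
rewrite lee_fin ler_expR (_ : tail_form U d2 0 _ = 2^-1 * tail_form U d 0 (s + map_mx intr k))//.
by rewrite /tail_form mulr_sumr; apply: eq_bigr => i _; rewrite [d2 _ _]mxE -mulrA.
Qed.

Lemma quot_weight_continuous : continuous v.
Proof.
apply/(@quotient_continuous V {ideal_quot L} R v).
rewrite (_ : v \o _ = fun z => fine (lsum z) / Theta).
  move=> z; apply: (@continuous_comp _ _ _ (fun z => fine (lsum z)) (fun r : R => r / Theta)).
    exact: lattice_sum_continuous.
  by apply: cvgM; [exact: cvg_id|exact: cvg_cst].
by apply/funext => z; exact: quot_weight_proj.
Qed.

Let circ (i : 'I_n) (t : R) : T := proj (phi (t *: delta_mx 0 i)).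

Lemma circ_circle i : is_circle (circ i).
Proof.
split.
- move=> t; apply: (@continuous_comp _ _ _ (fun t : R => phi (t *: delta_mx 0 i)) proj).
    exact: basis_line_continuous.
  exact: pi_continuous.
- by move=> s t; rewrite /circ scalerDl /phi basis_mapD quot_group_piD.
- rewrite /circ -[0]subr0 -[in RHS](subrr (proj 0)) -quot_group_piB subr0.
  apply/quot_group_eqP; rewrite subr0; apply/lattice_points; exists (delta_mx 0 i).
  rewrite /point scale1r subr0; congr (phi _); apply/rowP => j; rewrite !mxE.
  by case: (_ && _).
Qed.

Let circs : seq (R -> T) := [seq circ i | i <- enum 'I_n].

Lemma circs_circle c : List.In c circs -> is_circle c.
Proof.
rewrite /circs; elim: (enum _) => //= i s IH [<-|/IH//]; exact: circ_circle.
Qed.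

(** The coordinates of a representative of [x] in the basis [b] are parameters
    on the coordinate circles. *)
Lemma circs_gen x : circles_gen circs x.
Proof.
rewrite -[x]reprK; have [s ->] := basis_map_surj (repr x) b_disc.
suff -> : proj (basis_map S b s) = \sum_(i <- enum 'I_n) circ i (s 0 i).
  exact: circles_gen_sum.
rewrite -[LHS]/(proj (phi s)) {1}(row_sum_delta s) big_enum.
have proj0 : proj (phi 0) = 0.
  by apply: (addrI (proj (phi 0))); rewrite -quot_group_piD basis_map0 !addr0.
elim/big_ind2: _ => // s1 x1 s2 x2 <- <-.
by rewrite /phi basis_mapD quot_group_piD.
Qed.

(** The step is a natural number, turned into a coordinate by [insub], so that
    the induction can run up to [n] included. *)
Fixpoint partial_mean (j : nat) : T -> \bar R :=
  if j is j'.+1 then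
    if insub j' is Some i then circle_mean (circ i) (partial_mean j')
    else partial_mean j'
  else EFin \o v.

Lemma quot_weight_ge0 x : 0 <= v x.
Proof.
rewrite -[x]reprK -/(proj _) quot_weight_proj.
by apply: divr_ge0; [apply/fine_ge0/ltW/lattice_sum_gt0|exact/ltW/Theta_gt0].
Qed.

Lemma partial_mean_ge0 j x : (0 <= partial_mean j x)%E.
Proof.
elim: j x => [|j IH] x /=; first by rewrite lee_fin quot_weight_ge0.
by case: insub => [i|]; [exact: circle_mean_ge0|exact: IH].
Qed.

Lemma measurable_partial_mean j :
  measurable_fun setT (partial_mean j : borel T -> \bar R).
Proof.
elim: j => [|j IH] /=.
  by apply/measurable_EFinP; apply: continuous_borel; exact: quot_weight_continuous.
case: insub => [i|//]; apply: measurable_circle_mean => //; first exact: circ_circle.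
exact: partial_mean_ge0.
Qed.

(** The factor in front of the theta series once the first [j] coordinates are
    integrated out. *)
Let scale (j : nat) : R := Theta^-1 * \prod_(i < n | (i < j)%N) (Num.sqrt (d 0 i))^-1.

Lemma scale_gt0 j : 0 < scale j.
Proof.
rewrite mulr_gt0 ?invr_gt0 ?Theta_gt0// prodr_gt0// => i _.
by rewrite invr_gt0 sqrtr_gt0.
Qed.

(** Each step unfolds the sum over one coordinate into a Gaussian integral. *)
Lemma partial_mean_theta j s : (j <= n)%N ->
  partial_mean j (proj (phi s)) = ((scale j)%:E * theta j s)%E.
Proof.
elim: j s => [|j IH] s jn /=.
  rewrite quot_weight_proj /scale big_pred0 ?mulr1// mulrC EFinM lattice_sum_theta.
  by rewrite fineK// -lattice_sum_theta lattice_sum_fin.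
rewrite (insubT (fun k => k < n)%N jn).
set i : 'I_n := Sub j jn.
have ij : j = i :> nat by [].
pose f (t : R) : \bar R := theta j (s + t *: delta_mx 0 i).
have orbit (t : R) : partial_mean j (circ i t + proj (phi s)) = ((scale j)%:E * f t)%E.
  by rewrite /circ -quot_group_piD -basis_mapD addrC IH// ltnW.
have f0 t : (0 <= f t)%E by apply: esum_ge0 => k _; rewrite lee_fin expR_ge0.
have mf : measurable_fun setT f.
  rewrite (_ : f = fun t => ((scale j)^-1%:E * partial_mean j (circ i t + proj (phi s))%R)%E).
    apply: emeasurable_funM; first exact: measurable_cst.
    by apply: circle_orbit_measurable; [exact: circ_circle|exact: measurable_partial_mean].
  by apply/funext => t; rewrite orbit muleA -EFinM mulVf ?mul1e// gt_eqF// scale_gt0.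
have -> : circle_mean (circ i) (partial_mean j) (proj (phi s)) =
    (\int[mu]_(t in `[0%R, 1%R[) ((scale j)%:E * f t))%E.
  by apply: eq_integral => t _; exact: orbit.
have m01 : measurable (`[0, 1[%classic : set R) by exact: measurable_itv.
have sc0 : (0 <= (scale j)%:E)%E by rewrite lee_fin ltW// scale_gt0.
rewrite (ge0_integralZl mu m01 (measurable_funTS mf) (fun t _ => f0 t) sc0).
rewrite /f /theta ij tail_theta_mean// muleA -EFinM; congr (_%:E * _)%E.
rewrite /scale -mulrA; congr (_ * _).
rewrite [RHS](bigD1 i)/=; last by rewrite ij.
rewrite mulrC; congr (_ * _); apply: eq_bigl => l.
by rewrite ltnS [in RHS]leq_eqVlt -val_eqE /=; case: ltngtP.
Qed.

Let m : probability (borel T) R := haar R T.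

(** The circles provide an invariant probability, so the one chosen in the
    definition of [haar] is invariant. *)
Lemma haar_invariant z : invariant m z.
Proof.
have [m0 m0P] := invariant_probability_exists circs_circle.
have := @getPex _ [set m : probability (borel T) R |
        forall (x : T) (A : set (borel T)), measurable A ->
          m [set (x + y : T) | y in A] = m A].
apply; exists m0 => x A mA; exact: m0P (circs_gen x) A mA.
Qed.

Lemma haar_open_gt0 (A : set T) : open A -> A !=set0 -> (0 < m A)%E.
Proof.
apply: (invariant_open_gt0 circs_circle circs_gen); exact: haar_invariant.
Qed.

Let kappa : R := Theta^-1 * \prod_i (Num.sqrt (d 0 i))^-1.

Lemma kappa_gt0 : 0 < kappa.
Proof.
rewrite mulr_gt0 ?invr_gt0 ?Theta_gt0// prodr_gt0// => i _.
by rewrite invr_gt0 sqrtr_gt0.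
Qed.

(** Averaging along one circle after the other preserves the integral and ends
    with a constant. *)
Lemma integral_quot_weight : (\int[m]_x (v x)%:E = kappa%:E)%E.
Proof.
have step j : (\int[m]_x partial_mean j x = \int[m]_x (v x)%:E)%E.
  elim: j => //= j <-; case: insub => [i|//].
  apply: integral_circle_mean; first exact: circ_circle.
  - by move=> t; exact: haar_invariant.
  - exact: measurable_partial_mean.
  - exact: partial_mean_ge0.
rewrite -(step n) (eq_integral (cst kappa%:E)) => [|x _].
  by rewrite integral_cst//= probability_setT mule1.
rewrite -[x]reprK -/(proj _); have [s ->] := basis_map_surj (repr x) b_disc.
rewrite -/(phi s) partial_mean_theta// /theta tail_theta_end mule1; congr _%:E.
by congr (_ * _); apply: eq_bigl => i; rewrite ltn_ord.
Qed.

(** The density is only specified as a continuous function with the right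
    integrals; by [density_le] there is at most one. *)
Lemma haar_density_H1 x : haar_density (second_measure (g := H1 D)) x = v x / kappa.
Proof.
pose M := second_measure (g := H1 D).
have k0 : kappa != 0 by rewrite gt_eqF// kappa_gt0.
have ME A : M A = ((\int[m]_(x in A) (v x)%:E) * kappa^-1%:E)%E.
  rewrite -[LHS]/((\int[m]_(x in A) (v x)%:E) / (\int[m]_x (v x)%:E))%E.
  by rewrite integral_quot_weight inver (negbTE k0).
have hc : continuous (fun x => v x / kappa).
  move=> y; apply: (@continuous_comp _ _ _ v (fun r : R => r / kappa)).
    exact: quot_weight_continuous.
  by apply: cvgM; [exact: cvg_id|exact: cvg_cst].
have hM A : measurable (A : set (borel T)) -> M A = (\int[m]_(x in A) (v x / kappa)%:E)%E.
  move=> mA; rewrite ME muleC -ge0_integralZl//.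
  - by apply: eq_integral => y _; rewrite -EFinM mulrC.
  - apply: measurable_funTS; exact: (measurable_partial_mean 0).
  - by move=> y _; rewrite lee_fin quot_weight_ge0.
  - by rewrite lee_fin invr_ge0 ltW// kappa_gt0.
rewrite /haar_density; set P := (X in xget _ X).
have [dc dM] : P (xget (fun=> 0) P).
  by apply: xgetPex; exists (fun x => v x / kappa).
have eqM A : measurable (A : set (borel T)) ->
    (\int[m]_(y in A) (xget (fun=> 0) P y)%:E = \int[m]_(y in A) (v y / kappa)%:E)%E.
  by move=> mA; exact: etrans (esym (dM A mA)) (hM A mA).
apply/eqP; rewrite eq_le; apply/andP; split.
  exact: (density_le haar_open_gt0 dc hc eqM).
apply: (density_le haar_open_gt0 hc dc) => A mA; exact/esym/eqM.
Qed.

Lemma quot_weight0 : v 0 = 1.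
Proof.
have -> : (0 : T) = proj (phi 0).
  by apply: (addrI (proj (phi 0))); rewrite -quot_group_piD basis_map0 !addr0.
by rewrite quot_weight_proj basis_map0 divff// gt_eqF// Theta_gt0.
Qed.

Lemma h1_kappa : h1 D = (- ln kappa)%:E.
Proof.
rewrite /h1 /dim_second haar_density_H1 -/v quot_weight0 mul1r.
by rewrite lne_EFin ?invr_gt0 ?kappa_gt0// lnV// posrE kappa_gt0.
Qed.

Lemma h0_Theta : h0 D = (ln Theta)%:E.
Proof.
have IS := zmod_frac_ideal D.
have inI k : int_comb b k \in frac_ideal_pred D.
  by apply/asboolP/(zbasis_comb _ IS b_basis); exists k.
pose e k : ideal_group D := exist _ (int_comb b k) (inI k).
rewrite /h0 /dim_first.
suff -> : (\esum_(x in [set: H0 D]) (first_weight x)%:E)%E = lsum 0.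
  by rewrite -(fineK (lattice_sum_fin 0)) lne_EFin// Theta_gt0.
rewrite (reindex_esum [set: 'rV[int]_n] _ e); last first.
  split=> [//|k k' _ _ /(congr1 val)/= kk'|x _].
    apply/eqP; rewrite -subr_eq0; apply/eqP/(int_comb_inj b_disc).
    by rewrite int_combB kk' subrr.
  have /asboolP/(zbasis_comb _ IS b_basis)[k xk] := valP x.
  by exists k => //; apply: val_inj.
rewrite /lsum (reindex_esum [set: 'rV[int]_n] _ _ _ point_bij).
by apply: eq_esum => k _; rewrite /= add0r /point /phi basis_map_int.
Qed.

(** In the sum of the two logarithms the theta series cancels. *)
Lemma h0_minus_h1 : \det U = 1 -> (h0 D - h1 D = (- (2^-1 * ln (\det (gram D b))))%:E)%E.
Proof.
move=> detU; rewrite h0_Theta h1_kappa -EFinB opprK; congr _%:E.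
rewrite gramE !det_mulmx det_tr detU mul1r mulr1 det_diag.
have prod_gt0 : 0 < \prod_i (Num.sqrt (d 0 i))^-1.
  by apply: prodr_gt0 => i _; rewrite invr_gt0 sqrtr_gt0.
have -> : \prod_i d 0 i = (\prod_i (Num.sqrt (d 0 i))^-1) ^- 2.
  rewrite -prodrXl -prodfV; apply: eq_bigr => i _.
  by rewrite exprVn invrK sqr_sqrtr// ltW.
rewrite /kappa lnM ?posrE ?invr_gt0 ?Theta_gt0// lnV ?posrE ?Theta_gt0//.
by rewrite lnV ?posrE ?exprn_gt0// lnXn// -mulr_natr; field.
Qed.

End IdealTorus.

Lemma ln_exprz (R : realType) (x : R) (k : int) : 0 < x -> ln (x ^ k) = k%:~R * ln x.
Proof.
move=> x0; case: k => k; rewrite ?NegzE -?exprnN /=.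
  by rewrite -exprnP lnXn// mulr_natl.
by rewrite lnV ?posrE ?exprn_gt0// lnXn// mulrNz mulNr mulr_natl.
Qed.

(** The logarithm of [det_gram], with [x] the discriminant of the field, [y] the
    norm of the ideal and [s] the degree at the infinite places. *)
Lemma ln_volume (R : realType) (x y s : R) : 0 < x -> 0 < y ->
  ln (x * y ^+ 2 / expR s ^+ 2) = ln x + 2 * ln y - 2 * s.
Proof.
move=> x0 y0.
have y2 : 0 < y ^+ 2 by rewrite exprn_gt0.
have s2 : 0 < expR s ^+ 2 by rewrite exprn_gt0// expR_gt0.
rewrite lnM ?posrE ?mulr_gt0 ?invr_gt0// lnM ?posrE// lnV ?posrE//.
by rewrite !lnXn ?expR_gt0// expRK -[_ *+ 2]mulr_natl -[s *+ 2]mulr_natl.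
Qed.

Theorem theorem5p3 (R : realType) (F : fieldExtType rat)
    (S : infinite_places F R) (D : arakelov_divisor S) :
  (h0 D - h1 D = (degree D - 2^-1 * ln (ratr `|disc F|))%:E)%E.
Proof.
have [If discI] := frac_ideal_disc D.
have [b bI] := zbasis_frac If.
have b0 : trace_disc b != 0 by case: bI.
have [U [d [U_tri d_gt0 gramE detU]]] := posdef_factor (gram_posdef D b0).
rewrite (h0_minus_h1 bI U_tri d_gt0 gramE detU); congr _%:E.
rewrite det_gram (lattice_discE (frac_submod If) bI) discI.
have disc0 : disc F != 0 by rewrite discE; apply: lattice_disc_neq0; exact: is_frac_ringint.
have r0 : (0 : R) < ratr `|disc F| by rewrite ltr0q normr_gt0.
have N0 (P : max_ideal F) : (0 : R) < (idealN (val P))%:R.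
  by rewrite ltr0n; apply: idealN_gt0; apply/asboolP; exact: valP P.
pose N (P : max_ideal F) : R := (idealN (val P))%:R ^ (- fin_coef D P).
have Npos P : 0 < N P by rewrite exprz_gt0.
have -> : `|ratr (disc F * \prod_(P <- finsupp (fin_coef D))
      ((idealN (val P))%:R ^ (- fin_coef D P)) ^+ 2)| =
    ratr `|disc F| * (\prod_(P <- finsupp (fin_coef D)) N P) ^+ 2 :> R.
  rewrite rmorphM normrM /=; congr (_ * _); first by rewrite ratr_norm.
  rewrite rmorph_prod/= -prodrXl ger0_norm.
    by apply: eq_bigr => P _; rewrite rmorphXn/= fmorphXz/= ratr_nat.
  by apply: prodr_ge0 => P _; rewrite rmorphXn/= sqr_ge0.
have lnprod : ln (\prod_(P <- finsupp (fin_coef D)) N P) =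
    - \sum_(P <- finsupp (fin_coef D)) (fin_coef D P)%:~R * ln (idealN (val P))%:R.
  rewrite -sumrN; elim: (enum_fset _) => [|P s IH].
    by rewrite !big_nil ln1.
  rewrite !big_cons lnM ?posrE//; last exact: prodr_gt0.
  by rewrite IH /N ln_exprz// mulrNz mulNr.
have prodN : 0 < \prod_(P <- finsupp (fin_coef D)) N P by apply: prodr_gt0.
rewrite (ln_volume _ r0 prodN).
rewrite lnprod /degree.
move: (ln _) (\sum_(P <- _) _) (\sum_k _) (\sum_j _) => lnD p c r; by field.
Qed.
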